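(* Let $n,N,M\ge 1$ be integers with $M\ge N$. Let $A_0,A_1,\ldots,A_n\in M_N(\mathbb C)$ be Hermitian with $A_i\succeq 0$ for $i=1,\ldots,n$. Let $G_1,\ldots,G_n$ be independent $M\times M$ GUE matrices and put $$H_M=A_0\otimes I_M+\frac1{\sqrt M}\sum_{i=1}^n A_i\otimes G_i .$$ Then $$\mathbb E\lambda_{\max}(H_M)\le \rho_++6\sqrt{\frac{nN}{M}}\,\Bigl\|\sum_{i=1}^n A_i^2\Bigr\|_{\mathrm{op}}^{1/2}.$$
   Context: GUE normalization: $G_i$ is a random Hermitian $M\times M$ matrix with independent centered Gaussian entries on and above the diagonal; diagonal entries are real standard Gaussians $N(0,1)$, and the real and imaginary parts of the off-diagonal entries are independent $N(0,1/2)$. Here $\|\cdot\|_{\mathrm{op}}$ is the operator norm, $Z\succ0$ means Hermitian positive definite, $\succeq 0$ means Hermitian positive semidefinite, and $\lambda_{\max}$ denotes the largest eigenvalue. Define $$\rho_+=\inf_{Z\succ0}\lambda_{\max}\Bigl(A_0+Z+\sum_{i=1}^n A_iZ^{-1}A_i\Bigr),$$ with $Z$ ranging over $M_N(\mathbb C)$. *)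

(* Defs.v *)
From HB Require Import structures.
From mathcomp Require Import all_boot all_order all_algebra.
From mathcomp Require Import sesquilinear spectral.
From mathcomp Require Import complex mxtens.
From mathcomp Require Import all_classical all_reals all_analysis.

Set Implicit Arguments.
Unset Strict Implicit.
Unset Printing Implicit Defensive.

Import Order.TTheory GRing.Theory Num.Theory.
Import numFieldNormedType.Exports.

Local Open Scope classical_set_scope.
Local Open Scope ring_scope.
Local Open Scope complex_scope.
Local Open Scope sesquilinear_scope.

(* In the order of R[i], 0 <= z means that z is real and nonnegative. *)
Definition psdmx (R : realType) (n : nat) (A : 'M[R[i]]_n) : Prop :=
  A \is hermsymmx /\ forall v : 'cV[R[i]]_n, 0 <= (v ^t* *m A *m v) 0 0.

Definition posdefmx (R : realType) (n : nat) (A : 'M[R[i]]_n) : Prop :=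
  A \is hermsymmx /\
  forall v : 'cV[R[i]]_n, v != 0 -> 0 < (v ^t* *m A *m v) 0 0.

(* Used for Hermitian A of positive size only: the set of eigenvalues is then
   a nonempty finite set of reals, and its supremum is a maximum. *)
Definition lambda_max (R : realType) (n : nat) (A : 'M[R[i]]_n) : R :=
  sup [set x : R | eigenvalue A x%:C].

Definition l2norm (R : realType) (n : nat) (v : 'cV[R[i]]_n) : R :=
  Num.sqrt (\sum_(k < n) (complex.Re (v k 0) ^+ 2 + complex.Im (v k 0) ^+ 2)).

Definition opnorm (R : realType) (n : nat) (A : 'M[R[i]]_n) : R :=
  sup [set l2norm (A *m v) | v in [set v : 'cV[R[i]]_n | l2norm v <= 1]].

(* Every value below is at least lambda_max A0 when the A i are Hermitian, so
   this is the infimum of a nonempty set bounded below. *)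
Definition rho_plus (R : realType) (n N : nat) (A0 : 'M[R[i]]_N)
    (A : 'I_n -> 'M[R[i]]_N) : R :=
  inf [set lambda_max (A0 + Z + \sum_(k < n) A k *m invmx Z *m A k)
      | Z in [set Z : 'M[R[i]]_N | posdefmx Z]].

Section random_matrices.
Context (R : realType) (d : measure_display) (T : measurableType d).
Context (P : probability T R).

Definition independent (I : finType) (F : I -> set (set T)) : Prop :=
  forall (J : {set I}) (E : I -> set T), (forall k, k \in J -> F k (E k)) ->
    P (\bigcap_(k in [set` J]) E k) = (\prod_(k in J) P (E k))%E.

(* The sigma-algebra generated by a complex random variable. *)
Definition complex_sigma (z : T -> R[i]) : set (set T) :=
  <<s g_sigma_algebra_preimage (fun w => complex.Re (z w))
      `|` g_sigma_algebra_preimage (fun w => complex.Im (z w)) >>.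

Definition matrix_sigma (M : nat) (G : T -> 'M[R[i]]_M) : set (set T) :=
  <<s \bigcup_(ab in [set: 'I_M * 'I_M])
        complex_sigma (fun w => G w ab.1 ab.2) >>.

(* normal_prob takes the standard deviation as second parameter. *)
Definition centered_normal (X : T -> R) (variance : R) : Prop :=
  measurable_fun [set: T] X /\
  forall B : set R, measurable B ->
    pushforward P X B = normal_prob 0 (Num.sqrt variance) B.

Record is_GUE (M : nat) (G : T -> 'M[R[i]]_M) : Prop := IsGUE {
  GUE_hermitian : forall w, G w \is hermsymmx ;
  GUE_diag : forall a, centered_normal (fun w => complex.Re (G w a a)) 1 ;
  GUE_re : forall a b : 'I_M, (a < b)%N ->
    centered_normal (fun w => complex.Re (G w a b)) (1 / 2) ;
  GUE_im : forall a b : 'I_M, (a < b)%N ->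
    centered_normal (fun w => complex.Im (G w a b)) (1 / 2) ;
  GUE_re_im : forall a b : 'I_M, (a < b)%N ->
    independent (fun c : bool => g_sigma_algebra_preimage
      (fun w => if c then complex.Re (G w a b) else complex.Im (G w a b))) ;
  GUE_entries : independent
    (fun ab : {ab : 'I_M * 'I_M | (ab.1 <= ab.2)%N} =>
       complex_sigma (fun w => G w (val ab).1 (val ab).2)) }.

End random_matrices.

Definition GUE_pencil (R : realType) (T : Type) (n N M : nat)
    (A0 : 'M[R[i]]_N) (A : 'I_n -> 'M[R[i]]_N) (G : 'I_n -> T -> 'M[R[i]]_M)
    (w : T) : 'M[R[i]]_(N * M) :=
  A0 *t 1%:M + ((Num.sqrt (M%:R : R))^-1)%:C *: \sum_(k < n) A k *t G k w.

(* Main.v *)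
(* The largest eigenvalue of H_M is the supremum of Re <v, H_M v> over unit
   vectors v. Writing v as an N x M matrix U and B_i = U^H A_i U, this is the
   Gaussian process tr(A_0 U U^H) + M^(-1/2) sum_i <G_i, B_i>. By the
   Sudakov-Fernique inequality its expected supremum is at most that of
   tr(A_0 U U^H) + 2 M^(-1/2) Re sum_i <Gamma_i, U^H A_i P>, where P = (U U^H)^(1/2)
   and Gamma = (Gamma_1, ..., Gamma_n) is a complex Gaussian M x nN matrix.

   If |Gamma| <= sqrt M + e, Young's inequality with weight Z bounds the new
   process by (1 + e / sqrt M) tr((Z + sum_i A_i Z^-1 A_i) U U^H), while
   Cauchy-Schwarz bounds it by 2 (1 + e / sqrt M) |sum_i A_i^2|^(1/2); mixing the
   two costs only 2 (e / sqrt M) |sum_i A_i^2|^(1/2) over the value of rho_+ at Z.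
   Finally one can choose e with E e <= 3 sqrt(nN): when nN <= M this combines a
   Chevet bound for the stacked real matrix (Re Gamma; Im Gamma) with one for
   (Re Gamma)^T Im Gamma; when nN > M the triangle inequality suffices. *)
From HB Require Import structures.
Require Import Defs.
From mathcomp Require Import all_boot all_order all_algebra.
From mathcomp Require Import sesquilinear spectral.
From mathcomp Require Import complex mxtens.
From mathcomp Require Import all_classical all_reals all_analysis.
From mathcomp Require Import measurable_realfun ring lra.

Import Order.TTheory GRing.Theory Num.Theory.
Import numFieldNormedType.Exports.

Local Open Scope classical_set_scope.
Local Open Scope ring_scope.
Local Open Scope complex_scope.

Set Implicit Arguments.
Unset Strict Implicit.
Unset Printing Implicit Defensive.

(** * The standard normal distribution *)

(** The coefficient of the leading term must be exactly one: [|Gamma|] may exceed [sqrt M] only by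
    an amount of mean O(sqrt(nN)). For Gamma = (X + iY) / sqrt 2 the triangle inequality gives sqrt
    2 times too much. Hence |Gamma v|^2 is expanded: its squared terms belong to the stacked real
    matrix, of norm about sqrt(2M), and its mixed terms to X^T Y, of order sqrt(M nN). The mixing
    step needs e >= 0 at every sample point, so the mean of a positive part (|W| - rho)^+ has to be
    bounded, not only the mean of |W|. Chevet's comparison run on balls with the deterministic
    penalty rho |u| |a| gives this without any concentration inequality. Positivity of the A_i
    enters through <E, A_i E A_i> >= 0, which makes the decoupled increments the larger ones. The
    Sudakov-Fernique inequality is obtained for log-sum-exp by a discrete rotation argument:
    convexity replaces differentiation under the integral, and finite nets give both measurability
    of the suprema and the passage to infinite index sets. The constant 6 is the factor 2 of the
    decoupled process times the 3 in E e <= 3 sqrt(nN). *)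

Section normal_integral.
Import HBNNSimple.
Context {R : realType}.
Local Notation mu := (@lebesgue_measure R).
Local Notation gam := (@normal_prob R 0 1).
Local Notation pdf := (@normal_pdf R 0 1).
Implicit Types f h : R -> R.

(** [normal_prob] of a set is the integral of the density over it, so the formula is immediate for
    indicators; simple functions and monotone convergence carry it to nonnegative [f]. *)
Lemma ge0_integral_normal (f : measurableTypeR R -> \bar R) :
  measurable_fun setT f -> (forall x, 0 <= f x)%E ->
  (\int[gam]_x f x = \int[mu]_x (f x * (pdf x)%:E))%E.
Proof.
move=> mf f0.
pose g := nnsfun_approx measurableT mf.
have cg x : (g n x)%:E @[n --> \oo] --> f x by exact: cvg_nnsfun_approx.
have mpdf : measurable_fun setT (fun x => (pdf x)%:E).
  by apply/measurable_EFinP; exact: measurable_normal_pdf.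
transitivity (limn (fun n => \int[gam]_x (g n x)%:E))%E.
  rewrite -monotone_convergence//.
  - by apply: eq_integral => x _; apply/esym/cvg_lim => //.
  - by move=> n; apply/measurable_EFinP; exact: measurable_funP.
  - by move=> n x _; rewrite lee_fin; exact: fun_ge0.
  - by move=> x _ a b ab; rewrite lee_fin; exact/lefP/nd_nnsfun_approx.
transitivity (limn (fun n => \int[mu]_x ((g n x)%:E * (pdf x)%:E)))%E; last first.
  rewrite -monotone_convergence//.
  - apply: eq_integral => x _; apply/cvg_lim => //.
    apply: cvgeZr => //.
  - by move=> n; apply: emeasurable_funM => //; apply/measurable_EFinP; exact: measurable_funP.
  - move=> n x _; rewrite mule_ge0// lee_fin; first exact: fun_ge0.
    exact: normal_pdf_ge0.
  - move=> x _ a b ab; apply: lee_wpmul2r; first by rewrite lee_fin normal_pdf_ge0.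
    by rewrite lee_fin; exact/lefP/nd_nnsfun_approx.
apply: congr_lim; apply/funext => n.
rewrite integralT_nnsfun sintegralE.
under [RHS]eq_integral => x _ do rewrite fimfunE -fsumEFin//.
transitivity (\int[mu]_x (\sum_(y \in range (g n))
   ((y * \1_(g n @^-1` [set y]) x)%:E * (pdf x)%:E)))%E; last first.
  apply: eq_integral => x _; rewrite ge0_mule_fsuml// => y.
  exact: nnfun_muleindic_ge0.
rewrite ge0_integral_fsum//; last 2 first.
- move=> y; apply: emeasurable_funM => //; apply/measurable_EFinP.
  exact: measurable_funM.
- move=> y x _; rewrite mule_ge0//; first exact: nnfun_muleindic_ge0.
  by rewrite lee_fin normal_pdf_ge0.
apply: eq_fsbigr => y /[!inE] -[z _ <-].
rewrite /normal_prob.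
transitivity (\int[mu]_x ((g n z)%:E * ((\1_(g n @^-1` [set g n z]) x)%:E * (pdf x)%:E)))%E;
  last by apply: eq_integral => x _; rewrite EFinM muleA.
rewrite ge0_integralZl//; last 3 first.
- apply: emeasurable_funM => //; exact/measurable_EFinP.
- by move=> x _; rewrite mule_ge0// lee_fin normal_pdf_ge0.
- by rewrite lee_fin fun_ge0.
congr (_ * _)%E; rewrite /= /normal_prob integral_mkcond; apply: eq_integral => x _.
by rewrite patchE indicE; case: ifPn => _; rewrite ?mul1e ?mul0e.
Qed.

Lemma integrable_normal f : measurable_fun setT f ->
  mu.-integrable setT (fun x => (f x * pdf x)%:E) ->
  gam.-integrable setT (EFin \o f).
Proof.
move=> mf /integrableP[_ fi]; apply/integrableP; split; first exact/measurable_EFinP.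
rewrite ge0_integral_normal//; last by apply: measurableT_comp => //; exact/measurable_EFinP.
apply: le_lt_trans fi; apply: ge0_le_integral => //.
- by move=> x _; rewrite mule_ge0// lee_fin normal_pdf_ge0.
- apply: emeasurable_funM => //; first by apply: measurableT_comp => //; exact/measurable_EFinP.
  by apply/measurable_EFinP; exact: measurable_normal_pdf.
- apply: measurableT_comp => //; apply/measurable_EFinP; apply: measurable_funM => //.
  exact: measurable_normal_pdf.
- by move=> x _ /=; rewrite normrM (ger0_norm (normal_pdf_ge0 _ _ _)) EFinM.
Qed.

Lemma Rintegral_normal f : measurable_fun setT f ->
  mu.-integrable setT (fun x => (f x * pdf x)%:E) ->
  \int[gam]_x f x = \int[mu]_x (f x * pdf x).
Proof.
move=> mf fi; rewrite /Rintegral; congr fine.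
rewrite integralE [RHS]integralE !ge0_integral_normal//; last 2 first.
- by apply: measurable_funeneg; exact/measurable_EFinP.
- by apply: measurable_funepos; exact/measurable_EFinP.
congr (_ - _)%E; apply: eq_integral => x _.
  by rewrite !funeposE EFinM maxe_pMl ?mul0e// lee_fin normal_pdf_ge0.
by rewrite !funenegE EFinM -mulNe maxe_pMl ?mul0e// lee_fin normal_pdf_ge0.
Qed.

(** The fundamental theorem of calculus on the intervals from [- n.+1%:R] to [n.+1%:R], followed by
    dominated convergence. The successor keeps every interval nondegenerate. *)
Lemma integral_derive_eq0 (F f : R -> R) :
  (forall x : R, is_derive x 1 F (f x)) -> continuous f ->
  mu.-integrable setT (EFin \o f) ->
  F n.+1%:R @[n --> \oo] --> 0 -> F (- n.+1%:R) @[n --> \oo] --> 0 ->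
  \int[mu]_x f x = 0.
Proof.
move=> dF cf intf Fy FNy.
have mf : measurable_fun setT (EFin \o f) by case/integrableP : intf.
have mI n : measurable (`[- n.+1%:R, n.+1%:R]%classic : set (measurableTypeR R)).
  exact: measurable_itv.
have mfn n : measurable_fun setT ((EFin \o f) \_ `[- n.+1%:R, n.+1%:R]).
  by apply/(measurable_restrictT _ (mI n)); exact: measurable_funTS.
have fnf : {ae mu, forall x, setT x ->
    ((EFin \o f) \_ `[- n.+1%:R, n.+1%:R]) x @[n --> \oo] --> (EFin \o f) x}.
  apply: aeW => x _; apply: cvg_near_cst; near=> n.
  rewrite patchE ifT// inE/= in_itv/= -ler_norml.
  apply: (@le_trans _ _ n%:R); last by rewrite ler_nat.
  by near: n; exact: nbhs_infty_ger.
have fnle : {ae mu, forall (x : R) (n : nat), setT x ->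
    (`|((EFin \o f) \_ `[(- n.+1%:R)%R, n.+1%:R%R]) x| <= (abse \o (EFin \o f)) x)%E}.
  by apply: aeW => x n _; rewrite patchE; case: ifP => _ //=; rewrite normr0 lee_fin.
have [_ _ lim] := @dominated_convergence _ (measurableTypeR R) R mu setT measurableT _ _ _ mfn mf fnf (integrable_abse intf) fnle.
have FTC n : (\int[mu]_x ((EFin \o f) \_ `[(- n.+1%:R)%R, n.+1%:R%R]) x)%E =
    (F n.+1%:R - F (- n.+1%:R))%:E.
  rewrite -integral_mkcond EFinB; apply: continuous_FTC2.
  - by rewrite -subr_gt0 opprK -natrD ltr0n.
  - by apply: continuous_subspaceT => x; exact: cf.
  - split.
    + by move=> x _; case: (dF x).
    + by apply: cvg_at_right_filter; apply: differentiable_continuous;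
        apply/derivable1_diffP; case: (dF (- n.+1%:R)).
    + by apply: cvg_at_left_filter; apply: differentiable_continuous;
        apply/derivable1_diffP; case: (dF n.+1%:R).
  - by move=> x _; rewrite derive1E; apply: derive_val; exact: dF.
have lim0 : (fun n => \int[mu]_x ((EFin \o f) \_ `[(- n.+1%:R)%R, n.+1%:R%R]) x)%E @ \oo
    --> 0%:E.
  under eq_fun do rewrite FTC.
  apply: cvg_EFin; first exact: nearW.
  by rewrite -[X in _ --> X](subr0 0); exact: cvgB.
by rewrite /Rintegral (cvg_unique _ lim lim0).
Unshelve. all: by end_near.
Qed.

Lemma normal_pdf01E x : pdf x = normal_peak 1 * expR (- (x ^+ 2 / 2)).
Proof.
by rewrite normal_pdfE ?oner_eq0// /normal_fun subr0 expr1n mulNr.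
Qed.

(** A factor [expR (x ^+ 2 / 4)] halves the Gaussian exponent; what remains is a multiple of the
    centered density of variance 2. *)
Lemma normal_growth_integrable f C : measurable_fun setT f ->
  (forall x, `|f x| <= C * expR (x ^+ 2 / 4)) ->
  mu.-integrable setT (fun x => (f x * pdf x)%:E).
Proof.
move=> mf fC.
have s2 : Num.sqrt 2 != 0 :> R by rewrite gt_eqF// sqrtr_gt0.
have pE x : expR (x ^+ 2 / 4) * pdf x =
    (normal_peak 1 / normal_peak (Num.sqrt 2)) * normal_pdf 0 (Num.sqrt 2) x.
  rewrite normal_pdf01E normal_pdfE// /normal_fun subr0 sqr_sqrtr// mulrCA -expRD.
  rewrite mulrA divfK ?gt_eqF ?normal_peak_gt0//; congr (_ * expR _).
  by rewrite -mulr_natr; field.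
have := @integrable_normal_pdf R 0 (Num.sqrt 2).
move/(integrableZl measurableT (C * (normal_peak 1 / normal_peak (Num.sqrt 2)))).
apply: le_integrable => //.
  by apply/measurable_EFinP; apply: measurable_funM => //; exact: measurable_normal_pdf.
move=> x _; rewrite /= lee_fin normrM (ger0_norm (normal_pdf_ge0 _ _ _)).
apply: le_trans (ler_norm _); rewrite -mulrA -pE mulrA.
by apply: ler_wpM2r; rewrite ?normal_pdf_ge0.
Qed.

Lemma cvg_expR_sqr0 C : C * expR (- (n.+1%:R ^+ 2 / 4)) @[n --> \oo] --> (0 : R).
Proof.
rewrite -[X in _ --> X](mulr0 C); apply: cvgMr.
apply: (@squeeze_cvgr _ _ _ _ (fun=> 0) (fun n => 4 * (n.+1%:R)^-1)).
- near=> n; rewrite expR_ge0/= expRN.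
  have n0 : (0 : R) < n.+1%:R by rewrite ltr0n.
  rewrite -lef_pV2 ?posrE ?invr_gt0 ?expR_gt0 ?mulr_gt0 ?invr_gt0//.
  rewrite invrK invfM invrK; apply: le_trans (expR_ge1Dx _).
  nra.
- exact: cvg_cst.
- rewrite -[X in _ --> X](mulr0 4); apply: cvgMr; exact: cvg_harmonic.
Unshelve. all: by end_near.
Qed.

(** Integration by parts: [h \* pdf] has derivative [(h' x - x * h x) * pdf x]. The rate 1/8 leaves
    room for the factor [x], since [|x| <= 4 * expR (x ^+ 2 / 8)] keeps [x * h x] within the rate
    1/4 of [normal_growth_integrable]. *)
Lemma stein_normal (h h' : R -> R) C :
  (forall x : R, is_derive x 1 h (h' x)) -> continuous h' ->
  (forall x, `|h x| <= C * expR (x ^+ 2 / 8)) ->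
  (forall x, `|h' x| <= C * expR (x ^+ 2 / 8)) ->
  [/\ gam.-integrable setT (fun x : R => (x * h x)%:E),
      gam.-integrable setT (fun x => (h' x)%:E) &
      \int[gam]_x (x * h x) = \int[gam]_x h' x].
Proof.
move=> dh ch' hC h'C.
have C0 : 0 <= C.
  have := le_trans (normr_ge0 _) (hC 0).
  by rewrite pmulr_lge0// expR_gt0.
have ch : continuous h.
  by move=> x; apply: differentiable_continuous; apply/derivable1_diffP; case: (dh x).
have mh : measurable_fun setT h by exact: continuous_measurable_fun.
have mh' : measurable_fun setT h' by exact: continuous_measurable_fun.
have mxh : measurable_fun setT (fun x : R => x * h x) by exact: measurable_funM.
have e84 (x : R) : expR (x ^+ 2 / 8) <= expR (x ^+ 2 / 4).
  by rewrite ler_expR; have := sqr_ge0 x; lra.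
have i1 : mu.-integrable setT (fun x : R => (x * h x * pdf x)%:E).
  apply: (@normal_growth_integrable _ (4 * C)) => // x.
  rewrite normrM (_ : x ^+ 2 / 4 = x ^+ 2 / 8 + x ^+ 2 / 8); last by field.
  rewrite expRD mulrACA; apply: ler_pM => //.
  apply: (@le_trans _ _ (4 * (1 + x ^+ 2 / 8))); last by rewrite ler_pM2l// expR_ge1Dx.
  have := sqr_ge0 (`|x| - 1); rewrite sqrrB real_normK ?num_real// => ?; lra.
have i2 : mu.-integrable setT (fun x => (h' x * pdf x)%:E).
  apply: (@normal_growth_integrable _ C) => // x.
  by apply: le_trans (h'C x) _; rewrite ler_wpM2l.
split; [exact: integrable_normal|exact: integrable_normal|].
rewrite !Rintegral_normal//; apply/eqP; rewrite eq_sym -subr_eq0 -RintegralB//.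
have dp (x : R) : is_derive x 1 pdf (- x * pdf x).
  rewrite (_ : pdf = fun x => normal_peak 1 * expR (- (x ^+ 2 / 2))); last first.
    by apply/funext => y; rewrite normal_pdf01E.
  have dg : is_derive x 1 (fun y : R => - (y ^+ 2 / 2)) (- x).
    have := is_deriveZ (- 2^-1) (is_deriveX 2 (is_derive_id x (1 : R))).
    rewrite (_ : - 2^-1 \*: (id ^+ 2) = (fun y : R => - (y ^+ 2 / 2))); last first.
      by apply/funext => y; change (- 2^-1 * (y * y) = - (y ^+ 2 / 2)); field.
    by move/is_derive_eq; apply; rewrite /GRing.scale/=; field.
  have := is_deriveZ (normal_peak 1) (is_derive1_comp (is_derive_expR _) dg).
  by move/is_derive_eq; apply; rewrite /GRing.scale/=; ring.
have tail (x : R) : `|h x * pdf x| <= (C * normal_peak 1) * expR (- (x ^+ 2 / 4)).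
  rewrite normrM (ger0_norm (normal_pdf_ge0 _ _ _)) normal_pdf01E mulrCA mulrC mulrAC.
  rewrite [leRHS]mulrAC [leLHS]mulrAC; apply: ler_wpM2r; first exact: normal_peak_ge0.
  have -> : - (x ^+ 2 / 4) = (x ^+ 2 / 4) + - (x ^+ 2 / 2) by field.
  rewrite expRD mulrA; apply: ler_wpM2r; first exact: expR_ge0.
  by apply: le_trans (hC x) _; rewrite ler_wpM2l.
have e0 := cvg_expR_sqr0 (C * normal_peak 1).
have e0' : - (C * normal_peak 1 * expR (- (n.+1%:R ^+ 2 / 4))) @[n --> \oo] --> (0 : R).
  by rewrite -oppr0; exact: cvgN.
apply/eqP; apply: (@integral_derive_eq0 (h \* pdf)).
- move=> x; have := is_deriveM (dh x) (dp x).
  by move/is_derive_eq; apply; rewrite /GRing.scale/=; ring.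
- move=> x; apply: cvgB; apply: cvgM; [exact: ch'| |apply: cvgM; [exact: cvg_id|exact: ch]|];
    by apply: continuous_normal_pdf; rewrite oner_eq0.
- by have := integrableB measurableT i2 i1.
- apply: (squeeze_cvgr _ e0' e0).
  by apply: nearW => n; rewrite -ler_norml; exact: tail.
- apply: (squeeze_cvgr _ e0' e0).
  by apply: nearW => n; rewrite -ler_norml -(sqrrN n.+1%:R); exact: tail.
Qed.

(** Stein's identity for [h] equal to 1, [x] and [x ^+ 3]. The fourth moment serves for the variance
    of the squared norm of a Gaussian vector. *)
Lemma normal_moments :
  [/\ gam.-integrable setT (fun x : R => x%:E),
      gam.-integrable setT (fun x : R => (x ^+ 2)%:E),
      gam.-integrable setT (fun x : R => (x ^+ 4)%:E),
      \int[gam]_x x = 0 &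
      \int[gam]_x (x ^+ 2) = 1 /\ \int[gam]_x (x ^+ 4) = 3].
Proof.
have e1 (x : R) : 1 <= expR (x ^+ 2 / 8).
  by rewrite -[leLHS]expR0 ler_expR; have := sqr_ge0 x; lra.
have [i1 _ E1] := @stein_normal (fun=> 1) (fun=> 0) 1
  (fun x => is_derive_cst (1 : R) x 1) (fun x => cvg_cst _)
  (fun x => ltac:(by rewrite normr1 mul1r)) (fun x => ltac:(by rewrite normr0 mul1r expR_ge0)).
(* A third of the rate 1/8, so that the cube of this bound is still admissible for
   [h x = x ^+ 3]. *)
have ax (x : R) : `|x| <= 3 * expR (x ^+ 2 / 24).
  apply: (@le_trans _ _ (3 * (1 + x ^+ 2 / 24))); last by rewrite ler_pM2l// expR_ge1Dx.
  have := sqr_ge0 (`|x| - 4); rewrite sqrrB real_normK ?num_real// => ?; lra.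
have e24 (x : R) n : (n <= 3)%N -> expR (x ^+ 2 / 24) ^+ n <= expR (x ^+ 2 / 8).
  move=> n3; rewrite -expRM_natl ler_expR.
  have : n%:R <= 3 :> R by rewrite ler_nat.
  have := sqr_ge0 x; nra.
have b2 (x : R) : `|id x| <= 3 * expR (x ^+ 2 / 8).
  by apply: le_trans (ax x) _; rewrite ler_pM2l// (le_trans _ (e24 x 1 _)).
have b2' (x : R) : `|(1 : R)| <= 3 * expR (x ^+ 2 / 8).
  by rewrite normr1; have := e1 x; lra.
have [i2 _ E2] := @stein_normal id (fun=> 1) 3
  (fun x => is_derive_id x 1) (fun x => cvg_cst _) b2 b2'.
have d3 (x : R) : is_derive x 1 (fun x : R => x ^+ 3) (3 * x ^+ 2).
  have := is_deriveX 3 (is_derive_id x (1 : R)).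
  by move/is_derive_eq; apply; rewrite /GRing.scale/=; ring.
have c3 : continuous (fun x : R => 3 * x ^+ 2).
  by move=> x; apply: cvgM; [exact: cvg_cst|exact: sqr_continuous].
have b3 (x : R) : `|x ^+ 3| <= 27 * expR (x ^+ 2 / 8).
  rewrite normrX; apply: (@le_trans _ _ ((3 * expR (x ^+ 2 / 24)) ^+ 3)).
    by rewrite lerXn2r ?nnegrE ?mulr_ge0 ?expR_ge0.
  by rewrite exprMn -natrX ler_pM2l ?e24.
have b3' (x : R) : `|3 * x ^+ 2| <= 27 * expR (x ^+ 2 / 8).
  rewrite normrM normrX; apply: (@le_trans _ _ (3 * (3 * expR (x ^+ 2 / 24)) ^+ 2)).
    by rewrite ger0_norm// ler_pM2l// lerXn2r ?nnegrE ?mulr_ge0 ?expR_ge0.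
  by rewrite exprMn mulrA -natrX -natrM ler_pM2l ?e24.
have [i4 _ E4] := @stein_normal _ _ 27 d3 c3 b3 b3'.
have {}E1 : \int[gam]_x x = 0.
  transitivity (\int[gam]_x (x * 1)); first by apply: eq_Rintegral => x _; rewrite mulr1.
  by rewrite E1 Rintegral_cst// mul0r.
have {}E2 : \int[gam]_x (x ^+ 2) = 1.
  transitivity (\int[gam]_x (x * x)); first by apply: eq_Rintegral => x _; rewrite expr2.
  by rewrite E2 Rintegral_cst// mul1r /= /normal_prob integral_normal_pdf.
have {}i1 : gam.-integrable setT (fun x : R => x%:E).
  by apply: eq_integrable i1 => // x _; rewrite mulr1.
have {}i2 : gam.-integrable setT (fun x : R => (x ^+ 2)%:E).
  by apply: eq_integrable i2 => // x _; rewrite expr2.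
split => //.
split=> //; transitivity (\int[gam]_x (x * x ^+ 3)).
  by apply: eq_Rintegral => x _; rewrite -exprS.
by rewrite E4 RintegralZl// E2 mulr1.
Qed.

End normal_integral.

(** * Independent standard normal variables *)

Section equal_laws.
Context {R : realType} d1 d2 d3 (T1 : measurableType d1) (T2 : measurableType d2)
  (E : measurableType d3) (P : probability T1 R) (Q : probability T2 R).
Variables (X : T1 -> E) (Y : T2 -> E) (f : E -> R).
Hypotheses (mX : measurable_fun setT X) (mY : measurable_fun setT Y).
Hypothesis lawXY : forall A, measurable A -> P (X @^-1` A) = Q (Y @^-1` A).
Hypothesis mf : measurable_fun setT f.

Lemma eq_law_ge0_integral (h : E -> \bar R) : measurable_fun setT h ->
  (forall x, 0 <= h x)%E -> (\int[P]_w h (X w) = \int[Q]_w h (Y w))%E.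
Proof.
move=> mh h0.
have := @ge0_integral_pushforward _ _ _ _ R X mX P setT h measurableT
  (measurable_funTS mh) (fun x _ => h0 x).
have := @ge0_integral_pushforward _ _ _ _ R Y mY Q setT h measurableT
  (measurable_funTS mh) (fun x _ => h0 x).
rewrite !preimage_setT => <- <-.
by apply: eq_measure_integral => A mA _; exact: lawXY.
Qed.

Lemma eq_law_integrable : P.-integrable setT (EFin \o (f \o X)) ->
  Q.-integrable setT (EFin \o (f \o Y)).
Proof.
move=> /integrableP[_ iX]; apply/integrableP; split.
  by apply/measurable_EFinP; exact: measurableT_comp.
rewrite -(@eq_law_ge0_integral (fun x => `|(f x)%:E|)%E)//.
by apply: measurableT_comp => //; exact/measurable_EFinP.
Qed.

Lemma eq_law_Rintegral : \int[P]_w f (X w) = \int[Q]_w f (Y w).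
Proof.
have mEf : measurable_fun setT (EFin \o f) by exact/measurable_EFinP.
rewrite /Rintegral; congr fine; rewrite integralE [RHS]integralE.
congr (_ - _)%E.
  transitivity (\int[P]_w (EFin \o f)^\+ (X w))%E.
    by apply: eq_integral => w _; rewrite !funeposE.
  rewrite eq_law_ge0_integral//; last exact: measurable_funepos.
  by apply: eq_integral => w _; rewrite !funeposE.
transitivity (\int[P]_w (EFin \o f)^\- (X w))%E.
  by apply: eq_integral => w _; rewrite !funenegE.
rewrite eq_law_ge0_integral//; last exact: measurable_funeneg.
by apply: eq_integral => w _; rewrite !funenegE.
Qed.

End equal_laws.

(** * Finite families of independent standard normals *)

Section gaussian_families.
Context {R : realType}.
Local Notation gam := (@normal_prob R 0 1).

(** Boxes are stable under intersection and, for a finite index type, generate the product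
    sigma-algebra; a probability on [vec] is therefore determined by its values on them. *)
Definition vec_rectangles (I : Type) : set (set (I -> R)) :=
  [set A | exists2 B : I -> set R, (forall i, measurable (B i)) &
    A = [set x | forall i, B i (x i)]].

Definition vec (I : Type) := g_sigma_algebraType (@vec_rectangles I).

Lemma measurable_coord (I : finType) (i : I) : measurable_fun setT (fun x : vec I => x i).
Proof.
move=> _ Y mY; rewrite setTI; apply: sub_sigma_algebra.
exists (fun j => if j == i then Y else setT).
  by move=> j; case: ifP => _ //.
apply/seteqP; split => x /=.
  by move=> Yx j; case: eqP => [->|].
by move=> /(_ i); rewrite eqxx.
Qed.

Lemma measurable_to_vec (I : finType) d (T : measurableType d) (g : I -> T -> R) :
  (forall i, measurable_fun setT (g i)) ->
  measurable_fun setT (fun w => (g ^~ w) : vec I).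
Proof.
move=> mg; apply: (@measurability _ _ _ (vec I) _ _ (@vec_rectangles I)) => //.
move=> _ [_ [B mB ->] <-]; rewrite setTI.
rewrite (_ : _ @^-1` _ = \bigcap_(i in setT) (g i @^-1` B i)); last first.
  by apply/seteqP; split => [x Bx i _|x Bx i]; [exact: Bx|exact: (Bx i)].
apply: fin_bigcap_measurable; first exact: finite_finset.
by move=> i _; rewrite -[X in measurable X]setTI; exact: mg.
Qed.

(** One identity encodes both the standard normal marginals and mutual independence: taking [setT]
    at some indices gives the product rule for every subfamily. *)
Definition gauss_family (I : finType) d (T : measurableType d) (P : probability T R)
    (g : I -> T -> R) : Prop :=
  (forall i, measurable_fun setT (g i)) /\
  forall B : I -> set R, (forall i, measurable (B i)) ->
    P (\bigcap_(i in setT) (g i @^-1` B i)) = (\prod_i gam (B i))%E.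

Lemma gauss_family_law (I : finType) d (T : measurableType d) (P : probability T R)
    (g : I -> T -> R) (i : I) (A : set R) :
  gauss_family P g -> measurable A -> P (g i @^-1` A) = gam A.
Proof.
move=> [mg gP] mA; have := gP (fun j => if j == i then A else setT).
rewrite (_ : \bigcap_(_ in _) _ = g i @^-1` A); last first.
  apply/seteqP; split => w /=.
    by move=> /(_ i Logic.I); rewrite /= eqxx.
  by move=> Aw j _ /=; case: eqP => [->|].
move=> ->; last by move=> j; case: ifP.
rewrite (bigD1 i)//= eqxx big1 ?mule1// => j /negPf ->.
by rewrite probability_setT.
Qed.

(** Uniqueness of measures that agree on the pi-system of boxes. The mean of a measurable function
    of the family may thus be computed on any space carrying such a family. *)
Lemma gauss_family_law_unique (I : finType) d (T : measurableType d) (P : probability T R)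
    (g : I -> T -> R) d' (T' : measurableType d') (P' : probability T' R)
    (g' : I -> T' -> R) :
  gauss_family P g -> gauss_family P' g' -> forall A : set (vec I), measurable A ->
  P ((fun w => g ^~ w) @^-1` A) = P' ((fun w => g' ^~ w) @^-1` A).
Proof.
move=> [mg gP] [mg' gP'].
pose X : T -> vec I := fun w => g ^~ w.
pose Y : T' -> vec I := fun w => g' ^~ w.
have mX : measurable_fun setT X by exact: measurable_to_vec.
have mY : measurable_fun setT Y by exact: measurable_to_vec.
pose X' : {mfun T >-> vec I} := HB.pack X (isMeasurableFun.Build _ _ _ _ X mX).
pose Y' : {mfun T' >-> vec I} := HB.pack Y (isMeasurableFun.Build _ _ _ _ Y mY).
move=> A mA.
have preE d0 (S : measurableType d0) (h : I -> S -> R) (B : I -> set R) :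
    (fun w => h ^~ w) @^-1` [set x | forall i, B i (x i)] =
    \bigcap_(i in setT) (h i @^-1` B i).
  by apply/seteqP; split => [x Bx i _|x Bx i]; [exact: Bx|exact: (Bx i)].
have setTE : [set: vec I] = [set x | forall i, setT (x i)].
  by apply/seteqP; split.
apply: (@measure_unique _ R (vec I) (@vec_rectangles I) (fun=> setT) _ _ _ _
  (distribution P X') (distribution P' Y')) => //.
- move=> _ _ [B mB ->] [C mC ->]; exists (fun i => B i `&` C i).
    by move=> i; exact: measurableI.
  apply/seteqP; split => x /=; first by move=> [Bx Cx] i; split.
  by move=> BCx; split => i; have [] := BCx i.
- by move=> _; exists (fun=> setT).
- by rewrite bigcup_const//; exists 0%N.
- move=> _ [B mB ->]; rewrite /distribution /pushforward.
  transitivity (P (\bigcap_(i in setT) (g i @^-1` B i))); first by rewrite -preE.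
  by rewrite gP// -gP'// -preE.
- by move=> _; rewrite (le_lt_trans (probability_le1 _ _))// ltry.
Qed.

Lemma gauss_family_sum (I J : finType) d (T : measurableType d) (P : probability T R)
    (g : I -> T -> R) d' (S : measurableType d') (Q : probability S R) (h : J -> S -> R) :
  gauss_family P g -> gauss_family Q h ->
  gauss_family (P \x Q)%E (fun (ij : I + J) (z : T * S) =>
    match ij with inl i => g i z.1 | inr j => h j z.2 end).
Proof.
move=> [mg gP] [mh hQ]; split.
  by case=> [i|j]; [apply: (measurableT_comp (mg i))|apply: (measurableT_comp (mh j))].
move=> B mB.
rewrite (_ : \bigcap_(_ in _) _ = (\bigcap_(i in setT) (g i @^-1` B (inl i))) `*`
    (\bigcap_(j in setT) (h j @^-1` B (inr j)))); last first.
  apply/seteqP; split => -[x y] /=.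
    move=> H; split => [i _|j _]; [exact: (H (inl i))|exact: (H (inr j))].
  by move=> [H1 H2] [i|j] _; [exact: H1|exact: H2].
apply: etrans; first apply: product_measure1E.
- apply: fin_bigcap_measurable => [|i _]; first exact: finite_finset.
  by rewrite -[X in measurable X]setTI; exact: mg.
- apply: fin_bigcap_measurable => [|i _]; first exact: finite_finset.
  by rewrite -[X in measurable X]setTI; exact: mh.
rewrite big_sumType/=; congr (_ * _)%E.
  exact: (gP (fun i => B (inl i)) (fun i => mB _)).
exact: (hQ (fun i => B (inr i)) (fun i => mB _)).
Qed.

Lemma gauss_family_bij (I J : finType) d (T : measurableType d) (P : probability T R)
    (g : I -> T -> R) (f : J -> I) :
  bijective f -> gauss_family P g -> gauss_family P (g \o f).
Proof.
move=> [f' fK f'K] [mg gP]; split=> [j|B mB]; first exact: mg.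
have := gP (B \o f') (fun i => mB _).
rewrite (reindex f) /=; last by exists f' => i _; [exact: fK|exact: f'K].
under eq_bigr do rewrite fK.
move=> <-; congr (P _); apply/seteqP; split => w /= H i _ /=.
  by have := H (f' i) Logic.I; rewrite /= f'K.
by have := H (f i) Logic.I; rewrite /= fK.
Qed.

Lemma gauss_family_normal : gauss_family gam (fun (_ : unit) (x : R) => x).
Proof.
split=> [i|B mB]; first exact: measurable_id.
rewrite (_ : \bigcap_(_ in _) _ = B tt).
  by rewrite (big_pred1 tt)// => -[].
by apply/seteqP; split => [x /(_ tt Logic.I)|x Bx []].
Qed.

(** The comparison processes need Gaussian variables of their own; they are produced by multiplying
    by one copy of the real line at a time. *)
Lemma gauss_family_exists (I : finType) :
  exists (d : measure_display) (T : measurableType d) (P : probability T R)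
    (g : I -> T -> R), gauss_family P g.
Proof.
suff [d [T [P [g gP]]]] : exists (d : measure_display) (T : measurableType d)
    (P : probability T R) (g : 'I_#|I| -> T -> R), gauss_family P g.
  exists d, T, P, (g \o enum_rank); apply: gauss_family_bij gP.
  by exists enum_val; [exact: enum_rankK|exact: enum_valK].
elim: #|I| => [|n [d [T [P [g gP]]]]].
  exists _, (measurableTypeR R), (normal_prob 0 1 : probability (measurableTypeR R) R), (fun=> id); split => [[]//|B mB].
  rewrite big_ord0 (_ : \bigcap_(_ in _) _ = setT) ?probability_setT//.
  by apply/seteqP; split => // x _ [].
have := gauss_family_sum gP gauss_family_normal.
move/(@gauss_family_bij _ _ _ _ _ _ (fun i : 'I_n.+1 =>
  if unlift ord_max i is Some j then inl j else inr tt)) => H.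
eexists _, _, _, _; apply: H.
exists (fun x => match x with inl j => lift ord_max j | inr _ => ord_max end).
  by move=> i; case: unliftP => [j ->|->].
by case=> [j|[]]; rewrite ?liftK ?unlift_none.
Qed.

Lemma gauss_coord_integrable (I : finType) d (T : measurableType d) (P : probability T R)
    (g : I -> T -> R) (i : I) (f : R -> R) :
  gauss_family P g -> measurable_fun setT f -> gam.-integrable setT (EFin \o f) ->
  P.-integrable setT (EFin \o (f \o g i)).
Proof.
move=> gP mf intf; have [mg _] := gP.
apply: (@eq_law_integrable R _ _ _ _ _ _ (normal_prob 0 1 : probability (measurableTypeR R) R) P id (g i) f) => //.
- exact: mg.
- by move=> A mA; symmetry; exact: (gauss_family_law i gP).
Qed.

Lemma gauss_coord_Rintegral (I : finType) d (T : measurableType d) (P : probability T R)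
    (g : I -> T -> R) (i : I) (f : R -> R) :
  gauss_family P g -> measurable_fun setT f ->
  \int[P]_w f (g i w) = \int[gam]_x f x.
Proof.
move=> gP mf; have [mg _] := gP; symmetry.
apply: (@eq_law_Rintegral R _ _ _ _ _ _ (normal_prob 0 1 : probability (measurableTypeR R) R) P id (g i) f) => //.
- exact: mg.
- by move=> A mA; symmetry; exact: (gauss_family_law i gP).
Qed.

Definition upd (I : finType) (x : I -> R) (k : I) (t : R) : I -> R :=
  fun i => if i == k then t else x i.

(** Replacing coordinate [k] by a fresh independent normal keeps the joint law. Fubini in the fresh
    variable then allows one-dimensional arguments with the other coordinates frozen. *)
Lemma gauss_family_upd (I : finType) d (T : measurableType d) (P : probability T R)
    (g : I -> T -> R) (k : I) : gauss_family P g ->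
  gauss_family (P \x gam)%E (fun i (z : T * R) => upd (g ^~ z.1) k z.2 i).
Proof.
move=> [mg gP]; split=> [i|B mB].
  rewrite /upd; case: eqP => _; first exact: measurable_snd.
  exact: (measurableT_comp (mg i)).
pose B' i := if i == k then setT else B i.
have mB' i : measurable (B' i) by rewrite /B'; case: ifP.
rewrite (_ : \bigcap_(_ in _) _ = (\bigcap_(i in setT) (g i @^-1` B' i)) `*` B k); last first.
  apply/seteqP; split => -[x y] /=.
    move=> H; split => [i _|]; last by have := H k Logic.I; rewrite /= /upd eqxx.
    by have := H i Logic.I; rewrite /= /upd /B'; case: eqP.
  move=> [H Bk] i _; rewrite /= /upd; case: eqP => [->//|/eqP ik].
  by have := H i Logic.I; rewrite /= /B' (negPf ik).
apply: etrans; first apply: product_measure1E.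
- apply: fin_bigcap_measurable => [|i _]; first exact: finite_finset.
  by rewrite -[X in measurable X]setTI; exact: mg.
- exact: mB.
apply: etrans; first exact: (congr1 (fun t => t * _)%E (gP B' mB')).
rewrite (bigD1 k)//= [in RHS](bigD1 k)//= {1}/B' eqxx probability_setT mul1e muleC.
by congr (_ * _)%E; apply: eq_bigr => i /negPf ik; rewrite /B' ik.
Qed.

(** [stein_normal] is applied in the fresh variable of [gauss_family_upd] for almost no cost: [h]
    and [h'] are bounded, so every frozen slice satisfies its growth conditions. *)
Lemma stein_family (I : finType) d (T : measurableType d) (P : probability T R)
    (g : I -> T -> R) (k : I) (h h' : (I -> R) -> R) (C : R) :
  gauss_family P g ->
  measurable_fun setT (h : vec I -> R) -> measurable_fun setT (h' : vec I -> R) ->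
  (forall x (t : R), is_derive t 1 (fun t => h (upd x k t)) (h' (upd x k t))) ->
  (forall x, continuous (fun t => h' (upd x k t))) ->
  (forall x, `|h x| <= C) -> (forall x, `|h' x| <= C) ->
  [/\ P.-integrable setT (fun w => (g k w * h (g ^~ w))%:E),
      P.-integrable setT (fun w => (h' (g ^~ w))%:E) &
      \int[P]_w (g k w * h (g ^~ w)) = \int[P]_w h' (g ^~ w)].
Proof.
move=> gP mh mh' dh ch' hC h'C; have [mg _] := gP.
have uP := gauss_family_upd k gP; have [mu _] := uP.
pose X : T -> vec I := fun w => g ^~ w.
pose Y : T * measurableTypeR R -> vec I := fun z => upd (g ^~ z.1) k z.2.
have mX : measurable_fun setT X by exact: measurable_to_vec.
have mY : measurable_fun setT Y by exact: measurable_to_vec.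
have law := gauss_family_law_unique gP uP.
have mf : measurable_fun setT (fun x : vec I => x k * h x).
  by apply: measurable_funM => //; exact: measurable_coord.
have C0 : 0 <= C by exact: le_trans (normr_ge0 _) (hC (fun=> 0)).
have e1 (x : R) : 1 <= expR (x ^+ 2 / 8).
  by rewrite -[leLHS]expR0 ler_expR; have := sqr_ge0 x; lra.
have st x : [/\ gam.-integrable setT (fun t : R => (t * h (upd x k t))%:E),
      gam.-integrable setT (fun t : R => (h' (upd x k t))%:E) &
      \int[gam]_t (t * h (upd x k t)) = \int[gam]_t h' (upd x k t)].
  apply: (@stein_normal R _ _ C (dh x) (ch' x)) => t.
    by apply: le_trans (hC _) _; rewrite ler_peMr.
  by apply: le_trans (h'C _) _; rewrite ler_peMr.
have i1 : P.-integrable setT (EFin \o (fun w => g k w * h (g ^~ w))).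
  have [ig1 _ _ _ _] := @normal_moments R.
  have := @gauss_coord_integrable I _ _ _ _ k (fun x => x) gP (@measurable_id _ _ _) ig1.
  move/(integrableZl measurableT C); apply: le_integrable => //.
    by apply/measurable_EFinP; exact: (measurableT_comp mf mX).
  by move=> w _ /=; rewrite lee_fin !normrM (ger0_norm C0) mulrC ler_wpM2r.
have i2 : P.-integrable setT (EFin \o (fun w => h' (g ^~ w))).
  apply: (@le_integrable _ _ _ P _ measurableT _ (EFin \o cst C) _ _ (finite_measure_integrable_cst P C measurableT)).
    by apply/measurable_EFinP; exact: (measurableT_comp mh' mX).
  by move=> w _ /=; rewrite lee_fin (ger0_norm C0).
have j1 := eq_law_integrable mX mY law mf i1.
have j2 := eq_law_integrable mX mY law mh' i2.
split => //.
rewrite (eq_law_Rintegral mX mY law mf) (eq_law_Rintegral mX mY law mh').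
rewrite /Rintegral; congr fine.
rewrite -(integral12_prod_meas1 j1) -(integral12_prod_meas1 j2).
apply: eq_integral => w _; rewrite /fubini_F /=.
have [s1 s2 s3] := st (g ^~ w).
transitivity (\int[gam]_t (t * h (upd (g ^~ w) k t))%:E)%E.
  by apply: eq_integral => t _; rewrite /Y /= {1}/upd eqxx.
have f1 := integrable_fin_num measurableT s1.
have f2 := integrable_fin_num measurableT s2.
by rewrite -(fineK f1) -(fineK f2); congr EFin; exact: s3.
Qed.

End gaussian_families.
Arguments vec R I : clear implicits.

(** * Gaussian comparison *)

Section finite_sums.
Context {R : realType} d (T : measurableType d) (P : probability T R).

Lemma integrable_sumr (J : finType) (f : J -> T -> R) :
  (forall j, P.-integrable setT (EFin \o f j)) ->
  P.-integrable setT (EFin \o (fun w => \sum_j f j w)).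
Proof.
move=> fi; have := @integrable_sum _ T R P setT measurableT J (index_enum J) xpredT
  (fun j => EFin \o f j) (fun j _ => fi j).
by apply: eq_integrable => // w _; rewrite /= sumEFin.
Qed.

Lemma Rintegral_sum (J : finType) (f : J -> T -> R) :
  (forall j, P.-integrable setT (EFin \o f j)) ->
  \int[P]_w (\sum_j f j w) = \sum_j \int[P]_w f j w.
Proof.
move=> fi; rewrite /Rintegral sum_fine; last by move=> j _; exact: (integrable_fin_num measurableT (fi j)).
congr fine; rewrite -(@integral_sum _ T R P setT measurableT J (fun j => EFin \o f j) fi).
by apply: eq_integral => w _; rewrite sumEFin.
Qed.

End finite_sums.

(** * Log-sum-exp as a smooth maximum *)

Section softmax.
Context {R : realType} (n : nat).
Implicit Types x y : 'I_n.+1 -> R.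

Definition expsum x := \sum_v expR (x v).
Definition softmax x v := expR (x v) / expsum x.
Definition lse x := ln (expsum x).

Lemma expsum_gt0 x : 0 < expsum x.
Proof.
rewrite /expsum (bigD1 ord0)//= ltr_pwDl ?expR_gt0// sumr_ge0//.
Qed.

Lemma softmax_ge0 x v : 0 <= softmax x v.
Proof. by rewrite divr_ge0 ?expR_ge0 ?ltW ?expsum_gt0. Qed.

Lemma softmax_sum x : \sum_v softmax x v = 1.
Proof. by rewrite -mulr_suml divff// gt_eqF// expsum_gt0. Qed.

Lemma softmax_le1 x v : softmax x v <= 1.
Proof.
rewrite -(softmax_sum x) [leRHS](bigD1 v)//= lerDl sumr_ge0// => w _.
exact: softmax_ge0.
Qed.

(** [softmax x] is the gradient of the convex function [lse], and this is the tangent inequality at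
    [x]. It is Jensen's inequality for [expR] under the weights [softmax x], proved with the tangent
    of [expR] at the mean [m]. *)
Lemma lse_convex x y : \sum_v softmax x v * (y v - x v) <= lse y - lse x.
Proof.
set m := \sum_v _.
have Sx := expsum_gt0 x; have Sy := expsum_gt0 y.
rewrite /lse -ln_div ?posrE// -ler_expR lnK ?posrE ?divr_gt0//.
have -> : expsum y / expsum x = \sum_v softmax x v * expR (y v - x v).
  rewrite mulr_suml; apply: eq_bigr => v _.
  by rewrite /softmax expRD expRN; field; rewrite !gt_eqF// expR_gt0.
have H v : expR m * (softmax x v * (1 + (y v - x v - m))) <=
    softmax x v * expR (y v - x v).
  rewrite mulrCA ler_wpM2l ?softmax_ge0//.
  have -> : expR (y v - x v) = expR m * expR (y v - x v - m).
    by rewrite -expRD; congr expR; ring.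
  by rewrite ler_wpM2l ?expR_ge0 ?expR_ge1Dx.
apply: le_trans (ler_sum _ (fun v _ => H v)).
rewrite -mulr_sumr -[leLHS]mulr1 ler_wpM2l ?expR_ge0//.
under eq_bigr do rewrite mulrDr mulr1 mulrBr.
by rewrite big_split/= softmax_sum sumrB -/m -mulr_suml softmax_sum mul1r subrr addr0.
Qed.

Lemma ler_lse x v : x v <= lse x.
Proof.
rewrite -ler_expR lnK ?posrE ?expsum_gt0// /expsum (bigD1 v)//= lerDl sumr_ge0//.
Qed.

(** With [ler_lse] this places [lse] within [ln n.+1%:R] of the maximum, an error that becomes
    negligible after rescaling by a large factor. *)
Lemma lse_le x b : (forall v, x v <= b) -> lse x <= b + ln n.+1%:R.
Proof.
move=> xb; rewrite -ler_expR lnK ?posrE ?expsum_gt0// expRD lnK ?posrE ?ltr0n//.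
apply: (@le_trans _ _ (\sum_(v < n.+1) expR b)).
  by apply: ler_sum => v _; rewrite ler_expR.
by rewrite sumr_const card_ord mulr_natr.
Qed.

Lemma lse_norm x : `|lse x| <= \sum_v `|x v| + ln n.+1%:R.
Proof.
have xs v : `|x v| <= \sum_v `|x v|.
  by rewrite [leRHS](bigD1 v)//= lerDl sumr_ge0//.
have ln0 : (0 : R) <= ln n.+1%:R by rewrite ln_ge0// ler1n.
rewrite ler_norml lse_le ?andbT; last by move=> v; exact: le_trans (ler_norm _) (xs v).
apply: le_trans (ler_lse x ord0).
by have := xs ord0; have := ler_normlP _ _ (lexx `|x ord0|) => -[]; lra.
Qed.

Lemma is_derive_softmax (al ep : 'I_n.+1 -> R) v (t : R) :
  let x t := fun w => al w + ep w * t in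
  is_derive t 1 (fun t => softmax (x t) v)
    (softmax (x t) v * (ep v - \sum_w softmax (x t) w * ep w)).
Proof.
move=> x.
have dx w : is_derive t 1 (fun t => x t w) (ep w).
  have := is_deriveD (is_derive_cst (al w) t 1) (is_deriveZ (ep w) (is_derive_id t (1 : R))).
  by move/is_derive_eq; apply; rewrite /GRing.scale/=; ring.
have de w : is_derive t 1 (fun t => expR (x t w)) (expR (x t w) * ep w).
  exact: (is_derive1_comp (is_derive_expR _) (dx w)).
have dS : is_derive t 1 (fun t => expsum (x t)) (\sum_w expR (x t w) * ep w).
  have := is_derive_sum de.
  by rewrite (_ : \sum_(i < n.+1) _ = fun t => expsum (x t))//; apply/funext => s; rewrite fct_sumE.
have S0 : expsum (x t) != 0 by rewrite gt_eqF// expsum_gt0.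
have := is_deriveM (de v) (is_deriveV S0 dS).
move/is_derive_eq; apply; rewrite /GRing.scale/= /softmax.
have -> : \sum_w expR (x t w) / expsum (x t) * ep w = (\sum_w expR (x t w) * ep w) / expsum (x t).
  by rewrite mulr_suml; apply: eq_bigr => w _; rewrite mulrAC.
by field.
Qed.

End softmax.

Section gauss_linear.
Context {R : realType} (I : finType).
Implicit Types a b u : I -> R.

Definition dot a b := \sum_i a i * b i.

Lemma dotC a b : dot a b = dot b a.
Proof. by apply: eq_bigr => i _; rewrite mulrC. Qed.

Lemma dotDl a b u : dot (fun i => a i + b i) u = dot a u + dot b u.
Proof. by rewrite /dot -big_split; apply: eq_bigr => i _; rewrite mulrDl. Qed.

Lemma dotZl (k : R) a u : dot (fun i => k * a i) u = k * dot a u.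
Proof. by rewrite /dot mulr_sumr; apply: eq_bigr => i _; rewrite mulrA. Qed.

Lemma dotBl a b u : dot (fun i => a i - b i) u = dot a u - dot b u.
Proof. by rewrite /dot -sumrB; apply: eq_bigr => i _; rewrite mulrBl. Qed.

Lemma dotZr (k : R) a u : dot u (fun i => k * a i) = k * dot u a.
Proof. by rewrite dotC dotZl dotC. Qed.

Lemma dotBr a b u : dot u (fun i => a i - b i) = dot u a - dot u b.
Proof. by rewrite dotC dotBl !(dotC u). Qed.

Lemma dot_upd a x k t : dot a (upd x k t) = dot a (upd x k 0) + a k * t.
Proof.
rewrite /dot (bigD1 k)//= [in RHS](bigD1 k)//= /upd eqxx mulr0 add0r addrC; congr (_ + _).
by apply: eq_bigr => i /negPf ->.
Qed.

Lemma measurable_dot a : measurable_fun setT (dot a : vec R I -> R).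
Proof.
apply: measurable_sum => i; apply: measurable_funM => //; exact: measurable_coord.
Qed.

Context d (T : measurableType d) (P : probability T R) (g : I -> T -> R).
Hypothesis gP : gauss_family P g.

Lemma measurable_family : measurable_fun setT (fun w => (g ^~ w) : vec R I).
Proof. by apply: measurable_to_vec; case: gP. Qed.

Lemma integrable_dot a : P.-integrable setT (EFin \o (fun w => dot a (g ^~ w))).
Proof.
apply: integrable_sumr => i.
have [ig1 _ _ _ _] := @normal_moments R.
exact: (integrableZl measurableT (a i)
  (@gauss_coord_integrable R I _ _ _ _ i (fun x => x) gP (@measurable_id _ _ _) ig1)).
Qed.

Lemma integrable_norm_dot a : P.-integrable setT (EFin \o (fun w => `|dot a (g ^~ w)|)).
Proof. by have := integrable_norm (integrable_dot a). Qed.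

Variable n : nat.
Implicit Types (c : 'I_n.+1 -> R) (e : 'I_n.+1 -> I -> R).

Definition affine c e (x : I -> R) : 'I_n.+1 -> R := fun v => c v + dot (e v) x.

Lemma measurable_affine c e v :
  measurable_fun setT ((fun x => affine c e x v) : vec R I -> R).
Proof. by apply: measurable_funD => //; exact: measurable_dot. Qed.

Lemma measurable_expsum c e :
  measurable_fun setT ((fun x => expsum (affine c e x)) : vec R I -> R).
Proof.
apply: measurable_sum => v; apply: measurableT_comp => //; exact: measurable_affine.
Qed.

Lemma measurable_softmax c e v :
  measurable_fun setT ((fun x => softmax (affine c e x) v) : vec R I -> R).
Proof.
apply: measurable_funM.
  apply: measurableT_comp => //; exact: measurable_affine.
(* The inverse of the positive sum is written through [expR] and [ln], whose measurability is
   available. *)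
rewrite (_ : (fun x => _) = (fun x => expR (- ln (expsum (affine c e x))))).
  apply: measurableT_comp => //; apply: measurableT_comp => //.
  apply: measurableT_comp => //; exact: measurable_expsum.
by apply/funext => x; rewrite expRN lnK// posrE expsum_gt0.
Qed.

Lemma measurable_lse c e :
  measurable_fun setT ((fun x => lse (affine c e x)) : vec R I -> R).
Proof. apply: measurableT_comp => //; exact: measurable_expsum. Qed.

Lemma integrable_lse c e : P.-integrable setT (EFin \o (fun w => lse (affine c e (g ^~ w)))).
Proof.
have H v : P.-integrable setT (EFin \o (fun w => `|affine c e (g ^~ w) v|)).
  apply: integrable_norm; rewrite /affine.
  exact: (integrableD measurableT (finite_measure_integrable_cst P (c v) measurableT)
    (integrable_dot (e v))).
have := integrableD measurableT (integrable_sumr H)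
  (finite_measure_integrable_cst P (ln n.+1%:R) measurableT).
apply: le_integrable => //.
  by apply/measurable_EFinP; apply: (measurableT_comp (@measurable_lse c e) measurable_family).
by move=> w _; rewrite /= lee_fin; apply: le_trans (ler_norm _); exact: lse_norm.
Qed.

(** Gaussian integration by parts in each coordinate, summed with weights [u]; the integrand on the
    right is the derivative of the softmax weight of [v] in the direction [u]. *)
Lemma stein_softmax c e u v :
  [/\ P.-integrable setT (EFin \o
        (fun w => dot u (g ^~ w) * softmax (affine c e (g ^~ w)) v)),
      P.-integrable setT (EFin \o (fun w => softmax (affine c e (g ^~ w)) v *
        (dot u (e v) - \sum_w' softmax (affine c e (g ^~ w)) w' * dot u (e w')))) &
      \int[P]_w (dot u (g ^~ w) * softmax (affine c e (g ^~ w)) v) =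
      \int[P]_w (softmax (affine c e (g ^~ w)) v *
        (dot u (e v) - \sum_w' softmax (affine c e (g ^~ w)) w' * dot u (e w')))].
Proof.
pose h x := softmax (affine c e x) v.
pose h' k x := h x * (e v k - \sum_w softmax (affine c e x) w * e w k).
have mh : measurable_fun setT (h : vec R I -> R) by exact: measurable_softmax.
have mh' k : measurable_fun setT (h' k : vec R I -> R).
  apply: measurable_funM => //; apply: measurable_funB => //.
  by apply: measurable_sum => w; apply: measurable_funM => //; exact: measurable_softmax.
have affE x k t : affine c e (upd x k t) =
    (fun w => (c w + dot (e w) (upd x k 0)) + e w k * t).
  by apply/funext => w; rewrite /affine dot_upd addrA.
have dh k x (t : R) : is_derive t 1 (fun t => h (upd x k t)) (h' k (upd x k t)).
  rewrite /h' /h affE.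
  under [fun t => _]eq_fun do rewrite affE.
  exact: (@is_derive_softmax R n (fun w => c w + dot (e w) (upd x k 0)) (fun w => e w k) v t).
have csm k x w : continuous (fun t : R => softmax (affine c e (upd x k t)) w).
  rewrite (_ : (fun t : R => _) =
      (fun t : R => softmax (fun w' => c w' + dot (e w') (upd x k 0) + e w' k * t) w)).
    2: by apply/funext => t; rewrite affE.
  move=> t; apply: differentiable_continuous; apply/derivable1_diffP.
  by case: (@is_derive_softmax R n (fun w => c w + dot (e w) (upd x k 0)) (fun w => e w k) w t).
have ch' k x : continuous (fun t => h' k (upd x k t)).
  move=> t; apply: cvgM; first exact: csm.
  apply: cvgB; first exact: cvg_cst.
  by apply: cvg_big => [|w _]; [exact: add_continuous|apply: cvgM; [exact: csm|exact: cvg_cst]].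
have hb x : `|h x| <= 1 by rewrite ger0_norm ?softmax_ge0 ?softmax_le1.
pose C k := 1 + (`|e v k| + \sum_w `|e w k|).
have C1 k : 1 <= C k by rewrite lerDl addr_ge0// sumr_ge0.
have h'b k x : `|h' k x| <= C k.
  rewrite normrM -[C k]mul1r; apply: ler_pM => //.
  apply: le_trans (ler_normB _ _) _; rewrite /C -[leLHS]add0r.
  apply: lerD => //; apply: lerD => //.
  apply: le_trans (ler_norm_sum _ _ _) _; apply: ler_sum => w _.
  by rewrite normrM ger0_norm ?softmax_ge0// ler_piMl// softmax_le1.
have st k := stein_family gP mh (mh' k) (dh k) (ch' k) (fun x => le_trans (hb x) (C1 k)) (h'b k).
have i1 k : P.-integrable setT (EFin \o (fun w => u k * (g k w * h (g ^~ w)))).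
  by have [s1 _ _] := st k; exact: (integrableZl measurableT (u k) s1).
have i2 k : P.-integrable setT (EFin \o (fun w => u k * h' k (g ^~ w))).
  by have [_ s2 _] := st k; exact: (integrableZl measurableT (u k) s2).
have E1 w : dot u (g ^~ w) * h (g ^~ w) = \sum_k u k * (g k w * h (g ^~ w)).
  by rewrite mulr_suml; apply: eq_bigr => k _; rewrite mulrA.
have E2 w : h (g ^~ w) * (dot u (e v) - \sum_w' softmax (affine c e (g ^~ w)) w' * dot u (e w'))
    = \sum_k u k * h' k (g ^~ w).
  rewrite /h'; under [RHS]eq_bigr do rewrite mulrCA.
  rewrite -mulr_sumr; congr (_ * _).
  under [RHS]eq_bigr do rewrite mulrBr.
  rewrite sumrB; congr (_ - _).
  under [RHS]eq_bigr do rewrite mulr_sumr.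
  rewrite exchange_big/=; apply: eq_bigr => w' _; rewrite mulr_sumr.
  by apply: eq_bigr => k _; rewrite mulrCA.
split.
- by apply: eq_integrable (integrable_sumr i1) => // w _ /=; rewrite E1.
- by apply: eq_integrable (integrable_sumr i2) => // w _ /=; rewrite E2.
under eq_Rintegral => w _ do rewrite E1.
under [RHS]eq_Rintegral => w _ do rewrite E2.
rewrite !Rintegral_sum//; apply: eq_bigr => k _.
have [s1 s2 s3] := st k.
by rewrite !RintegralZl// s3.
Qed.

End gauss_linear.

Lemma ler_step (R : realType) (x y z u j : R) :
  u <= y -> x - j * y <= z -> x - (j + 1) * y <= z - u.
Proof. by lra. Qed.

Lemma ler_sub_div (R : realType) (x y C : R) :
  (forall m, x - C / m.+1%:R <= y) -> x <= y.
Proof.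
move=> H; rewrite leNgt; apply/negP => xy.
pose m := Num.truncn (C / (x - y)).
have m0 : (0 : R) < m.+1%:R by rewrite ltr0n.
have := H m; apply/negP; rewrite -ltNge ltrBrDr -ltrBrDl ltr_pdivrMr//.
rewrite mulrC -ltr_pdivrMr ?subr_gt0//; exact: truncnS_gt.
Qed.

(** * Rotation between two independent Gaussian processes *)

Section gaussian_interpolation.
Context {R : realType} (I : finType) (n : nat).
Context d (T : measurableType d) (P : probability T R) (g : I -> T -> R).
Hypothesis gP : gauss_family P g.
Variables (c : 'I_n.+1 -> R) (a b : 'I_n.+1 -> I -> R).
Hypothesis ab0 : forall v w, dot (a v) (b w) = 0.
Hypothesis ab_incr : forall v w,
  dot (fun i => a v i - a w i) (fun i => a v i - a w i) <=
  dot (fun i => b v i - b w i) (fun i => b v i - b w i).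

(** Rotation is chosen as interpolation because [e (t + h)] equals [cos h * e t + sin h * e' t]
    exactly, so that a finite step leaves no Taylor remainder. *)
Let e (t : R) v i := cos t * a v i + sin t * b v i.
Let e' (t : R) v i := - sin t * a v i + cos t * b v i.
Let phi t := \int[P]_w lse (affine c (e t) (g ^~ w)).
Let K := \int[P]_w \sum_v (`|dot (a v) (g ^~ w)| + `|dot (b v) (g ^~ w)|).

Let dot_e t v x : dot (e t v) x = cos t * dot (a v) x + sin t * dot (b v) x.
Proof. by rewrite /e dotDl !dotZl. Qed.

Let dot_e' t v x : dot (e' t v) x = - sin t * dot (a v) x + cos t * dot (b v) x.
Proof. by rewrite /e' dotDl !dotZl. Qed.

Let intK v : P.-integrable setT
  (EFin \o (fun w => `|dot (a v) (g ^~ w)| + `|dot (b v) (g ^~ w)|)).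
Proof.
exact: (integrableD measurableT (integrable_norm_dot gP (a v)) (integrable_norm_dot gP (b v))).
Qed.

(** Stein's identity turns the drift into the mean of a double sum with weights [p v * p w].
    Symmetrizing in the two indices, with the mixed products killed by [ab0], leaves [sin t * cos t]
    times the difference of squared increments, which [ab_incr] makes nonnegative. *)
Let drift_ge0 t : 0 <= t <= pi / 2 ->
  0 <= \int[P]_w \sum_v (dot (e' t v) (g ^~ w) * softmax (affine c (e t) (g ^~ w)) v).
Proof.
move=> /andP[t0 tpi].
have s0 : 0 <= sin t by apply: sin_ge0_pi; rewrite t0; have := pi_gt0 R; lra.
have c0 : 0 <= cos t by apply: cos_ge0_pihalf; have := pi_gt0 R; lra.
have st u v := stein_softmax gP c (e t) u v.
rewrite Rintegral_sum; last by move=> v; have [] := st (e' t v) v.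
under eq_bigr => v _ do have [_ _ ->] := st (e' t v) v.
rewrite -Rintegral_sum; last by move=> v; have [] := st (e' t v) v.
apply: Rintegral_ge0 => w _.
set p := softmax _.
have sp : \sum_v p v = 1 by exact: softmax_sum.
have p0 v : 0 <= p v by exact: softmax_ge0.
pose D v w := dot (e' t v) (e t w).
have -> : \sum_v p v * (dot (e' t v) (e t v) - \sum_w' p w' * dot (e' t v) (e t w')) =
    \sum_v \sum_w p v * p w * (D v v - D v w).
  apply: eq_bigr => v _; rewrite -[in LHS](mul1r (dot _ (e t v))) -sp mulr_suml -sumrB mulr_sumr.
  by apply: eq_bigr => w' _; rewrite /D; ring.
have swap : \sum_v \sum_w p v * p w * (D v v - D v w) =
    \sum_v \sum_w p v * p w * (D w w - D w v).
  by rewrite exchange_big/=; apply: eq_bigr => v _; apply: eq_bigr => w' _; rewrite (mulrC (p w')).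
suff : 0 <= \sum_v \sum_w p v * p w * (D v v - D v w) + \sum_v \sum_w p v * p w * (D v v - D v w).
  by lra.
rewrite {2}swap -big_split/= sumr_ge0// => v _; rewrite -big_split/= sumr_ge0// => w' _.
rewrite -mulrDr; apply: mulr_ge0; first exact: mulr_ge0 (p0 v) (p0 w').
have -> : D v v - D v w' + (D w' w' - D w' v) = sin t * cos t *
    (dot (fun i => b v i - b w' i) (fun i => b v i - b w' i) -
     dot (fun i => a v i - a w' i) (fun i => a v i - a w' i)).
  rewrite /D !dot_e' !(dotC (a _) (e _ _)) !(dotC (b _) (e _ _)) !dot_e.
  rewrite !dotBl !dotBr !(dotC (b _) (a _)) !ab0 !mulr0 !addr0 !add0r.
  by rewrite (dotC (a w') (a v)) (dotC (b w') (b v)); ring.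
by rewrite mulr_ge0 ?mulr_ge0// subr_ge0.
Qed.

Let K_ge0 : 0 <= K.
Proof. by apply: Rintegral_ge0 => w _; apply: sumr_ge0 => v _; rewrite addr_ge0. Qed.

Let radial_bound t :
  `|\int[P]_w \sum_v (dot (e t v) (g ^~ w) * softmax (affine c (e t) (g ^~ w)) v)| <= K.
Proof.
have st u v := stein_softmax gP c (e t) u v.
have i1 : P.-integrable setT (EFin \o
    (fun w => \sum_v (dot (e t v) (g ^~ w) * softmax (affine c (e t) (g ^~ w)) v))).
  by apply: integrable_sumr => v; have [] := st (e t v) v.
apply: le_trans (le_normr_Rintegral measurableT i1) _.
apply: le_Rintegral => //; [exact: integrable_norm|exact: integrable_sumr|].
move=> w _; apply: le_trans (ler_norm_sum _ _ _) _; apply: ler_sum => v _.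
rewrite normrM [X in _ * X]ger0_norm ?softmax_ge0//.
apply: le_trans (ler_piMr _ (softmax_le1 _ _)) _ => //.
rewrite dot_e; apply: le_trans (ler_normD _ _) _.
by rewrite !normrM; apply: lerD; apply: ler_piMl => //; [exact: cos_max|exact: sin_max].
Qed.

(** The tangent inequality of [lse] stands in for a derivative of [phi]. The exponent moves by
    [(cos h - 1) * e t + sin h * e' t]: the second part contributes the nonnegative drift, the first
    costs at most [(1 - cos h) * K]. *)
Let phi_step t h : 0 <= t <= pi / 2 -> 0 <= h <= pi ->
  phi t - (1 - cos h) * K <= phi (t + h).
Proof.
move=> tb hb.
have sh : 0 <= sin h by exact: sin_ge0_pi.
have st u v := stein_softmax gP c (e t) u v.
pose S1 w := \sum_v (dot (e t v) (g ^~ w) * softmax (affine c (e t) (g ^~ w)) v).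
pose S2 w := \sum_v (dot (e' t v) (g ^~ w) * softmax (affine c (e t) (g ^~ w)) v).
have i1 : P.-integrable setT (EFin \o S1).
  by apply: integrable_sumr => v; have [] := st (e t v) v.
have i2 : P.-integrable setT (EFin \o S2).
  by apply: integrable_sumr => v; have [] := st (e' t v) v.
have j1 : P.-integrable setT (EFin \o (fun w => (cos h - 1) * S1 w)).
  exact: (integrableZl measurableT _ i1).
have j2 : P.-integrable setT (EFin \o (fun w => sin h * S2 w)).
  exact: (integrableZl measurableT _ i2).
have L s := integrable_lse gP c (e s).
have main : \int[P]_w ((cos h - 1) * S1 w + sin h * S2 w) <= phi (t + h) - phi t.
  rewrite /phi -RintegralB//; apply: le_Rintegral => //.
  - exact: (integrableD measurableT j1 j2).
  - exact: (integrableB measurableT (L _) (L _)).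
  move=> w _; apply: le_trans (lse_convex _ _).
  rewrite /S1 /S2 !mulr_sumr -big_split/= le_eqVlt; apply/orP; left; apply/eqP.
  apply: eq_bigr => v _; rewrite /affine !dot_e dot_e' cosD sinD; ring.
rewrite RintegralD// !RintegralZl// in main.
have := drift_ge0 tb; rewrite -/(S2 _) => dr.
have := radial_bound t; rewrite ler_norml => /andP[_ rb].
have c1 : cos h <= 1 by exact: cos_le1.
have r1 : (1 - cos h) * \int[P]_w S1 w <= (1 - cos h) * K by rewrite ler_wpM2l ?subr_ge0.
have r2 : 0 <= sin h * \int[P]_w S2 w by rewrite mulr_ge0.
move: main r1 r2; clear; move: (phi _) (phi _) (\int[P]_w S1 w) (\int[P]_w S2 w) K (cos h) (sin h).
move=> ? ? ? ? ? ? ?; lra.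
Qed.

(** The loss of a step is quadratic in its length, so that [m] steps of length of order 1/m lose
    only O(1/m) in total. The mean value theorem is applied to [cos] and then to [sin]. *)
Let one_sub_cos (h : R) : 0 <= h <= pi / 2 -> 1 - cos h <= h ^+ 2.
Proof.
move=> /andP[]; rewrite le_eqVlt => /predU1P[<- _|h0 hpi].
  by rewrite cos0 subrr expr0n.
have [x xh Ex] := @MVT R cos (fun x => - sin x) 0 h h0 (fun x _ => is_derive_cos x)
  (continuous_subspaceT (@continuous_cos R)).
move: xh; rewrite in_itv/= => /andP[x0 xh].
have [y yx Ey] := @MVT R sin cos 0 x x0 (fun x _ => is_derive_sin x)
  (continuous_subspaceT (@continuous_sin R)).
move: yx; rewrite in_itv/= => /andP[y0 yx].
rewrite cos0 subr0 in Ex; rewrite sin0 !subr0 in Ey.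
have -> : 1 - cos h = sin x * h by lra.
rewrite expr2; apply: ler_wpM2r; first exact: ltW.
rewrite Ey; apply: le_trans (ltW xh).
by apply: ler_piMl; [exact: ltW|exact: cos_le1].
Qed.

Let phi_iter (h : R) m j : 0 <= h -> h <= pi / 2 -> h <= pi ->
  m%:R * h = pi / 2 -> (j <= m)%N ->
  phi 0 - j%:R * (h ^+ 2 * K) <= phi (j%:R * h).
Proof.
move=> h0 hpi2 hpi mh; elim: j => [_|j IH jm]; first by rewrite !mul0r subr0.
have jh : 0 <= j%:R * h <= pi / 2.
  apply/andP; split; first exact: mulr_ge0.
  by rewrite -mh; apply: ler_wpM2r => //; rewrite ler_nat ltnW.
have hb : 0 <= h <= pi by rewrite h0.
have := phi_step jh hb.
have -> : j.+1%:R * h = j%:R * h + h by rewrite -natr1 mulrDl mul1r.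
apply: le_trans; rewrite -natr1.
have oc : (1 - cos h) * K <= h ^+ 2 * K.
  by apply: ler_wpM2r => //; apply: one_sub_cos; rewrite h0.
exact: ler_step oc (IH (ltnW jm)).
Qed.

Let divn_le (x : R) m : 0 <= x -> x / m.+1%:R <= x.
Proof.
by move=> x0; rewrite ler_pdivrMr ?ltr0n//; apply: ler_peMr => //; rewrite ler1n.
Qed.

Lemma lse_comparison :
  \int[P]_w lse (affine c a (g ^~ w)) <= \int[P]_w lse (affine c b (g ^~ w)).
Proof.
have phi0 : phi 0 = \int[P]_w lse (affine c a (g ^~ w)).
  apply: eq_Rintegral => w _; congr lse; apply/funext => v.
  by rewrite /affine dot_e cos0 sin0 mul1r mul0r addr0.
have phi1 : phi (pi / 2) = \int[P]_w lse (affine c b (g ^~ w)).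
  apply: eq_Rintegral => w _; congr lse; apply/funext => v.
  by rewrite /affine dot_e cos_pihalf sin_pihalf mul1r mul0r add0r.
rewrite -phi0 -phi1.
apply: (@ler_sub_div _ _ _ ((pi / 2) ^+ 2 * K)) => m.
have p2 : 0 <= pi / 2 :> R := divr_ge0 (ltW (pi_gt0 R)) (ler0n _ 2).
have m0 : m.+1%:R != 0 :> R by rewrite pnatr_eq0.
have hE : m.+1%:R * (pi / 2 / m.+1%:R) = pi / 2 :> R.
  by rewrite mulrC divfK.
have := @phi_iter (pi / 2 / m.+1%:R) m.+1 m.+1 (divr_ge0 p2 (ler0n _ _)) (divn_le m p2)
  (le_trans (divn_le m p2) (divn_le 1 (ltW (pi_gt0 R)))) hE (leqnn _).
rewrite hE; congr (_ - _ <= _).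
by rewrite -[in RHS]hE; move: (pi / 2 / _) => h; field.
Qed.

End gaussian_interpolation.

Section separate_spaces.
Context {R : realType} (I J : finType) (n : nat).
Context d (T : measurableType d) (P : probability T R) (g : I -> T -> R).
Context d' (S : measurableType d') (Q : probability S R) (h : J -> S -> R).
Hypothesis gP : gauss_family P g.
Hypothesis hQ : gauss_family Q h.

Lemma Rintegral_fst (f : T -> R) : measurable_fun setT f ->
  \int[(P \x Q)%E]_z f z.1 = \int[P]_w f w.
Proof.
move=> mf.
apply: (@eq_law_Rintegral R _ _ _ _ _ _ (P \x Q)%E P fst id f) => //.
move=> A mA; rewrite (_ : fst @^-1` A = A `*` setT).
  have Q1 : Q setT = 1%E := probability_setT Q.
  by transitivity (P A * Q setT)%E; [exact: product_measure1E|rewrite Q1 mule1].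
by apply/seteqP; split => -[x y]//= [].
Qed.

Lemma Rintegral_snd (f : S -> R) : measurable_fun setT f ->
  \int[(P \x Q)%E]_z f z.2 = \int[Q]_w f w.
Proof.
move=> mf.
apply: (@eq_law_Rintegral R _ _ _ _ _ _ (P \x Q)%E Q snd id f) => //.
move=> A mA; rewrite (_ : snd @^-1` A = setT `*` A).
  have P1 : P setT = 1%E := probability_setT P.
  by transitivity (P setT * Q A)%E; [exact: product_measure1E|rewrite P1 mul1e].
by apply/seteqP; split => -[x y]//= [].
Qed.

Lemma integrable_fst (f : T -> R) : P.-integrable setT (EFin \o f) ->
  (P \x Q)%E.-integrable setT (EFin \o (fun z => f z.1)).
Proof.
move=> iF; have mf : measurable_fun setT f by apply/measurable_EFinP; case/integrableP : iF.
apply: (@eq_law_integrable R _ _ _ _ _ _ P (P \x Q)%E id fst f) => //.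
move=> A mA; rewrite (_ : fst @^-1` A = A `*` setT).
  have Q1 : Q setT = 1%E := probability_setT Q.
  by symmetry; transitivity (P A * Q setT)%E; [exact: product_measure1E|rewrite Q1 mule1].
by apply/seteqP; split => -[x y]//= [].
Qed.

Lemma integrable_snd (f : S -> R) : Q.-integrable setT (EFin \o f) ->
  (P \x Q)%E.-integrable setT (EFin \o (fun z => f z.2)).
Proof.
move=> iF; have mf : measurable_fun setT f by apply/measurable_EFinP; case/integrableP : iF.
apply: (@eq_law_integrable R _ _ _ _ _ _ Q (P \x Q)%E id snd f) => //.
move=> A mA; rewrite (_ : snd @^-1` A = setT `*` A).
  have P1 : P setT = 1%E := probability_setT P.
  by symmetry; transitivity (P setT * Q A)%E; [exact: product_measure1E|rewrite P1 mul1e].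
by apply/seteqP; split => -[x y]//= [].
Qed.

(** Placing the two families on the two halves of [I + J] makes every vector [a' v] orthogonal to
    every [b' w], as the interpolation requires. *)
Lemma lse_comparison2 (c : 'I_n.+1 -> R) (a : 'I_n.+1 -> I -> R) (b : 'I_n.+1 -> J -> R) :
  (forall v w, dot (fun i => a v i - a w i) (fun i => a v i - a w i) <=
    dot (fun i => b v i - b w i) (fun i => b v i - b w i)) ->
  \int[P]_w lse (affine c a (g ^~ w)) <= \int[Q]_w lse (affine c b (h ^~ w)).
Proof.
move=> incr.
pose a' v (ij : I + J) := if ij is inl i then a v i else 0.
pose b' v (ij : I + J) := if ij is inr j then b v j else 0.
have := @lse_comparison R _ n _ _ _ _ (gauss_family_sum gP hQ) c a' b'.
have da v w : dot (fun i => a' v i - a' w i) (fun i => a' v i - a' w i) =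
    dot (fun i => a v i - a w i) (fun i => a v i - a w i).
  by rewrite /dot big_sumType/= [X in _ + X]big1 ?addr0// => j _; rewrite subrr mul0r.
have db v w : dot (fun i => b' v i - b' w i) (fun i => b' v i - b' w i) =
    dot (fun i => b v i - b w i) (fun i => b v i - b w i).
  rewrite /dot big_sumType/= -[RHS]add0r; congr (_ + _).
  by apply: big1 => j _; rewrite subrr mul0r.
have ab v w : dot (a' v) (b' w) = 0.
  by rewrite /dot big_sumType/= !big1 ?addr0// => ? _; rewrite ?mulr0 ?mul0r.
have {}incr v w : dot (fun i => a' v i - a' w i) (fun i => a' v i - a' w i) <=
    dot (fun i => b' v i - b' w i) (fun i => b' v i - b' w i) by rewrite da db.
move=> /(_ ab incr); congr (_ <= _).
- rewrite -(@Rintegral_fst (fun w => lse (affine c a (g ^~ w)))).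
    apply: eq_Rintegral => z _; congr lse; apply/funext => v.
    rewrite /affine /dot big_sumType/= [X in _ + (_ + X)]big1 ?addr0// => j _.
    by rewrite mul0r.
  exact: (measurableT_comp (measurable_lse c a) (measurable_family gP)).
- rewrite -(@Rintegral_snd (fun w => lse (affine c b (h ^~ w)))).
    apply: eq_Rintegral => z _; congr lse; apply/funext => v.
    rewrite /affine /dot big_sumType/= [X in _ + (X + _)]big1 ?add0r// => j _.
    by rewrite mul0r.
  exact: (measurableT_comp (measurable_lse c b) (measurable_family hQ)).
Qed.

End separate_spaces.

(** Pigeonhole on a grid of mesh [e]: points in the same cell differ by at most [e] in every
    coordinate, so one representative per occupied cell is enough. Only the values of [f] have to be
    bounded; [V] carries no structure. *)
Lemma finite_net (R : realType) (K : finType) (V : Type) (f : V -> K -> R) (C : R) (v0 : V) :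
  (forall v k, `|f v k| <= C) -> forall e, 0 < e ->
  exists (n : nat) (s : 'I_n.+1 -> V), forall v, exists k, forall i, `|f v i - f (s k) i| <= e.
Proof.
move=> fC e e0.
pose L := Num.truncn (2 * C / e).
pose X := {ffun K -> 'I_L.+1}.
pose cell v : X := [ffun k => inord (Num.truncn ((f v k + C) / e))].
have fb v k : 0 <= (f v k + C) / e <= 2 * C / e.
  have := fC v k; rewrite ler_norml => /andP[f1 f2].
  rewrite divr_ge0 ?(ltW e0)//=; last by lra.
  by apply: ler_wpM2r; [rewrite invr_ge0 ltW|lra].
have cellP v w i : cell v = cell w -> `|f v i - f w i| <= e.
  move=> /ffunP/(_ i); rewrite !ffunE => /(congr1 val).
  have /andP[v1 v2] := fb v i; have /andP[w1 w2] := fb w i.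
  rewrite /= !inordK; last 2 first.
    1,2: by rewrite ltnS; exact: le_truncn.
  move=> E; have /andP[v3 v4] := truncn_itv v1; have /andP[w3 w4] := truncn_itv w1.
  rewrite -natr1 E in v4; rewrite -natr1 in w4; rewrite E in v3.
  have : `|(f v i + C) / e - (f w i + C) / e| <= 1.
    move: v3 v4 w3 w4; move: ((f v i + C) / e) ((f w i + C) / e) (Num.truncn _)%:R.
    by move=> p q r *; rewrite ler_norml; apply/andP; split; lra.
  rewrite -mulrBl normrM normfV (gtr0_norm e0) ler_pdivrMr// mul1r.
  by congr (`|_| <= _); ring.
pose rep (q : X) : V := if pselect (exists v, cell v = q) is left H then projT1 (cid H) else v0.
have repP v : cell (rep (cell v)) = cell v.
  rewrite /rep; case: pselect => [H|]; last by case; exists v.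
  exact: (projT2 (cid H)).
(* The last index lies beyond the enumeration, where [nth] returns its default [cell v0]; it only
   gives the index type the shape ['I_n.+1]. *)
exists #|X|, (fun k : 'I_#|X|.+1 => rep (nth (cell v0) (enum X) k)) => v.
have lt : (index (cell v) (enum X) < #|X|.+1)%N.
  by rewrite ltnS cardE index_size.
exists (Ordinal lt) => i; apply: cellP.
by rewrite /= nth_index ?mem_enum// repP.
Qed.

Lemma ler_chain (R : realType) (x y z t u e : R) :
  x - y <= z -> z <= t -> t <= u + e -> x - (e + y) <= u.
Proof. by lra. Qed.

(** * Suprema over arbitrary index sets *)

Section gaussian_suprema.
Context {R : realType} (I : finType) (V : Type).
Variables (c : V -> R) (a : V -> I -> R) (C : R) (F : (I -> R) -> R).
Hypothesis cC : forall v, `|c v| <= C.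
Hypothesis aC : forall v i, `|a v i| <= C.
Hypothesis F_ge : forall x v, c v + dot (a v) x <= F x.
Hypothesis F_sup : forall x e, 0 < e -> exists v, F x - e <= c v + dot (a v) x.

Let one_norm (x : I -> R) := 1 + \sum_i `|x i|.

(** A finite net brings a finite maximum close to [F], and [lse] at inverse temperature [b] is close
    to that maximum. The lower error grows with [one_norm x] because the net controls the
    coefficients, not their products with [x]. *)
Lemma sup_affine_approx (e : R) : 0 < e ->
  exists (n : nat) (s : 'I_n.+1 -> V) (b : R), [/\ 0 < b, ln n.+1%:R <= b * e &
    forall x, F x - e * one_norm x <=
      b^-1 * lse (affine (fun k => b * c (s k)) (fun k i => b * a (s k) i) x) <= F x + e].
Proof.
move=> e0.
have [v0 _] := F_sup (fun=> 0) ltr01.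
pose f v (k : option I) := if k is Some i then a v i else c v.
have fC v k : `|f v k| <= C by case: k => [i|]; [exact: aC|exact: cC].
have e20 : 0 < e / 2 by rewrite divr_gt0.
have [n [s sP]] := finite_net v0 fC e20.
have ln0 : (0 : R) <= ln n.+1%:R by rewrite ln_ge0// ler1n.
(* Large enough for the entropy loss [ln n.+1%:R / b] to stay below [e]; the summand 1 keeps [b]
   positive when [n = 0]. *)
pose b := (1 + ln n.+1%:R) / e.
have b0 : 0 < b by rewrite divr_gt0//; lra.
have lnb : ln n.+1%:R <= b * e by rewrite divfK ?gt_eqF//; lra.
exists n, s, b; split => // x.
have affE k : affine (fun k => b * c (s k)) (fun k i => b * a (s k) i) x k =
    b * (c (s k) + dot (a (s k)) x) by rewrite /affine dotZl mulrDr.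
apply/andP; split; last first.
  rewrite ler_pdivrMl// mulrDr.
  have bF k : affine (fun k => b * c (s k)) (fun k i => b * a (s k) i) x k <= b * F x.
    by rewrite affE ler_pM2l.
  by apply: le_trans (lse_le bF) _; rewrite lerD2l.
have [v vP] := F_sup x e20; have [k kP] := sP v.
apply: (@le_trans _ _ (c (s k) + dot (a (s k)) x)); last first.
  rewrite ler_pdivlMl// -affE; exact: ler_lse.
have h1 := kP None; have h2 i := kP (Some i).
rewrite /= ler_norml in h1; have /andP[_ {}h1] := h1.
have : dot (a v) x - dot (a (s k)) x <= e / 2 * \sum_i `|x i|.
  rewrite -dotBl /dot mulr_sumr; apply: ler_sum => i _.
  apply: le_trans (ler_norm _) _; rewrite normrM.
  by apply: ler_wpM2r; [exact: normr_ge0|exact: h2].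
have s0 : 0 <= \sum_i `|x i| by exact: sumr_ge0.
rewrite /one_norm mulrDr mulr1; move: (\sum_i _) s0 => X X0 h3.
have : e / 2 * X <= e * X by rewrite ler_wpM2r//; lra.
lra.
Qed.

(** The supremum may run over an uncountable type, so measurability comes from a pointwise limit of
    functions built on [lse]. *)
Lemma measurable_sup_affine : measurable_fun setT (F : vec R I -> R).
Proof.
have ap (m : nat) : exists f : vec R I -> R, measurable_fun setT f /\
    forall x, F x - m.+1%:R^-1 * one_norm x <= f x <= F x + m.+1%:R^-1.
  have e0 : (0 : R) < m.+1%:R^-1 by rewrite invr_gt0 ltr0n.
  have [n [s [b [_ _ bP]]]] := sup_affine_approx e0.
  exists (fun x => b^-1 * lse (affine (fun k => b * c (s k)) (fun k i => b * a (s k) i) x)).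
  by split=> //; apply: measurable_funM => //; exact: measurable_lse.
have [f fP] := choice ap.
apply: (@measurable_fun_cvg _ _ _ _ f) => [m|x _]; first by have [] := fP m.
apply: (@squeeze_cvgr _ _ _ _ (fun m => F x - m.+1%:R^-1 * one_norm x) (fun m => F x + m.+1%:R^-1)).
- by apply: nearW => m; have [_] := fP m.
- rewrite -[X in _ --> X]subr0 -(mul0r (one_norm x)).
  by apply: cvgB; [exact: cvg_cst|apply: cvgM; [exact: cvg_harmonic|exact: cvg_cst]].
- rewrite -[X in _ --> X]addr0.
  by apply: cvgD; [exact: cvg_cst|exact: cvg_harmonic].
Qed.

Lemma sup_affine_norm x : `|F x| <= C * one_norm x.
Proof.
have H v : `|c v + dot (a v) x| <= C * one_norm x.
  apply: le_trans (ler_normD _ _) _; rewrite mulrDr mulr1 lerD//.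
  apply: le_trans (ler_norm_sum _ _ _) _; rewrite mulr_sumr ler_sum// => i _.
  by rewrite normrM ler_wpM2r.
rewrite ler_norml; apply/andP; split.
  have [v _] := F_sup x ltr01.
  apply: le_trans (F_ge x v); have := H v; by rewrite ler_norml => /andP[].
apply/ler_addgt0Pr => e e0; have [v vP] := F_sup x e0.
have := H v; rewrite ler_norml => /andP[_ ?]; lra.
Qed.

Section over_family.
Context d (T : measurableType d) (P : probability T R) (g : I -> T -> R).
Hypothesis gP : gauss_family P g.

Lemma integrable_one_norm : P.-integrable setT (EFin \o (fun w => one_norm (g ^~ w))).
Proof.
have [ig1 _ _ _ _] := @normal_moments R.
have i1 : P.-integrable setT (EFin \o (fun w => \sum_i `|g i w|)).
  apply: integrable_sumr => i; apply: integrable_norm.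
  exact: (@gauss_coord_integrable R I _ _ _ _ i (fun x => x) gP (@measurable_id _ _ _) ig1).
exact: (integrableD measurableT (finite_measure_integrable_cst P 1 measurableT) i1).
Qed.

Lemma integrable_sup_affine : P.-integrable setT (EFin \o (fun w => F (g ^~ w))).
Proof.
have := integrableZl measurableT C integrable_one_norm.
apply: le_integrable => //.
  by apply/measurable_EFinP; exact: (measurableT_comp measurable_sup_affine (measurable_family gP)).
move=> w _; rewrite /= lee_fin; apply: le_trans (ler_norm _); exact: sup_affine_norm.
Qed.

(** [lse_comparison2] is applied to a finite net rescaled by the inverse temperature [k], and the
    errors, of order [m.+1%:R^-1], vanish. [H] is any integrable majorant of the second process, so
    a pointwise estimate can take the place of its supremum. *)
Lemma sudakov_fernique (J : finType) d' (S : measurableType d') (Q : probability S R)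
    (h : J -> S -> R) (b : V -> J -> R) (H : S -> R) :
  gauss_family Q h ->
  (forall v w, dot (fun i => a v i - a w i) (fun i => a v i - a w i) <=
    dot (fun i => b v i - b w i) (fun i => b v i - b w i)) ->
  Q.-integrable setT (EFin \o H) ->
  (forall s v, c v + dot (b v) (h ^~ s) <= H s) ->
  \int[P]_w F (g ^~ w) <= \int[Q]_s H s.
Proof.
move=> hQ incr iH Hge.
apply: (@ler_sub_div _ _ _ (1 + \int[P]_w one_norm (g ^~ w))) => m.
set e := m.+1%:R^-1; have e0 : 0 < e by rewrite invr_gt0 ltr0n.
have [n [s [k [k0 kln kP]]]] := sup_affine_approx e0.
pose c' v := k * c (s v); pose a' v i := k * a (s v) i; pose b' v j := k * b (s v) j.
have cmp : \int[P]_w lse (affine c' a' (g ^~ w)) <= \int[Q]_w lse (affine c' b' (h ^~ w)).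
  apply: (lse_comparison2 gP hQ) => v w.
  have sq (K : finType) (x y : K -> R) : dot (fun i => k * x i - k * y i) (fun i => k * x i - k * y i) =
      k * (k * dot (fun i => x i - y i) (fun i => x i - y i)).
    by rewrite /dot !mulr_sumr; apply: eq_bigr => i _; ring.
  by rewrite /a' /b' !sq !ler_pM2l.
have i1 := integrable_lse gP c' a'; have i2 := integrable_lse hQ c' b'.
have i3 := integrable_sup_affine; have i4 := integrable_one_norm.
have i5 : P.-integrable setT (EFin \o (fun w => e * one_norm (g ^~ w))).
  exact: (integrableZl measurableT _ i4).
have i6 : P.-integrable setT (EFin \o (fun w => k^-1 * lse (affine c' a' (g ^~ w)))).
  exact: (integrableZl measurableT _ i1).
have i7 : Q.-integrable setT (EFin \o (fun w => k^-1 * lse (affine c' b' (h ^~ w)))).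
  exact: (integrableZl measurableT _ i2).
have i8 : Q.-integrable setT (EFin \o (fun w => H w + e)).
  exact: (integrableD measurableT iH (finite_measure_integrable_cst Q e measurableT)).
have l1 : \int[P]_w (F (g ^~ w) - e * one_norm (g ^~ w)) <=
    \int[P]_w (k^-1 * lse (affine c' a' (g ^~ w))).
  apply: le_Rintegral => //; first exact: (integrableB measurableT i3 i5).
  by move=> w _; have /andP[] := kP (g ^~ w).
have l2 : \int[Q]_w (k^-1 * lse (affine c' b' (h ^~ w))) <= \int[Q]_w (H w + e).
  apply: le_Rintegral => // w _.
  rewrite ler_pdivrMl// mulrDr.
  have bH v : affine c' b' (h ^~ w) v <= k * H w.
    by rewrite /affine dotZl -mulrDr ler_pM2l.
  by apply: le_trans (lse_le bH) _; rewrite lerD2l.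
rewrite RintegralB// !RintegralZl// in l1.
have Q1 : fine (Q setT) = 1 by rewrite probability_setT.
rewrite RintegralD ?RintegralZl// in l2; last exact: finite_measure_integrable_cst.
rewrite Rintegral_cst// Q1 mulr1 in l2.
have l3 : k^-1 * \int[P]_w lse (affine c' a' (g ^~ w)) <=
  k^-1 * \int[Q]_w lse (affine c' b' (h ^~ w)) by rewrite ler_pM2l ?invr_gt0.
rewrite mulrDl mul1r -/e [_ * e]mulrC.
exact: ler_chain l1 l3 l2.
Qed.

End over_family.

End gaussian_suprema.

(** * Norms of Gaussian matrices *)

Section moments.
Context {R : realType} (I : finType).
Context d (T : measurableType d) (P : probability T R) (g : I -> T -> R).
Hypothesis gP : gauss_family P g.
Local Notation gam := (@normal_prob R 0 1).

Section uncorrelated.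
Variable p : R -> R.
Hypothesis mp : measurable_fun setT p.
Hypothesis ip : gam.-integrable setT (EFin \o p).
Hypothesis ip2 : gam.-integrable setT (EFin \o (fun x => p x ^+ 2)).
Hypothesis p0 : \int[gam]_x p x = 0.

Lemma integrable_coord_prod i j :
  P.-integrable setT (EFin \o (fun w => p (g i w) * p (g j w))).
Proof.
have [mg _] := gP.
have mp2 : measurable_fun setT (fun x => p x ^+ 2) by exact: measurable_funX.
have i1 := gauss_coord_integrable i gP mp2 ip2.
have i2 := gauss_coord_integrable j gP mp2 ip2.
apply: le_integrable (integrableD measurableT i1 i2) => //.
  by apply/measurable_EFinP; apply: measurable_funM; apply: measurableT_comp.
move=> w _; rewrite /= lee_fin; apply: le_trans (ler_norm _).
have := sqr_ge0 (`|p (g i w)| - `|p (g j w)|).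
rewrite sqrrB !real_normK ?num_real// normrM.
have := sqr_ge0 (p (g i w)); have := sqr_ge0 (p (g j w)).
by move: (p _ ^+ 2) (p _ ^+ 2) (`|_| * `|_|) => *; lra.
Qed.

(** Coordinate [i] is resampled and integrated first; the inner integral carries the factor [p0]. *)
Lemma Rintegral_coord_prod i j : i != j ->
  \int[P]_w (p (g i w) * p (g j w)) = 0.
Proof.
move=> ij; have [mg _] := gP.
have uP := gauss_family_upd i gP.
pose X : T -> vec R I := fun w => g ^~ w.
pose Y : T * measurableTypeR R -> vec R I := fun z => upd (g ^~ z.1) i z.2.
have mX : measurable_fun setT X by exact: measurable_to_vec.
have mY : measurable_fun setT Y by apply: measurable_to_vec; case: uP.
have law := gauss_family_law_unique gP uP.
have mf : measurable_fun setT (fun x : vec R I => p (x i) * p (x j)).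
  by apply: measurable_funM; apply: (measurableT_comp mp); exact: measurable_coord.
have j1 := eq_law_integrable mX mY law mf (integrable_coord_prod i j).
rewrite (eq_law_Rintegral mX mY law mf) /Rintegral -(integral12_prod_meas1 j1).
have Hw w : fubini_F (normal_prob 0 1)
    (EFin \o ((fun x : vec R I => p (x i) * p (x j)) \o Y)) w = 0%E.
  rewrite /fubini_F; transitivity (\int[gam]_t (p (g j w) * p t)%:E)%E.
    by apply: eq_integral => t _; rewrite /Y /= /upd eqxx eq_sym (negPf ij) mulrC.
  have i1 : gam.-integrable setT (EFin \o (fun t => p (g j w) * p t)).
    exact: (integrableZl measurableT _ ip).
  have f1 := integrable_fin_num measurableT i1.
  rewrite -(fineK f1); congr EFin.
  have := @RintegralZl _ _ R gam setT p (p (g j w)) measurableT ip.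
  by rewrite p0 mulr0.
by under eq_integral => w _ do rewrite Hw; rewrite integral0.
Qed.

Lemma Rintegral_sqr_sum (u : I -> R) :
  P.-integrable setT (EFin \o (fun w => (\sum_i u i * p (g i w)) ^+ 2)) /\
  \int[P]_w ((\sum_i u i * p (g i w)) ^+ 2) = dot u u * \int[gam]_x (p x ^+ 2).
Proof.
have E w : (\sum_i u i * p (g i w)) ^+ 2 =
    \sum_i \sum_j (u i * u j) * (p (g i w) * p (g j w)).
  rewrite expr2 mulr_suml; apply: eq_bigr => i _; rewrite mulr_sumr.
  by apply: eq_bigr => j _; ring.
have i2 i j : P.-integrable setT (EFin \o (fun w => (u i * u j) * (p (g i w) * p (g j w)))).
  exact: (integrableZl measurableT _ (integrable_coord_prod i j)).
have i1 i : P.-integrable setT (EFin \o (fun w => \sum_j (u i * u j) * (p (g i w) * p (g j w)))).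
  exact: integrable_sumr.
split.
  by apply: eq_integrable (integrable_sumr i1) => // w _ /=; rewrite E.
under eq_Rintegral => w _ do rewrite E.
rewrite Rintegral_sum// /dot mulr_suml; apply: eq_bigr => i _.
rewrite Rintegral_sum// (bigD1 i)//= big1 ?addr0.
  rewrite RintegralZl//; last exact: integrable_coord_prod.
  congr (_ * _); under eq_Rintegral => w _ do rewrite -expr2.
  by rewrite (gauss_coord_Rintegral i gP (f := fun x => p x ^+ 2))//; exact: measurable_funX.
move=> j ji; rewrite RintegralZl ?Rintegral_coord_prod ?mulr0 1?eq_sym//.
exact: integrable_coord_prod.
Qed.

End uncorrelated.

Lemma Rintegral_sqr_dot (u : I -> R) :
  P.-integrable setT (EFin \o (fun w => dot u (g ^~ w) ^+ 2)) /\
  \int[P]_w (dot u (g ^~ w) ^+ 2) = dot u u.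
Proof.
have [i1 i2 _ e1 [e2 _]] := @normal_moments R.
have [h1 h2] := @Rintegral_sqr_sum id (@measurable_id _ _ _) i1 i2 e1 u.
by split => //; rewrite [LHS]h2 e2 mulr1.
Qed.

Lemma Rintegral_sqr_norm :
  P.-integrable setT (EFin \o (fun w => dot (g ^~ w) (g ^~ w))) /\
  \int[P]_w dot (g ^~ w) (g ^~ w) = #|I|%:R.
Proof.
have [_ i2 _ _ [e2 _]] := @normal_moments R.
have m2 : measurable_fun setT (fun x : R => x ^+ 2) by exact: measurable_funX.
have H i : P.-integrable setT (EFin \o (fun w => g i w * g i w)).
  exact: (gauss_coord_integrable i gP m2 i2).
split; first exact: integrable_sumr.
rewrite Rintegral_sum//.
rewrite (eq_bigr (fun=> 1)); first by rewrite sumr_const.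
by move=> i _; rewrite -e2; exact: (gauss_coord_Rintegral i gP m2).
Qed.

(** The centered function [x ^+ 2 - 1] has second moment 3 - 2 + 1 = 2, and its values at distinct
    coordinates are uncorrelated. *)
Lemma Rintegral_sqr_norm_dev :
  P.-integrable setT (EFin \o (fun w => (dot (g ^~ w) (g ^~ w) - #|I|%:R) ^+ 2)) /\
  \int[P]_w ((dot (g ^~ w) (g ^~ w) - #|I|%:R) ^+ 2) = 2 * #|I|%:R.
Proof.
have [_ i2 i4 _ [e2 e4]] := @normal_moments R.
pose p (x : R) := x ^+ 2 - 1.
have ic k : gam.-integrable setT (EFin \o (fun=> k : R)).
  exact: (finite_measure_integrable_cst (normal_prob 0 1 : probability (measurableTypeR R) R) k measurableT).
have gT : fine (gam setT) = 1 by rewrite /normal_prob integral_normal_pdf.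
have mp : measurable_fun setT p by apply: measurable_funB => //; exact: measurable_funX.
have ip : gam.-integrable setT (EFin \o p) by exact: (integrableB measurableT i2 (ic 1)).
have p0 : \int[gam]_x p x = 0.
  by rewrite /p RintegralB// ?e2 ?Rintegral_cst ?gT ?mulr1 ?subrr//; exact: ic.
have pE x : p x ^+ 2 = x ^+ 4 - 2 * x ^+ 2 + 1 by rewrite /p; ring.
have i22 : gam.-integrable setT (EFin \o (fun x : R => 2 * x ^+ 2)).
  exact: (integrableZl measurableT _ i2).
have i42 : gam.-integrable setT (EFin \o (fun x : R => x ^+ 4 - 2 * x ^+ 2)).
  exact: (integrableB measurableT i4 i22).
have ip2 : gam.-integrable setT (EFin \o (fun x => p x ^+ 2)).
  apply: eq_integrable (integrableD measurableT i42 (ic 1)) => // x _ /=.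
  by rewrite pE.
have ep2 : \int[gam]_x (p x ^+ 2) = 2.
  under eq_Rintegral => x _ do rewrite pE.
  rewrite RintegralD// RintegralB// RintegralZl// e2 e4 Rintegral_cst// gT.
  by ring.
have [h1 h2] := @Rintegral_sqr_sum p mp ip ip2 p0 (fun=> 1).
have E w : (\sum_i 1 * p (g i w)) ^+ 2 = (dot (g ^~ w) (g ^~ w) - #|I|%:R) ^+ 2.
  congr (_ ^+ 2); rewrite /dot /p; under eq_bigr do rewrite mul1r.
  by rewrite sumrB sumr_const.
split; first by apply: eq_integrable h1 => // w _ /=; rewrite E.
under eq_Rintegral => w _ do rewrite -E.
by rewrite h2 ep2 /dot; under eq_bigr do rewrite mulr1; rewrite sumr_const mulrC.
Qed.

End moments.

Section euclidean_norm.
Context {R : realType}.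

Definition nrm (I : finType) (u : I -> R) := Num.sqrt (dot u u).

Lemma dot_ge0 (I : finType) (u : I -> R) : 0 <= dot u u.
Proof. by apply: sumr_ge0 => i _; rewrite -expr2 sqr_ge0. Qed.

Lemma nrm_ge0 (I : finType) (u : I -> R) : 0 <= nrm u.
Proof. exact: sqrtr_ge0. Qed.

Lemma sqr_nrm (I : finType) (u : I -> R) : nrm u ^+ 2 = dot u u.
Proof. by rewrite sqr_sqrtr// dot_ge0. Qed.

Lemma nrmZ (I : finType) (k : R) (u : I -> R) : nrm (fun i => k * u i) = `|k| * nrm u.
Proof. by rewrite /nrm dotZl dotZr mulrA -expr2 sqrtrM ?sqr_ge0// sqrtr_sqr. Qed.

Lemma ler_nrm (I : finType) (u : I -> R) i : `|u i| <= nrm u.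
Proof.
rewrite -sqrtr_sqr ler_wsqrtr// /dot (bigD1 i)//= -expr2 lerDl.
by apply: sumr_ge0 => j _; rewrite -expr2 sqr_ge0.
Qed.

Lemma nrm0_eq0 (I : finType) (u : I -> R) : nrm u = 0 -> u = fun=> 0.
Proof.
move=> u0; apply/funext => i; apply/eqP; rewrite -normr_le0 -u0; exact: ler_nrm.
Qed.

Lemma dot0l (I : finType) (v : I -> R) : dot (fun=> 0) v = 0.
Proof. by apply: big1 => i _; rewrite mul0r. Qed.

Lemma nrm0 (I : finType) : nrm (fun _ : I => 0) = 0.
Proof. by rewrite /nrm dot0l sqrtr0. Qed.

Lemma cauchy_schwarz (I : finType) (u v : I -> R) : dot u v <= nrm u * nrm v.
Proof.
have [/nrm0_eq0 ->|u0] := eqVneq (nrm u) 0; first by rewrite dot0l nrm0 mul0r.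
have [/nrm0_eq0 ->|v0] := eqVneq (nrm v) 0; first by rewrite dotC dot0l nrm0 mulr0.
have up : 0 < nrm u by rewrite lt_neqAle eq_sym u0 nrm_ge0.
have vp : 0 < nrm v by rewrite lt_neqAle eq_sym v0 nrm_ge0.
have := dot_ge0 (fun i => nrm v * u i - nrm u * v i).
rewrite !dotBl !dotBr !dotZl !dotZr (dotC v u) -!sqr_nrm.
have -> : nrm v * (nrm v * nrm u ^+ 2) - nrm v * (nrm u * dot u v) -
   (nrm u * (nrm v * dot u v) - nrm u * (nrm u * nrm v ^+ 2)) =
   2 * (nrm u * nrm v) * (nrm u * nrm v - dot u v) by ring.
by rewrite pmulr_rge0 ?subr_ge0// !mulr_gt0.
Qed.

(* Gordon's inequality behind Chevet's theorem: the difference of the two sides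
   is (pq - p'q')^2 + 2 (pp' - <u,u'>) (qq' - <a,a'>). *)
Lemma chevet_incr (I J : finType) (u u' : I -> R) (a a' : J -> R) :
  dot (fun ij : I * J => u ij.1 * a ij.2 - u' ij.1 * a' ij.2)
      (fun ij : I * J => u ij.1 * a ij.2 - u' ij.1 * a' ij.2) <=
  dot (fun i => nrm a * u i - nrm a' * u' i) (fun i => nrm a * u i - nrm a' * u' i) +
  dot (fun j => nrm u * a j - nrm u' * a' j) (fun j => nrm u * a j - nrm u' * a' j).
Proof.
have tens (v v' : I -> R) (b b' : J -> R) :
    dot (fun ij : I * J => v ij.1 * b ij.2) (fun ij => v' ij.1 * b' ij.2) = dot v v' * dot b b'.
  rewrite /dot mulr_suml -(pair_bigA _ (fun i j => v i * b j * (v' i * b' j)))/=.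
  by apply: eq_bigr => i _; rewrite mulr_sumr; apply: eq_bigr => j _; ring.
rewrite !dotBl !dotBr !tens !dotZl !dotZr (dotC u' u) (dotC a' a) -!sqr_nrm.
have := cauchy_schwarz u u'; have := cauchy_schwarz a a'.
move: (nrm u) (nrm u') (nrm a) (nrm a') (dot u u') (dot a a') => p p' q q' s r hr hs.
have H1 : 0 <= (p * p' - s) * (q * q' - r) by rewrite mulr_ge0 ?subr_ge0.
have H2 := sqr_ge0 (p * q - p' * q').
rewrite -subr_ge0.
have -> : q * (q * p ^+ 2) - q * (q' * s) - (q' * (q * s) - q' * (q' * p' ^+ 2)) +
  (p * (p * q ^+ 2) - p * (p' * r) - (p' * (p * r) - p' * (p' * q' ^+ 2))) -
  (p ^+ 2 * q ^+ 2 - s * r - (s * r - p' ^+ 2 * q' ^+ 2)) =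
  (p * q - p' * q') ^+ 2 + 2 * ((p * p' - s) * (q * q' - r)) by ring.
by rewrite addr_ge0// mulr_ge0.
Qed.

End euclidean_norm.

Section operator_norm.
Context {R : realType} (I J : finType).
Implicit Types (x : I * J -> R) (u : I -> R) (a : J -> R).

Definition mulv x a : I -> R := fun i => \sum_j x (i, j) * a j.
Definition tens u a : I * J -> R := fun ij => u ij.1 * a ij.2.

Lemma dot_tens x u a : dot (tens u a) x = dot u (mulv x a).
Proof.
rewrite /dot; transitivity (\sum_(ij : I * J) (fun i j => u i * a j * x (i, j)) ij.1 ij.2).
  by apply: eq_bigr => -[i j].
rewrite -(pair_bigA _ (fun i j => u i * a j * x (i, j)))/=; by apply: eq_bigr => i _; rewrite mulr_sumr; apply: eq_bigr => j _; ring.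
Qed.

(** Balls instead of spheres: the zero pair keeps the supremum nonnegative, and in [chevet] it is
    what produces the maximum with 0. *)
Definition ball_pair := {ua : (I -> R) * (J -> R) | nrm ua.1 <= 1 /\ nrm ua.2 <= 1}.

Definition opR x := sup [set dot (tens (sval v).1 (sval v).2) x | v in [set: ball_pair]].

Lemma ball_pair_coord (v : ball_pair) i j : `|tens (sval v).1 (sval v).2 (i, j)| <= 1.
Proof.
case: v => -[u a] /= [u1 a1]; rewrite /tens /= normrM -[1]mulr1; apply: ler_pM => //.
  exact: le_trans (ler_nrm _ _) u1.
exact: le_trans (ler_nrm _ _) a1.
Qed.

Definition ball_pair0 : ball_pair.
Proof.
by exists ((fun=> 0), (fun=> 0)); rewrite /= !nrm0 ler01.
Defined.

Lemma has_sup_opR x : has_sup [set dot (tens (sval v).1 (sval v).2) x | v in [set: ball_pair]].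
Proof.
split; first by exists (dot (tens (sval ball_pair0).1 (sval ball_pair0).2) x); exists ball_pair0.
exists (\sum_ij `|x ij|) => _ [v _ <-].
apply: le_trans (ler_norm _) _; apply: le_trans (ler_norm_sum _ _ _) _.
apply: ler_sum => -[i j] _; rewrite normrM; apply: ler_piMl => //; exact: ball_pair_coord.
Qed.

Lemma opR_ub1 x (v : ball_pair) : dot (tens (sval v).1 (sval v).2) x <= opR x.
Proof. by apply: ub_le_sup; [case: (has_sup_opR x)|exists v]. Qed.

Lemma opR_ge0 x : 0 <= opR x.
Proof.
apply: le_trans (opR_ub1 x ball_pair0); rewrite dot_tens /= dot0l; exact: lexx.
Qed.

Lemma opR_ub x u a : dot u (mulv x a) <= opR x * (nrm u * nrm a).
Proof.
have [/nrm0_eq0 ->|u0] := eqVneq (nrm u) 0; first by rewrite dot0l nrm0 mul0r mulr0.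
have [/nrm0_eq0 ->|a0] := eqVneq (nrm a) 0.
  have -> : mulv x (fun=> 0) = fun=> 0.
    by apply/funext => i; rewrite /mulv big1// => j _; rewrite mulr0.
  by rewrite dotC dot0l nrm0 !mulr0.
have up : 0 < nrm u by rewrite lt_neqAle eq_sym u0 nrm_ge0.
have ap : 0 < nrm a by rewrite lt_neqAle eq_sym a0 nrm_ge0.
have b1 : nrm (fun i => (nrm u)^-1 * u i) <= 1.
  by rewrite nrmZ normfV ger0_norm ?mulVf// ltW.
have b2 : nrm (fun i => (nrm a)^-1 * a i) <= 1.
  by rewrite nrmZ normfV ger0_norm ?mulVf// ltW.
have := opR_ub1 x (exist _ (_, _) (conj b1 b2)); rewrite /= dot_tens.
have -> : mulv x (fun i => (nrm a)^-1 * a i) = fun i => (nrm a)^-1 * mulv x a i.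
  by apply/funext => i; rewrite /mulv mulr_sumr; apply: eq_bigr => j _; ring.
by rewrite dotZl dotZr mulrA -invfM mulrC ler_pdivrMr// mulr_gt0.
Qed.

Lemma nrm_mulv x a : nrm (mulv x a) <= opR x * nrm a.
Proof.
have := opR_ub x (mulv x a) a; rewrite -sqr_nrm expr2.
have := nrm_ge0 (mulv x a); rewrite le_eqVlt => /predU1P[<- _|n0].
  by rewrite mulr_ge0 ?opR_ge0 ?nrm_ge0.
by rewrite (mulrC (nrm (mulv _ _)) (nrm a)) mulrA ler_pM2r.
Qed.

Lemma opR_sup x e : 0 < e -> exists v : ball_pair,
  opR x - e <= dot (tens (sval v).1 (sval v).2) x.
Proof.
move=> e0; have [_ [v _ <-] /ltW ?] := sup_adherent e0 (has_sup_opR x).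
by exists v.
Qed.

Lemma measurable_opR : measurable_fun setT (opR : vec R (I * J)%type -> R).
Proof.
apply: (@measurable_sup_affine R (I * J)%type ball_pair (fun=> 0)
  (fun v => tens (sval v).1 (sval v).2) 1).
- by move=> _; rewrite normr0.
- by move=> v [i j]; exact: ball_pair_coord.
- by move=> x v; rewrite add0r; exact: opR_ub1.
- by move=> x e e0; have [v ?] := opR_sup x e0; exists v; rewrite add0r.
Qed.

End operator_norm.

Section mean_bounds.
Context {R : realType} d (T : measurableType d) (P : probability T R).

(** Integration of [f <= f ^+ 2 / (2 * c) + c / 2] with [c = r + e]. The slack [e] keeps [c]
    positive when [r = 0]. *)
Lemma mean_le_rms (f : T -> R) (r : R) : 0 <= r -> measurable_fun setT f ->
  (forall w, 0 <= f w) -> P.-integrable setT (EFin \o (fun w => f w ^+ 2)) ->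
  \int[P]_w (f w ^+ 2) <= r ^+ 2 ->
  P.-integrable setT (EFin \o f) /\ \int[P]_w f w <= r.
Proof.
move=> r0 mf f0 if2 f2r.
have ic k : P.-integrable setT (EFin \o (fun=> k)).
  exact: (finite_measure_integrable_cst P k measurableT).
have PT : fine (P setT) = 1 by rewrite probability_setT.
have if1 : P.-integrable setT (EFin \o f).
  apply: le_integrable (integrableD measurableT if2 (ic 1)) => //; first exact/measurable_EFinP.
  move=> w _; rewrite /= lee_fin; apply: le_trans (ler_norm _).
  rewrite ger0_norm//; have := sqr_ge0 (f w - 1); have := sqr_ge0 (f w); rewrite sqrrB; lra.
split => //; apply/ler_addgt0Pr => e e0.
have re : 0 < r + e by lra.
have i2 : P.-integrable setT (EFin \o (fun w => (2 * (r + e))^-1 * f w ^+ 2)).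
  exact: (integrableZl measurableT _ if2).
apply: (@le_trans _ _ (\int[P]_w ((2 * (r + e))^-1 * f w ^+ 2 + (r + e) / 2))).
  apply: le_Rintegral => //; first exact: (integrableD measurableT i2 (ic _)).
  move=> w _; rewrite -subr_ge0.
  have -> : (2 * (r + e))^-1 * f w ^+ 2 + (r + e) / 2 - f w =
      (f w - (r + e)) ^+ 2 / (2 * (r + e)) by field; rewrite gt_eqF.
  by rewrite divr_ge0 ?sqr_ge0// mulr_ge0// ltW.
rewrite RintegralD// Rintegral_cst// PT mulr1 RintegralZl//.
apply: (@le_trans _ _ ((2 * (r + e))^-1 * (r + e) ^+ 2 + (r + e) / 2)); last first.
  by rewrite le_eqVlt; apply/orP; left; apply/eqP; field; rewrite gt_eqF.
rewrite lerD2r ler_wpM2l ?invr_ge0 ?mulr_ge0 ?(ltW re)//.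
by apply: le_trans f2r _; rewrite lerXn2r ?nnegrE ?(ltW re)//; lra.
Qed.

(** Since [f] is nonnegative, Tonelli gives integrability and the bound at once. This allows one of
    two independent Gaussian matrices to be frozen. *)
Lemma Fubini_bound d' (S : measurableType d') (Q : probability S R) (f : T * S -> R) (b : S -> R) :
  measurable_fun setT f -> (forall z, 0 <= f z) ->
  (forall y, P.-integrable setT (EFin \o (fun x => f (x, y)))) ->
  (forall y, \int[P]_x f (x, y) <= b y) -> Q.-integrable setT (EFin \o b) ->
  (P \x Q)%E.-integrable setT (EFin \o f) /\ \int[(P \x Q)%E]_z f z <= \int[Q]_y b y.
Proof.
move=> mf f0 ify fb ib.
have mEf : measurable_fun setT (EFin \o f) by exact/measurable_EFinP.
have f0E z : (0 <= (EFin \o f) z)%E by rewrite lee_fin.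
have le : (\int[(P \x Q)%E]_z (f z)%:E <= \int[Q]_y (b y)%:E)%E.
  rewrite (@fubini_tonelli2 _ _ _ _ R P Q (EFin \o f) mEf f0E); apply: ge0_le_integral => //.
  - by move=> y _; apply: integral_ge0 => x _; rewrite lee_fin.
  - exact: (@measurable_fun_fubini_tonelli_G _ _ _ _ R P _ mEf f0E).
  - by case/integrableP : ib => /measurable_EFinP ? _; exact/measurable_EFinP.
  - move=> y _; have f1 := integrable_fin_num measurableT (ify y).
    by rewrite /fubini_G -(fineK f1) lee_fin; exact: fb.
have fb' : (\int[Q]_y (b y)%:E)%E \is a fin_num by exact: integrable_fin_num.
have iff : (P \x Q)%E.-integrable setT (EFin \o f).
  apply/integrableP; split => //.
  under eq_integral => z _ do rewrite gee0_abs//.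
  by apply: le_lt_trans le _; rewrite ltey_eq fb'.
split => //; rewrite /Rintegral; apply: fine_le => //.
exact: integrable_fin_num.
Qed.

End mean_bounds.

Section gaussian_norm.
Context {R : realType} (I : finType) d (T : measurableType d) (P : probability T R)
  (g : I -> T -> R).
Hypothesis gP : gauss_family P g.

Lemma measurable_nrm (K : finType) (f : K -> T -> R) :
  (forall k, measurable_fun setT (f k)) -> measurable_fun setT (fun w => nrm (f ^~ w)).
Proof.
move=> mf; apply: (@measurableT_comp _ _ _ _ _ _ (@Num.sqrt R)).
  by apply: continuous_measurable_fun; exact: sqrt_continuous.
by apply: measurable_sum => k; exact: measurable_funM.
Qed.

Lemma mean_nrm :
  P.-integrable setT (EFin \o (fun w => nrm (g ^~ w))) /\
  \int[P]_w nrm (g ^~ w) <= Num.sqrt #|I|%:R.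
Proof.
have [mg _] := gP; have [h1 h2] := Rintegral_sqr_norm gP.
apply: mean_le_rms; rewrite ?sqrtr_ge0//.
- exact: measurable_nrm.
- by move=> w; exact: nrm_ge0.
- by apply: eq_integrable h1 => // w _ /=; rewrite sqr_nrm.
- by rewrite sqr_sqrtr// -h2; under eq_Rintegral => w _ do rewrite sqr_nrm.
Qed.

(** With k the dimension, the excess of |g| over sqrt k is at most ||g|^2 - k| / (2 sqrt k). The
    variance of |g|^2 is 2k, so the mean is at most sqrt(2k) / (2 sqrt k), a bound free of the
    dimension. *)
Lemma mean_nrm_excess : (0 < #|I|)%N ->
  P.-integrable setT (EFin \o (fun w => Num.max (nrm (g ^~ w) - Num.sqrt #|I|%:R) 0)) /\
  \int[P]_w (Num.max (nrm (g ^~ w) - Num.sqrt #|I|%:R) 0) <= (Num.sqrt 2)^-1.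
Proof.
move=> I0; have [mg _] := gP; have [h1 h2] := Rintegral_sqr_norm_dev gP.
set k : R := #|I|%:R in h1 h2 *; set sk := Num.sqrt k.
have k0 : 0 < k by rewrite ltr0n.
have sk0 : 0 < sk by rewrite sqrtr_gt0.
have skE : sk ^+ 2 = k by rewrite sqr_sqrtr// ltW.
have mn := measurable_nrm mg.
have mX : measurable_fun setT (fun w => `|dot (g ^~ w) (g ^~ w) - k|).
  apply: measurableT_comp => //; apply: measurable_funB => //.
  by apply: measurable_sum => i; exact: measurable_funM.
have [|||||iX eX] := @mean_le_rms _ _ _ P (fun w => `|dot (g ^~ w) (g ^~ w) - k|) (Num.sqrt (2 * k)).
- exact: sqrtr_ge0.
- exact: mX.
- by [].
- by apply: eq_integrable h1 => // w _ /=; rewrite real_normK ?num_real.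
- rewrite sqr_sqrtr ?mulr_ge0 ?(ltW k0)// -h2.
  by under eq_Rintegral => w _ do rewrite real_normK ?num_real//.
have bd w : Num.max (nrm (g ^~ w) - sk) 0 <= (2 * sk)^-1 * `|dot (g ^~ w) (g ^~ w) - k|.
  rewrite ge_max mulr_ge0 ?invr_ge0 ?mulr_ge0 ?(ltW sk0)// andbT ler_pdivlMl ?mulr_gt0//.
  rewrite -sqr_nrm -skE subr_sqr; have := nrm_ge0 (g ^~ w).
  move: (nrm _) => x x0.
  have [xs|xs] := leP x sk.
    by apply: (@le_trans _ _ 0); rewrite // mulr_ge0_le0 ?subr_le0// mulr_ge0// ltW.
  rewrite normrM !ger0_norm; [|by rewrite addr_ge0// ltW|by rewrite subr_ge0 ltW].
  by rewrite mulrC; apply: ler_wpM2l; [rewrite subr_ge0 ltW|lra].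
have i1 : P.-integrable setT (EFin \o (fun w => (2 * sk)^-1 * `|dot (g ^~ w) (g ^~ w) - k|)).
  exact: (integrableZl measurableT _ iX).
have i2 : P.-integrable setT (EFin \o (fun w => Num.max (nrm (g ^~ w) - sk) 0)).
  apply: le_integrable i1 => //.
    apply/measurable_EFinP; apply: measurable_maxr => //; exact: measurable_funB.
  move=> w _; rewrite /= lee_fin ger0_norm ?le_max ?lexx ?orbT//.
  by apply: le_trans (ler_norm _); exact: bd.
split => //; apply: (@le_trans _ _ (\int[P]_w ((2 * sk)^-1 * `|dot (g ^~ w) (g ^~ w) - k|))).
  by apply: le_Rintegral.
rewrite RintegralZl// ler_pdivrMl ?mulr_gt0//.
apply: le_trans eX _; rewrite sqrtrM// -/sk.
have s2 : Num.sqrt 2 ^+ 2 = 2 :> R by rewrite sqr_sqrtr.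
have s0 : 0 < Num.sqrt 2 :> R by rewrite sqrtr_gt0.
by rewrite -[X in X * sk / _]s2 le_eqVlt; apply/orP; left; apply/eqP; field; rewrite gt_eqF.
Qed.

End gaussian_norm.

(** * Chevet bounds for real Gaussian matrices *)

Section chevet.
Context {R : realType} (I J : finType) d (T : measurableType d) (P : probability T R)
  (W : I * J -> T -> R).
Hypothesis WP : gauss_family P W.
Hypotheses (I0 : (0 < #|I|)%N) (J0 : (0 < #|J|)%N).

Lemma integrable_opR : P.-integrable setT (EFin \o (fun w => opR (W ^~ w))).
Proof.
apply: (@integrable_sup_affine R (I * J)%type (ball_pair I J) (fun=> 0)
  (fun v => tens (sval v).1 (sval v).2) 1 _ _ _ _ _ _ _ _ _ WP).
- by move=> _; rewrite normr0.
- by move=> v [i j]; exact: ball_pair_coord.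
- by move=> x v; rewrite add0r; exact: opR_ub1.
- by move=> x e e0; have [v ?] := opR_sup x e0; exists v; rewrite add0r.
Qed.

(** The penalty rho |u| |a| is deterministic and passes unchanged through the Gaussian comparison;
    over the two balls the penalized bilinear form has supremum [Num.max (opR x - rho) 0]. The
    comparison process |a| <g, u> + |u| <h, a> with the same penalty is at most |u| |a| (|g| - rho)
    + |h|, and |u| |a| lies between 0 and 1. *)
Lemma chevet (rho : R) d1 (S1 : measurableType d1) (Q1 : probability S1 R) (g : I -> S1 -> R)
    d2 (S2 : measurableType d2) (Q2 : probability S2 R) (h : J -> S2 -> R) :
  0 <= rho -> gauss_family Q1 g -> gauss_family Q2 h ->
  Q1.-integrable setT (EFin \o (fun w => Num.max (nrm (g ^~ w) - rho) 0)) ->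
  \int[P]_w (Num.max (opR (W ^~ w) - rho) 0) <=
  \int[Q1]_w (Num.max (nrm (g ^~ w) - rho) 0) + Num.sqrt #|J|%:R.
Proof.
move=> r0 gQ hQ ig; have [ih eh] := mean_nrm hQ.
have ghQ := gauss_family_sum gQ hQ.
have mg : measurable_fun setT (fun w => Num.max (nrm (g ^~ w) - rho) 0).
  by apply/measurable_EFinP; case/integrableP : ig.
have mh : measurable_fun setT (fun w => nrm (h ^~ w)).
  by apply/measurable_EFinP; case/integrableP : ih.
have i1 : (Q1 \x Q2)%E.-integrable setT (EFin \o (fun z => Num.max (nrm (g ^~ z.1) - rho) 0)).
  exact: (integrable_fst Q2 ig).
have i2 : (Q1 \x Q2)%E.-integrable setT (EFin \o (fun z => nrm (h ^~ z.2))).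
  exact: (integrable_snd Q1 ih).
apply: (@le_trans _ _ (\int[(Q1 \x Q2)%E]_z
    (Num.max (nrm (g ^~ z.1) - rho) 0 + nrm (h ^~ z.2)))); last first.
  rewrite RintegralD//.
  rewrite (Rintegral_fst Q1 Q2 mg) (Rintegral_snd Q1 Q2 mh).
  by rewrite lerD2l.
apply: (@sudakov_fernique R (I * J)%type (ball_pair I J)
  (fun v => - (rho * (nrm (sval v).1 * nrm (sval v).2)))
  (fun v => tens (sval v).1 (sval v).2) (1 + rho)
  (fun x => Num.max (opR x - rho) 0) _ _ _ _ _ _ P W WP (I + J)%type _ _ (Q1 \x Q2)%E _
  (fun v ij => match ij with inl i => nrm (sval v).2 * (sval v).1 i
     | inr j => nrm (sval v).1 * (sval v).2 j end) _ ghQ).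
- move=> [[u a] /= [u1 a1]]; rewrite normrN ger0_norm ?mulr_ge0 ?nrm_ge0//.
  rewrite -[leLHS]add0r lerD// ler_piMr// mulr_ile1 ?nrm_ge0//.
- by move=> v [i j]; apply: le_trans (ball_pair_coord v i j) _; rewrite lerDl.
- move=> x [[u a] /= [u1 a1]]; rewrite dot_tens.
  apply: (@le_trans _ _ ((opR x - rho) * (nrm u * nrm a))).
    by rewrite mulrBl addrC lerD2r opR_ub.
  have t0 : 0 <= nrm u * nrm a by rewrite mulr_ge0 ?nrm_ge0.
  have t1 : nrm u * nrm a <= 1 by rewrite mulr_ile1 ?nrm_ge0.
  have [xr|xr] := leP (opR x - rho) 0.
    by rewrite ?(max_idPr xr) mulr_le0_ge0.
  by rewrite ?(max_idPl (ltW xr)) ler_piMr// ltW.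
- move=> x e e0; have [xr|xr] := leP (opR x - rho) 0.
    exists (ball_pair0 I J); rewrite ?(max_idPr xr) dot_tens /= !nrm0 dot0l mulr0 mulr0 oppr0 addr0.
    lra.
  have [v vP] := opR_sup x e0; exists v; rewrite ?(max_idPl (ltW xr)).
  case: v vP => -[u a] /= [u1 a1] vP.
  have t1 : nrm u * nrm a <= 1 by rewrite mulr_ile1 ?nrm_ge0.
  have : rho * (nrm u * nrm a) <= rho by rewrite ler_piMr.
  lra.
- move=> [[u a] /= _] [[u' a'] /= _].
  apply: le_trans (chevet_incr u u' a a') _.
  by rewrite [leRHS]/dot big_sumType.
- exact: (integrableD measurableT i1 i2).
- move=> [s1 s2] [[u a] /= [u1 a1]]; rewrite /dot big_sumType/=.
  rewrite -[X in _ + (X + _)]/(dot (fun i => nrm a * u i) (g ^~ s1)).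
  rewrite -[X in _ + (_ + X)]/(dot (fun j => nrm u * a j) (h ^~ s2)) !dotZl.
  have cg := cauchy_schwarz u (g ^~ s1); have ch := cauchy_schwarz a (h ^~ s2).
  have n1 := nrm_ge0 u; have n2 := nrm_ge0 a; have n3 := nrm_ge0 (h ^~ s2).
  have t0 : 0 <= nrm u * nrm a by rewrite mulr_ge0.
  have t1 : nrm u * nrm a <= 1 by rewrite mulr_ile1.
  have b1 : nrm a * dot u (g ^~ s1) <= (nrm u * nrm a) * nrm (g ^~ s1).
    by rewrite (mulrC (nrm u)) -mulrA ler_wpM2l.
  have b2 : nrm u * dot a (h ^~ s2) <= nrm (h ^~ s2).
    apply: le_trans (ler_wpM2l n1 ch) _; rewrite mulrA; exact: ler_piMl.
  have b3 : (nrm u * nrm a) * (nrm (g ^~ s1) - rho) <= Num.max (nrm (g ^~ s1) - rho) 0.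
    have [xr|xr] := leP (nrm (g ^~ s1) - rho) 0.
      by rewrite ?(max_idPr xr) mulr_ge0_le0.
    by rewrite ?(max_idPl (ltW xr)) ler_piMl// ltW.
  rewrite mulrBr in b3; move: b1 b2 b3.
  move: (nrm u * nrm a) (nrm a * dot u _) (nrm u * dot a _) (Num.max _ _) (nrm (h ^~ s2)) (_ * nrm (g ^~ s1)).
  by move=> t x y z p q; rewrite (mulrC t); lra.
Qed.

Lemma chevet_mean : \int[P]_w opR (W ^~ w) <= Num.sqrt #|I|%:R + Num.sqrt #|J|%:R.
Proof.
have [d1 [S1 [Q1 [g gQ]]]] := @gauss_family_exists R I.
have [d2 [S2 [Q2 [h hQ]]]] := @gauss_family_exists R J.
have [ig eg] := mean_nrm gQ.
have E w : Num.max (nrm (g ^~ w) - 0) 0 = nrm (g ^~ w).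
  by rewrite subr0; apply/max_idPl; exact: nrm_ge0.
have ig' : Q1.-integrable setT (EFin \o (fun w => Num.max (nrm (g ^~ w) - 0) 0)).
  by apply: eq_integrable ig => // w _ /=; rewrite E.
have := chevet (lexx 0) gQ hQ ig'.
under eq_Rintegral => w _ do rewrite subr0 (max_idPl (opR_ge0 _)).
by move/le_trans; apply; rewrite lerD2r; under eq_Rintegral => w _ do rewrite E.
Qed.

Lemma chevet_excess :
  \int[P]_w (Num.max (opR (W ^~ w) - Num.sqrt #|I|%:R) 0) <= (Num.sqrt 2)^-1 + Num.sqrt #|J|%:R.
Proof.
have [d1 [S1 [Q1 [g gQ]]]] := @gauss_family_exists R I.
have [d2 [S2 [Q2 [h hQ]]]] := @gauss_family_exists R J.
have [ig eg] := mean_nrm_excess gQ I0.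
by apply: le_trans (chevet (sqrtr_ge0 _) gQ hQ ig) _; rewrite lerD2r.
Qed.

Definition gram (x y : I * J -> R) : J * J -> R := fun jk => \sum_i x (i, jk.1) * y (i, jk.2).

Lemma mulv_gram x y (a b : J -> R) :
  dot a (mulv (gram x y) b) = dot (mulv x a) (mulv y b).
Proof.
transitivity (\sum_j \sum_k \sum_i a j * b k * (x (i, j) * y (i, k))).
  apply: eq_bigr => j _; rewrite /mulv mulr_sumr; apply: eq_bigr => k _.
  by rewrite /gram mulr_suml mulr_sumr; apply: eq_bigr => i _ /=; ring.
under eq_bigr do rewrite exchange_big.
rewrite exchange_big/=; apply: eq_bigr => i _; rewrite mulr_suml.
apply: eq_bigr => j _; rewrite mulr_sumr; apply: eq_bigr => k _; ring.
Qed.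

(** For frozen [B], the form <a, W^T B b> is the bilinear form of [W] on the pair (B b, a), so the
    comparison behind [chevet] applies with B b as left vector. There |a| <g, B b> is at most |B^T
    g|, whose mean is at most the Frobenius norm [nrm B], and |B b| <h, a> is at most [opR B] times
    |h|. *)
Lemma chevet_gram (B : I * J -> R) :
  P.-integrable setT (EFin \o (fun w => opR (gram (W ^~ w) B))) /\
  \int[P]_w opR (gram (W ^~ w) B) <= nrm B + opR B * Num.sqrt #|J|%:R.
Proof.
have [d1 [S1 [Q1 [g gQ]]]] := @gauss_family_exists R I.
have [d2 [S2 [Q2 [h hQ]]]] := @gauss_family_exists R J.
have ghQ := gauss_family_sum gQ hQ; have [mg _] := gQ.
have [ih eh] := mean_nrm hQ.
pose Bt (x : I -> R) : J -> R := fun j => dot (fun i => B (i, j)) x.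
have m1 : measurable_fun setT (fun w => nrm (Bt (g ^~ w))).
  apply: measurable_nrm => j; apply: (measurableT_comp (measurable_dot _)).
  exact: measurable_to_vec.
have sqBt w : nrm (Bt (g ^~ w)) ^+ 2 = \sum_j dot (fun i => B (i, j)) (g ^~ w) ^+ 2.
  by rewrite sqr_nrm; apply: eq_bigr => j _; rewrite expr2.
have iB j := (Rintegral_sqr_dot gQ (fun i => B (i, j))).1.
have [|||||i1 e1] := @mean_le_rms _ _ _ Q1 (fun w => nrm (Bt (g ^~ w))) (nrm B).
- exact: nrm_ge0.
- exact: m1.
- by move=> w; exact: nrm_ge0.
- by apply: eq_integrable (integrable_sumr iB) => // w _ /=; rewrite sqBt.
- under eq_Rintegral => w _ do rewrite sqBt.
  rewrite Rintegral_sum// sqr_nrm /dot.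
  rewrite (eq_bigr (fun ij => (fun i j => B (i, j) * B (i, j)) ij.1 ij.2)); last by case.
  rewrite -(pair_bigA _ (fun i j => B (i, j) * B (i, j)))/= exchange_big/=.
  by apply: ler_sum => j _; rewrite (Rintegral_sqr_dot gQ (fun i => B (i, j))).2.
have cB : @ball_pair R J J -> `|@GRing.zero R| <= opR B by move=> _; rewrite normr0 opR_ge0.
have aB (v : ball_pair J J) (ij : I * J) : `|tens (mulv B (sval v).2) (sval v).1 ij| <= opR B.
  case: v ij => -[a b] /= [a1 b1] [i j]; rewrite /tens /= normrM.
  have := le_trans (ler_nrm (mulv B b) i) (nrm_mulv B b) => h1.
  have h2 := le_trans (ler_nrm a j) a1.
  apply: le_trans (ler_piMr _ h2) _ => //; apply: le_trans h1 _.
  by rewrite ler_piMr// opR_ge0.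
have gE x (v : ball_pair J J) : dot (tens (mulv B (sval v).2) (sval v).1) x =
    dot (tens (sval v).1 (sval v).2) (gram x B).
  by rewrite !dot_tens mulv_gram dotC.
have ub x (v : ball_pair J J) : 0 + dot (tens (mulv B (sval v).2) (sval v).1) x <= opR (gram x B).
  by rewrite add0r gE; exact: opR_ub1.
have sp x e : 0 < e -> exists v : ball_pair J J,
    opR (gram x B) - e <= 0 + dot (tens (mulv B (sval v).2) (sval v).1) x.
  by move=> e0; have [v ?] := opR_sup (gram x B) e0; exists v; rewrite add0r gE.
split; first exact: (integrable_sup_affine (c := fun=> 0) (F := fun x => opR (gram x B)) cB aB ub sp WP).
have i1' : (Q1 \x Q2)%E.-integrable setT (EFin \o (fun z => nrm (Bt (g ^~ z.1)))).
  exact: (integrable_fst Q2 i1).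
have mh : measurable_fun setT (fun w => nrm (h ^~ w)).
  by apply/measurable_EFinP; case/integrableP : ih.
have i2' : (Q1 \x Q2)%E.-integrable setT (EFin \o (fun z => nrm (h ^~ z.2))).
  exact: (integrable_snd Q1 ih).
have i3' : (Q1 \x Q2)%E.-integrable setT (EFin \o (fun z => opR B * nrm (h ^~ z.2))).
  exact: (integrableZl measurableT _ i2').
apply: (@le_trans _ _ (\int[(Q1 \x Q2)%E]_z (nrm (Bt (g ^~ z.1)) + opR B * nrm (h ^~ z.2)))); last first.
  rewrite RintegralD// RintegralZl//.
  rewrite (Rintegral_fst Q1 Q2 m1) (Rintegral_snd Q1 Q2 mh).
  by apply: lerD => //; rewrite ler_wpM2l// opR_ge0.
apply: (sudakov_fernique (c := fun=> 0) (F := fun x => opR (gram x B)) cB aB ub sp WP (b := fun v ij => match ij with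
     | inl i => nrm (sval v).1 * mulv B (sval v).2 i
     | inr j => nrm (mulv B (sval v).2) * (sval v).1 j end) ghQ).
- move=> [[a b] /= _] [[a' b'] /= _].
  apply: le_trans (chevet_incr (mulv B b) (mulv B b') a a') _.
  by rewrite [leRHS]/dot big_sumType.
- exact: (integrableD measurableT i1' i3').
- move=> [s1 s2] [[a b] /= [a1 b1]]; rewrite add0r /dot big_sumType/=.
  rewrite -[X in X + _]/(dot (fun i => nrm a * mulv B b i) (g ^~ s1)).
  rewrite -[X in _ + X]/(dot (fun j => nrm (mulv B b) * a j) (h ^~ s2)) !dotZl.
  have BtE : dot (mulv B b) (g ^~ s1) = dot b (Bt (g ^~ s1)).
    rewrite /dot /mulv; under eq_bigr do rewrite mulr_suml.
    rewrite exchange_big/=; apply: eq_bigr => j _; rewrite /Bt /dot mulr_sumr.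
    by apply: eq_bigr => i _; ring.
  have cg := cauchy_schwarz b (Bt (g ^~ s1)); have ch := cauchy_schwarz a (h ^~ s2).
  have n1 := nrm_ge0 (mulv B b); have n2 := nrm_ge0 a; have n3 := nrm_ge0 (h ^~ s2).
  have n4 := nrm_ge0 (Bt (g ^~ s1)); have n5 := nrm_ge0 b.
  apply: lerD.
    rewrite BtE; apply: le_trans (ler_wpM2l n2 cg) _; rewrite mulrA; apply: ler_piMl => //.
    by rewrite mulr_ile1.
  apply: le_trans (ler_wpM2l n1 ch) _; rewrite mulrA; apply: ler_wpM2r => //.
  apply: le_trans (ler_piMr n1 a1) _; apply: le_trans (nrm_mulv B b) _.
  by rewrite ler_piMr// opR_ge0.
Qed.

End chevet.

(** * The norm of a complex Gaussian matrix *)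

Section complex_gaussian.
Context {R : realType} (I J : finType).
Hypotheses (I0 : (0 < #|I|)%N) (J0 : (0 < #|J|)%N).
Implicit Types (x y : I * J -> R) (a b : J -> R).

(* The squared norm of (x + iy)(a + ib), separated into real and imaginary parts. *)
Definition cplx_sqr x y a b : R :=
  \sum_i ((mulv x a i - mulv y b i) ^+ 2 + (mulv x b i + mulv y a i) ^+ 2).

Lemma cplx_sqrE x y a b : cplx_sqr x y a b =
  dot (mulv x a) (mulv x a) + dot (mulv y a) (mulv y a) +
  (dot (mulv x b) (mulv x b) + dot (mulv y b) (mulv y b)) +
  2 * (dot (mulv x b) (mulv y a) - dot (mulv x a) (mulv y b)).
Proof.
rewrite /cplx_sqr /dot -!big_split -sumrB mulr_sumr -big_split/=.
by apply: eq_bigr => i _; ring.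
Qed.

(** Each of the two mixed terms is at most G |a| |b|, and 2 |a| |b| <= |a|^2 + |b|^2, so together
    they add [2 * G] to the constant [S] of the squared terms. *)
Lemma cplx_sqr_le x y a b (S G : R) :
  (forall a, dot (mulv x a) (mulv x a) + dot (mulv y a) (mulv y a) <= S * dot a a) ->
  0 <= G -> (forall a b, dot (mulv x a) (mulv y b) <= G * (nrm a * nrm b)) ->
  cplx_sqr x y a b <= (S + 2 * G) * (dot a a + dot b b).
Proof.
move=> xyS G0 xyG; rewrite cplx_sqrE.
have := xyS a; have := xyS b; have := xyG b a.
(* The mixed term with the minus sign is bounded by using [xyG] at the opposite vector. *)
have := xyG (fun j => -1 * a j) b.
have -> : mulv x (fun j => -1 * a j) = fun i => -1 * mulv x a i.
  by apply/funext => i; rewrite /mulv mulr_sumr; apply: eq_bigr => j _; ring.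
rewrite nrmZ dotZl normrN1 mul1r mulN1r.
have ab : 2 * (nrm a * nrm b) <= dot a a + dot b b.
  by have := sqr_ge0 (nrm a - nrm b); rewrite sqrrB !sqr_nrm; lra.
have := ler_wpM2l G0 ab.
move: (dot (mulv x a) (mulv x a)) (dot (mulv y a) (mulv y a)) (dot (mulv x b) (mulv x b))
  (dot (mulv y b) (mulv y b)) (dot (mulv x b) (mulv y a)) (dot (mulv x a) (mulv y b)).
move: (dot a a) (dot b b) (nrm a) (nrm b) ab => da db na nb ab.
by move=> *; lra.
Qed.

Definition stack x y : (I + I) * J -> R :=
  fun ij => match ij.1 with inl i => x (i, ij.2) | inr i => y (i, ij.2) end.

Lemma dot_stack x y a : dot (mulv (stack x y) a) (mulv (stack x y) a) =
  dot (mulv x a) (mulv x a) + dot (mulv y a) (mulv y a).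
Proof. by rewrite {1}/dot big_sumType. Qed.

(** The goal is o^2 + 2G <= 2 (m + N)^2. The first summand of [N] absorbs the excess of o over sqrt
    2 m; the second, G / (2m), yields exactly 2G through its product with m in the expanded
    square. *)
Lemma cplx_sqr_stack x y a b (m : R) : 0 < m ->
  let N := (Num.sqrt 2)^-1 * Num.max (opR (stack x y) - Num.sqrt 2 * m) 0 +
    (2 * m)^-1 * opR (gram x y) in
  0 <= N /\ cplx_sqr x y a b <= 2 * (m + N) ^+ 2 * (dot a a + dot b b).
Proof.
move=> m0; set o := opR (stack x y); set G := opR (gram x y) => N.
have s0 : 0 < Num.sqrt 2 :> R by rewrite sqrtr_gt0.
have s2 : Num.sqrt 2 ^+ 2 = 2 :> R by rewrite sqr_sqrtr.
have G0 : 0 <= G by exact: opR_ge0.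
have o0 : 0 <= o by exact: opR_ge0.
have N1 : 0 <= (Num.sqrt 2)^-1 * Num.max (o - Num.sqrt 2 * m) 0.
  by rewrite mulr_ge0 ?invr_ge0 ?(ltW s0)// le_max lexx orbT.
have N2 : 0 <= (2 * m)^-1 * G by apply: mulr_ge0 => //; rewrite invr_ge0 mulr_ge0// ltW.
have N0 : 0 <= N by rewrite addr_ge0.
split => //; have D0 : 0 <= dot a a + dot b b by rewrite addr_ge0 ?dot_ge0.
apply: (@le_trans _ _ ((o ^+ 2 + 2 * G) * (dot a a + dot b b))).
  apply: cplx_sqr_le => // [a'|a' b'].
    rewrite -dot_stack -!sqr_nrm -exprMn lerXn2r ?nnegrE ?nrm_ge0//.
      by rewrite mulr_ge0 ?nrm_ge0.
    exact: nrm_mulv.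
  by rewrite -mulv_gram; exact: opR_ub.
apply: ler_wpM2r => //.
pose x1 := (Num.sqrt 2)^-1 * Num.max (o - Num.sqrt 2 * m) 0.
have ox : o <= Num.sqrt 2 * (m + x1).
  rewrite mulrDr /x1 mulVKf ?gt_eqF// -lerBlDl le_max lexx//.
have ox2 : o ^+ 2 <= 2 * (m + x1) ^+ 2.
  rewrite -s2 -exprMn lerXn2r ?nnegrE// mulr_ge0 ?(ltW s0)// addr_ge0 ?(ltW m0)//.
have -> : 2 * (m + N) ^+ 2 = 2 * (m + x1) ^+ 2 + 2 * G + 2 * (x1 * (G / m)) + 2 * ((2 * m)^-1 * G) ^+ 2.
  by rewrite /N -/x1; field; rewrite gt_eqF.
have h1 : 0 <= x1 * (G / m) by rewrite mulr_ge0// divr_ge0// ltW.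
have h2 := sqr_ge0 ((2 * m)^-1 * G).
by lra.
Qed.

(** The triangle inequality |X + iY| <= |X| + |Y|, with [m] simply discarded. This is affordable
    when #|I| < #|J|, where the leading term is itself of the size of the allowed error. *)
Lemma cplx_sqr_sum x y a b (m : R) : 0 < m ->
  let N := (Num.sqrt 2)^-1 * (opR x + opR y) in
  0 <= N /\ cplx_sqr x y a b <= 2 * (m + N) ^+ 2 * (dot a a + dot b b).
Proof.
move=> m0 N.
have s0 : 0 < Num.sqrt 2 :> R by rewrite sqrtr_gt0.
have s2 : Num.sqrt 2 ^+ 2 = 2 :> R by rewrite sqr_sqrtr.
have ox0 := opR_ge0 x; have oy0 := opR_ge0 y.
have N0 : 0 <= N by rewrite mulr_ge0 ?invr_ge0 ?(ltW s0)// addr_ge0.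
split => //; have D0 : 0 <= dot a a + dot b b by rewrite addr_ge0 ?dot_ge0.
apply: (@le_trans _ _ ((opR x ^+ 2 + opR y ^+ 2 + 2 * (opR x * opR y)) * (dot a a + dot b b))).
  apply: cplx_sqr_le => [a'||a' b'].
  - rewrite mulrDl -!sqr_nrm -!exprMn; apply: lerD;
      by rewrite lerXn2r ?nnegrE ?nrm_ge0 ?mulr_ge0 ?nrm_ge0 ?nrm_mulv.
  - exact: mulr_ge0.
  - apply: le_trans (cauchy_schwarz _ _) _; rewrite mulrACA.
    by apply: ler_pM; rewrite ?nrm_ge0 ?nrm_mulv.
apply: ler_wpM2r => //.
have -> : opR x ^+ 2 + opR y ^+ 2 + 2 * (opR x * opR y) = 2 * N ^+ 2.
  by rewrite /N exprMn exprVn s2; field.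
by rewrite ler_pM2l// lerXn2r ?nnegrE ?addr_ge0 ?(ltW m0)// lerDr ltW.
Qed.

(** [W] has real and imaginary parts of variance 1, whereas Gamma carries an additional factor
    [(Num.sqrt 2)^-1]; this is the factor 2 in the last bound. [N] dominates the excess of the norm
    of Gamma over [Num.sqrt #|I|%:R]. *)
Lemma complex_gaussian_norm :
  exists (d : measure_display) (S : measurableType d) (Q : probability S R)
    (W : (I * J) + (I * J) -> S -> R) (N : S -> R),
  [/\ gauss_family Q W, Q.-integrable setT (EFin \o N),
      \int[Q]_s N s <= 3 * Num.sqrt #|J|%:R, forall s, 0 <= N s &
      forall s a b, cplx_sqr (fun ij => W (inl ij) s) (fun ij => W (inr ij) s) a b <=
        2 * (Num.sqrt #|I|%:R + N s) ^+ 2 * (dot a a + dot b b)].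
Proof.
have [d1 [S1 [Q1 [W1 W1Q]]]] := @gauss_family_exists R (I * J)%type.
have [d2 [S2 [Q2 [W2 W2Q]]]] := @gauss_family_exists R (I * J)%type.
have WQ := gauss_family_sum W1Q W2Q.
set m : R := Num.sqrt #|I|%:R; set l : R := Num.sqrt #|J|%:R.
have m0 : 0 < m by rewrite sqrtr_gt0 ltr0n.
have l1 : 1 <= l by rewrite -sqrtr1 ler_wsqrtr// ler1n.
have s0 : 0 < Num.sqrt 2 :> R by rewrite sqrtr_gt0.
have s2 : Num.sqrt 2 ^+ 2 = 2 :> R by rewrite sqr_sqrtr.
have s15 : Num.sqrt 2 < 3 / 2 :> R.
  by rewrite -(@ltr_pXn2r _ 2) ?nnegrE ?(ltW s0)// s2; lra.
have i1 := integrable_opR W1Q; have i2 := integrable_opR W2Q.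
have e1 := chevet_mean W1Q; have e2 := chevet_mean W2Q.
have io1 := integrable_fst Q2 i1; have io2 := integrable_snd Q1 i2.
have [_ mW1] : True /\ forall ij, measurable_fun setT (W1 ij) by split=> //; case: W1Q.
have [_ mW2] : True /\ forall ij, measurable_fun setT (W2 ij) by split=> //; case: W2Q.
have mo1 : measurable_fun setT (fun w => opR (W1 ^~ w)).
  exact: (measurableT_comp (@measurable_opR R I J) (measurable_family W1Q)).
have mo2 : measurable_fun setT (fun w => opR (W2 ^~ w)).
  exact: (measurableT_comp (@measurable_opR R I J) (measurable_family W2Q)).
exists _, (S1 * S2)%type, (Q1 \x Q2)%E, (fun ij z => match ij with inl k => W1 k z.1 | inr k => W2 k z.2 end).
have [JI|IJ] := leqP #|J| #|I|.
- have lm : l <= m by rewrite ler_wsqrtr// ler_nat.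
  pose W' (ij : (I + I) * J) (z : S1 * S2) := stack (W1 ^~ z.1) (W2 ^~ z.2) ij.
  have W'Q : gauss_family (Q1 \x Q2)%E W'.
    pose phi (ij : (I + I) * J) : (I * J) + (I * J) :=
      match ij.1 with inl i => inl (i, ij.2) | inr i => inr (i, ij.2) end.
    have bphi : bijective phi.
      exists (fun k => match k with inl ij => (inl ij.1, ij.2) | inr ij => (inr ij.1, ij.2) end).
        by move=> [[i|i] j].
      by move=> [[i j]|[i j]].
    have := gauss_family_bij bphi WQ; congr (gauss_family _ _).
    by apply/funext => -[[i|i] j].
  have cII : #|{: I + I}|%:R = 2 * #|I|%:R :> R by rewrite card_sum natrD; ring.
  have II0 : (0 < #|{: I + I}|)%N by rewrite card_sum addn_gt0 I0.
  (* The stacked matrix has twice as many rows, so its norm is compared with [Num.sqrt 2 * m], the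
     level subtracted in [f1]. *)
  have smE : Num.sqrt #|{: I + I}|%:R = Num.sqrt 2 * m by rewrite cII sqrtrM.
  have ex := chevet_excess W'Q II0; rewrite smE in ex.
  pose f1 z := Num.max (opR (W' ^~ z) - Num.sqrt 2 * m) 0.
  pose f2 z := opR (gram (W1 ^~ z.1) (W2 ^~ z.2)).
  have ir : (Q1 \x Q2)%E.-integrable setT (EFin \o f1).
    have iW' := integrable_opR W'Q.
    apply: le_integrable iW' => //.
      apply/measurable_EFinP; apply: measurable_maxr => //; apply: measurable_funB => //.
      exact: (measurableT_comp (@measurable_opR R _ J) (measurable_family W'Q)).
    move=> z _; rewrite /= lee_fin ger0_norm ?le_max ?lexx ?orbT// ger0_norm ?opR_ge0//.
    by rewrite /f1 ge_max opR_ge0 andbT gerBl mulr_ge0// ltW.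
  have mf2 : measurable_fun setT f2.
    apply: (measurableT_comp (@measurable_opR R J J)).
    apply: (@measurable_to_vec R (J * J)%type _ _ (fun jk z => \sum_i W1 (i, jk.1) z.1 * W2 (i, jk.2) z.2)).
    move=> jk; apply: measurable_sum => i; apply: measurable_funM.
      exact: (measurableT_comp (mW1 _)).
    exact: (measurableT_comp (mW2 _)).
  have [inW2 enW2] := mean_nrm W2Q.
  have iol : Q2.-integrable setT (EFin \o (fun y : S2 => opR (W2 ^~ y) * l)).
    have := integrableZl measurableT l i2.
    by apply: eq_integrable => // y _ /=; rewrite mulrC.
  have ib : Q2.-integrable setT (EFin \o (fun y : S2 => nrm (W2 ^~ y) + opR (W2 ^~ y) * l)).
    exact: (integrableD measurableT inW2 iol).
  (* [W2] is frozen: its Frobenius norm has mean at most [m * l] and its operator norm mean at most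
     [m + l]. *)
  have [if2 ef2] : (Q1 \x Q2)%E.-integrable setT (EFin \o f2) /\
      \int[(Q1 \x Q2)%E]_z f2 z <= \int[Q2]_y (nrm (W2 ^~ y) + opR (W2 ^~ y) * l).
    apply: Fubini_bound => // [z|y|y]; first exact: opR_ge0.
      by have [] := chevet_gram W1Q (W2 ^~ y).
    by have [] := chevet_gram W1Q (W2 ^~ y).
  have {}ef2 : \int[(Q1 \x Q2)%E]_z f2 z <= m * l + (m + l) * l.
    apply: le_trans ef2 _; rewrite RintegralD// RintegralZr//; apply: lerD.
      by apply: le_trans enW2 _; rewrite card_prod natrM sqrtrM.
    by rewrite ler_wpM2r// sqrtr_ge0.
  exists (fun z => (Num.sqrt 2)^-1 * f1 z + (2 * m)^-1 * f2 z); split => //.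
  + exact: (integrableD measurableT (integrableZl measurableT _ ir) (integrableZl measurableT _ if2)).
  + have j1 : (Q1 \x Q2)%E.-integrable setT (EFin \o (fun z => (Num.sqrt 2)^-1 * f1 z)).
      exact: (integrableZl measurableT _ ir).
    have j2 : (Q1 \x Q2)%E.-integrable setT (EFin \o (fun z => (2 * m)^-1 * f2 z)).
      exact: (integrableZl measurableT _ if2).
    rewrite RintegralD// !RintegralZl//.
    (* With [1 <= l <= m] and [Num.sqrt 2 < 3 / 2], the stack costs at most 1/2 + 3l/4 and the mixed
       terms at most l + l/2, which is at most 11l/4 in total. *)
    apply: (@le_trans _ _ ((Num.sqrt 2)^-1 * ((Num.sqrt 2)^-1 + l) + (2 * m)^-1 * (m * l + (m + l) * l))).
      by apply: lerD; [rewrite ler_pM2l ?invr_gt0|rewrite ler_pM2l ?invr_gt0 ?mulr_gt0].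
    have -> : (Num.sqrt 2)^-1 * ((Num.sqrt 2)^-1 + l) = 1 / 2 + Num.sqrt 2 * l / 2.
      have -> : (Num.sqrt 2)^-1 = Num.sqrt 2 / 2 :> R.
        by apply: (mulfI (lt0r_neq0 s0)); rewrite mulrA -expr2 s2 !divff ?gt_eqF.
      rewrite (_ : _ / 2 * _ = Num.sqrt 2 ^+ 2 / 4 + Num.sqrt 2 * l / 2); last by field.
      by rewrite s2; field.
    have -> : (2 * m)^-1 * (m * l + (m + l) * l) = l + l * (l / m) / 2.
      by field; rewrite gt_eqF.
    have h1 : l * (l / m) <= l by rewrite ler_piMr ?sqrtr_ge0// ler_pdivrMr// mul1r.
    have h2 : Num.sqrt 2 * l <= 3 / 2 * l by rewrite ler_wpM2r ?sqrtr_ge0// ltW.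
    by move: (Num.sqrt 2 * l) (l * (l / m)) h1 h2 => u v; lra.
  + by move=> z; have [] := cplx_sqr_stack (W1 ^~ z.1) (W2 ^~ z.2) (fun=> 0) (fun=> 0) m0.
  + by move=> z a b; have [_] := cplx_sqr_stack (W1 ^~ z.1) (W2 ^~ z.2) a b m0.
- have ml : m <= l by rewrite ler_wsqrtr// ler_nat ltnW.
  pose f z := opR (W1 ^~ z.1) + opR (W2 ^~ z.2).
  have if_ : (Q1 \x Q2)%E.-integrable setT (EFin \o f).
    exact: (integrableD measurableT io1 io2).
  exists (fun z => (Num.sqrt 2)^-1 * f z); split => //.
  + exact: (integrableZl measurableT _ if_).
  + rewrite RintegralZl// RintegralD// (Rintegral_fst Q1 Q2 mo1) (Rintegral_snd Q1 Q2 mo2).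
    (* Each mean is at most [m + l <= 2 * l], and 4 / sqrt 2 is below 3. *)
    rewrite ler_pdivrMl//; apply: (@le_trans _ _ (4 * l)).
      by move: e1 e2; rewrite -/m -/l; lra.
    rewrite mulrA; apply: ler_wpM2r; first exact: sqrtr_ge0.
    have : 4 / 3 <= Num.sqrt 2 :> R.
      by rewrite -(@ler_pXn2r _ 2) ?nnegrE ?(ltW s0)// s2; lra.
    lra.
  + by move=> z; have [] := cplx_sqr_sum (W1 ^~ z.1) (W2 ^~ z.2) (fun=> 0) (fun=> 0) m0.
  + by move=> z a b; have [_] := cplx_sqr_sum (W1 ^~ z.1) (W2 ^~ z.2) a b m0.
Qed.

End complex_gaussian.

(** * Hermitian matrices *)

Local Open Scope sesquilinear_scope.

Section hermitian_geometry.
Context {R : realType}.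
Implicit Types m n p : nat.

Lemma adjM m n p (A : 'M[R[i]]_(m, n)) (B : 'M[R[i]]_(n, p)) :
  (A *m B) ^t* = B ^t* *m A ^t*.
Proof. by rewrite trmx_mul map_mxM. Qed.

Lemma adjB m n (A B : 'M[R[i]]_(m, n)) : (A - B) ^t* = A ^t* - B ^t*.
Proof. by apply/matrixP => j k; rewrite !mxE raddfB. Qed.

Lemma hermE n (A : 'M[R[i]]_n) : (A \is hermsymmx) = (A ^t* == A).
Proof. by rewrite is_hermitianmxE expr0 scale1r eq_sym. Qed.

Lemma hermP n (A : 'M[R[i]]_n) : reflect (A ^t* = A) (A \is hermsymmx).
Proof. by rewrite hermE; exact: eqP. Qed.

(** The real Euclidean inner product of the real and imaginary parts, see [ipE]; with it real
    Gaussian vectors can be paired with complex matrices. *)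
Definition ip m n (X Y : 'M[R[i]]_(m, n)) : R := complex.Re (\tr (X ^t* *m Y)).

Lemma ReD (x y : R[i]) : complex.Re (x + y) = complex.Re x + complex.Re y.
Proof. by case: x y => [a b] [c d]. Qed.

Lemma Re_sum (I : finType) (F : I -> R[i]) :
  complex.Re (\sum_k F k) = \sum_k complex.Re (F k).
Proof. by apply: (big_morph _ ReD). Qed.

Lemma Re_conjM (x y : R[i]) : complex.Re (x^* * y) =
  complex.Re x * complex.Re y + complex.Im x * complex.Im y.
Proof. by case: x y => [a b] [c d] /=; rewrite mulNr opprK. Qed.

Lemma ipE m n (X Y : 'M[R[i]]_(m, n)) : ip X Y = \sum_j \sum_k
  (complex.Re (X j k) * complex.Re (Y j k) + complex.Im (X j k) * complex.Im (Y j k)).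
Proof.
rewrite /ip /mxtrace Re_sum exchange_big/=; apply: eq_bigr => k _.
by rewrite !mxE Re_sum; apply: eq_bigr => j _; rewrite !mxE Re_conjM.
Qed.

Lemma ipC m n (X Y : 'M[R[i]]_(m, n)) : ip X Y = ip Y X.
Proof.
by rewrite !ipE; do 2 apply: eq_bigr => ? _; congr (_ + _); exact: mulrC.
Qed.

Lemma ipDr m n (X Y Z : 'M[R[i]]_(m, n)) : ip X (Y + Z) = ip X Y + ip X Z.
Proof. by rewrite /ip mulmxDr raddfD/= ReD. Qed.

Lemma ipNr m n (X Y : 'M[R[i]]_(m, n)) : ip X (- Y) = - ip X Y.
Proof. by rewrite /ip mulmxN raddfN/=; case: (\tr _). Qed.

Lemma ipBr m n (X Y Z : 'M[R[i]]_(m, n)) : ip X (Y - Z) = ip X Y - ip X Z.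
Proof. by rewrite ipDr ipNr. Qed.

Lemma ipBl m n (X Y Z : 'M[R[i]]_(m, n)) : ip (X - Y) Z = ip X Z - ip Y Z.
Proof. by rewrite ipC ipBr !(ipC Z). Qed.

Lemma ip_sumr (I : finType) m n (X : 'M[R[i]]_(m, n)) (F : I -> 'M[R[i]]_(m, n)) :
  ip X (\sum_k F k) = \sum_k ip X (F k).
Proof. by rewrite /ip mulmx_sumr [\tr _]raddf_sum Re_sum. Qed.

Lemma ip_suml (I : finType) m n (X : 'M[R[i]]_(m, n)) (F : I -> 'M[R[i]]_(m, n)) :
  ip (\sum_k F k) X = \sum_k ip (F k) X.
Proof. by rewrite ipC ip_sumr; apply: eq_bigr => k _; exact: ipC. Qed.

Lemma ipZr m n (X Y : 'M[R[i]]_(m, n)) (t : R) : ip X (t%:C *: Y) = t * ip X Y.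
Proof.
by rewrite /ip -scalemxAr mxtraceZ; case: (\tr _) => a b /=; rewrite mul0r subr0.
Qed.

Lemma ip_ge0 m n (X : 'M[R[i]]_(m, n)) : 0 <= ip X X.
Proof. by rewrite ipE; do 2 apply: sumr_ge0 => ? _; rewrite addr_ge0// -expr2 sqr_ge0. Qed.

Lemma ip_eq0 m n (X : 'M[R[i]]_(m, n)) : ip X X = 0 -> X = 0.
Proof.
rewrite ipE => /eqP; rewrite psumr_eq0 => [|j _]; last first.
  by apply: sumr_ge0 => ? _; rewrite addr_ge0// -expr2 sqr_ge0.
move=> /allP h; apply/matrixP => j k; rewrite mxE.
have := h j (mem_index_enum _); rewrite psumr_eq0 => [|l _]; last first.
  by rewrite addr_ge0// -expr2 sqr_ge0.
move=> /allP /(_ k (mem_index_enum _)); rewrite -!expr2 paddr_eq0 ?sqr_ge0// !sqrf_eq0.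
by case: (X j k) => a b /= /andP[/eqP -> /eqP ->].
Qed.

Lemma ip_mull m n p (A : 'M[R[i]]_(m, n)) (X : 'M[R[i]]_(n, p)) (Y : 'M[R[i]]_(m, p)) :
  ip (A *m X) Y = ip X (A ^t* *m Y).
Proof. by rewrite /ip adjM mulmxA. Qed.

Lemma ip_mulr m n p (A : 'M[R[i]]_(n, p)) (X : 'M[R[i]]_(m, n)) (Y : 'M[R[i]]_(m, p)) :
  ip (X *m A) Y = ip X (Y *m A ^t* ).
Proof. by rewrite /ip adjM -mulmxA mxtrace_mulC mulmxA. Qed.

Lemma ip_sandwich k m n p (L : 'M[R[i]]_(k, m)) (A : 'M[R[i]]_(m, n)) (Z : 'M[R[i]]_(n, p)) Y :
  ip (L *m A *m Z) Y = ip A (L ^t* *m Y *m Z ^t* ).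
Proof. by rewrite ip_mulr ip_mull mulmxA. Qed.

Lemma ip_adj m n (X Y : 'M[R[i]]_(m, n)) : ip (X ^t* ) (Y ^t* ) = ip X Y.
Proof. by rewrite /ip trmxCK mxtrace_mulC -/(ip Y X) ipC. Qed.

Lemma ip_sub m n (X Y : 'M[R[i]]_(m, n)) :
  ip (X - Y) (X - Y) = ip X X - 2 * ip X Y + ip Y Y.
Proof. by rewrite ipBl !ipBr (ipC Y X); ring. Qed.

Lemma ip_subZ m n (X Y : 'M[R[i]]_(m, n)) (t : R) :
  ip (X - t%:C *: Y) (X - t%:C *: Y) = ip X X - 2 * t * ip X Y + t ^+ 2 * ip Y Y.
Proof. by rewrite ip_sub !ipZr (ipC (_ *: Y)) ipZr; ring. Qed.

Lemma ip_young m n (X Y : 'M[R[i]]_(m, n)) (t : R) : 0 < t ->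
  2 * ip X Y <= t^-1 * ip X X + t * ip Y Y.
Proof.
move=> t0; have := ip_ge0 (X - t%:C *: Y); rewrite ip_subZ => h.
rewrite -subr_ge0 -(pmulr_lge0 _ t0).
suff -> : (t^-1 * ip X X + t * ip Y Y - 2 * ip X Y) * t =
  ip X X - 2 * t * ip X Y + t ^+ 2 * ip Y Y by [].
by field; rewrite gt_eqF.
Qed.

Lemma ip_diag m n (l : 'I_n -> R) (X : 'M[R[i]]_(n, m)) :
  ip X (diag_mx (\row_j (l j)%:C) *m X) = \sum_j l j * \sum_k
    (complex.Re (X j k) ^+ 2 + complex.Im (X j k) ^+ 2).
Proof.
rewrite ipE; apply: eq_bigr => j _; rewrite mulr_sumr; apply: eq_bigr => k _.
by rewrite mul_diag_mx !mxE; case: (X j k) => a b /=; ring.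
Qed.

Lemma herm_spectral n (A : 'M[R[i]]_n) : A \is hermsymmx ->
  exists (U : 'M[R[i]]_n) (l : 'I_n -> R),
    U *m U ^t* = 1%:M /\ A = U ^t* *m diag_mx (\row_j (l j)%:C) *m U.
Proof.
move=> hA; have /orthomx_spectralP AE := hermitian_normalmx hA.
have Uu := spectral_unitarymx A; have /mxOverP rl := hermitian_spectral_diag_real hA.
exists (spectralmx A), (fun j => complex.Re (spectral_diag A 0 j)).
split; first exact/unitarymxP.
have -> : \row_j (complex.Re (spectral_diag A 0 j))%:C = spectral_diag A.
  by apply/rowP => j; rewrite mxE RRe_real.
by rewrite -(invmx_unitary Uu).
Qed.

Section spectral_form.
Variables (n : nat) (A U : 'M[R[i]]_n) (l : 'I_n -> R).
Hypotheses (UU : U *m U ^t* = 1%:M) (AE : A = U ^t* *m diag_mx (\row_j (l j)%:C) *m U).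

Let UU' : U ^t* *m U = 1%:M. Proof. exact: mulmx1C. Qed.

Lemma spectral_eigenvalue x : eigenvalue A x%:C <-> exists j, l j = x.
Proof.
split => [/eigenvalueP[v vA v0]|[j <-]].
  pose w := v *m U ^t*.
  have wD : w *m diag_mx (\row_j (l j)%:C) = x%:C *: w.
    by rewrite /w scalemxAl -vA AE !mulmxA -[RHS]mulmxA UU mulmx1.
  have /rV0Pn [j wj] : w != 0.
    apply: contra v0 => /eqP w0.
    by rewrite -[v]mulmx1 -UU' mulmxA -/w w0 mul0mx.
  exists j; apply: (@complexI R); apply: (mulfI wj).
  by have /matrixP/(_ 0 j) := wD; rewrite mul_mx_diag !mxE => ->; rewrite mulrC.
apply/eigenvalueP; exists (row j U).
  rewrite AE !mulmxA -!row_mul UU mul1mx; apply/rowP => k.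
  by rewrite !mxE (bigD1 j)//= big1 ?addr0 => [|i ij]; rewrite !mxE ?eqxx ?mulr1n// eq_sym (negbTE ij) mulr0n mul0r.
apply/eqP => /(congr1 (fun v => v *m U ^t* )); rewrite -row_mul UU mul0mx.
by move=> /rowP/(_ j); rewrite !mxE eqxx => /eqP; rewrite oner_eq0.
Qed.

Lemma spectral_ip m (X : 'M[R[i]]_(n, m)) : ip X (A *m X) = \sum_j l j * \sum_k
    (complex.Re ((U *m X) j k) ^+ 2 + complex.Im ((U *m X) j k) ^+ 2).
Proof. by rewrite -ip_diag ip_mull AE !mulmxA. Qed.

Lemma spectral_norm m (X : 'M[R[i]]_(n, m)) : ip X X = \sum_j \sum_k
    (complex.Re ((U *m X) j k) ^+ 2 + complex.Im ((U *m X) j k) ^+ 2).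
Proof.
transitivity (ip (U *m X) (U *m X)).
  by rewrite ip_mull mulmxA UU' mul1mx.
by rewrite ipE; do 2 apply: eq_bigr => ? _; rewrite !expr2.
Qed.

(** The eigenvalues are the finitely many values of [l], so the supremum that defines [lambda_max]
    is attained. *)
Lemma spectral_lambda_max : (0 < n)%N ->
  exists j, l j = lambda_max A /\ forall k, l k <= lambda_max A.
Proof.
move=> n0; pose j := [arg max_(j > Ordinal n0) l j]%O.
have lj k : l k <= l j by rewrite /j; case: arg_maxP => // i _; exact.
suff -> : lambda_max A = l j by exists j.
apply/eqP; rewrite eq_le; apply/andP; split.
  apply: ge_sup; first by exists (l j); apply/spectral_eigenvalue; exists j.
  by move=> x /spectral_eigenvalue [k <-].
apply: ub_le_sup; last by apply/spectral_eigenvalue; exists j.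
by exists (l j) => x /spectral_eigenvalue [k <-].
Qed.

End spectral_form.

Lemma rayleigh_le n m (A : 'M[R[i]]_n) (X : 'M[R[i]]_(n, m)) :
  (0 < n)%N -> A \is hermsymmx -> ip X (A *m X) <= lambda_max A * ip X X.
Proof.
move=> n0 /herm_spectral [U [l [UU AE]]].
have [_ [_ lA]] := spectral_lambda_max UU AE n0.
rewrite (spectral_ip AE) (spectral_norm UU) mulr_sumr.
apply: ler_sum => j _; rewrite ler_wpM2r//; apply: sumr_ge0 => k _.
by rewrite addr_ge0 ?sqr_ge0.
Qed.

Lemma rayleigh_max n (A : 'M[R[i]]_n) : (0 < n)%N -> A \is hermsymmx ->
  exists v : 'cV[R[i]]_n, ip v v = 1 /\ ip v (A *m v) = lambda_max A.
Proof.
move=> n0 /herm_spectral [U [l [UU AE]]].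
have [j [<- _]] := spectral_lambda_max UU AE n0.
have Uv k : (U *m (U ^t* *m delta_mx j 0)) k (0 : 'I_1) = (k == j)%:R.
  by rewrite mulmxA UU mul1mx mxE eqxx andbT.
exists (U ^t* *m delta_mx j 0).
rewrite (spectral_ip AE) (spectral_norm UU); split.
  rewrite (bigD1 j)//= big_ord1 Uv eqxx big1 => [|k kj]; first by rewrite /=; ring.
  by rewrite big_ord1 Uv (negbTE kj)/=; ring.
rewrite (bigD1 j)//= big_ord1 Uv eqxx big1 => [|k kj]; first by rewrite /=; ring.
by rewrite big_ord1 Uv (negbTE kj)/=; ring.
Qed.

Lemma ip_col n (v w : 'cV[R[i]]_n) : ip v w = complex.Re ((v ^t* *m w) 0 0).
Proof. by rewrite /ip /mxtrace big_ord1. Qed.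

(** The quadratic form at the [j]-th eigenvector is [l j], hence nonnegative, and the square root is
    taken on the spectrum. *)
Lemma psd_sqrt n (A : 'M[R[i]]_n) : psdmx A ->
  exists B, B ^t* = B /\ B *m B = A.
Proof.
move=> [hA pA]; have [U [l [UU AE]]] := herm_spectral hA.
have l0 j : 0 <= l j.
  have := pA (U ^t* *m delta_mx j 0); rewrite lecE => /andP[_].
  rewrite -mulmxA -ip_col (spectral_ip AE) (bigD1 j)//= big_ord1 big1 => [|k kj].
    by rewrite mulmxA UU mul1mx mxE !eqxx/=; lra.
  by rewrite big_ord1 mulmxA UU mul1mx mxE (negbTE kj)/=; ring.
have UU' : U ^t* *m U = 1%:M by exact: mulmx1C.
pose D := diag_mx (\row_j (Num.sqrt (l j))%:C).
have hD : D ^t* = D.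
  apply/matrixP => j k; rewrite !mxE eq_sym; case: eqVneq => [->|_].
    by rewrite !mulr1n; apply/CrealP; rewrite complex_real.
  by rewrite !mulr0n conjC0.
exists (U ^t* *m D *m U); split; first by rewrite !adjM trmxCK hD mulmxA.
have DD : D *m D = diag_mx (\row_j (l j)%:C).
  rewrite mulmx_diag; congr diag_mx; apply/rowP => j; rewrite !mxE -rmorphM/=.
  by rewrite -expr2 sqr_sqrtr.
by rewrite AE -DD !mulmxA -(mulmxA _ U) UU mulmx1.
Qed.

Lemma posdef_psd n (A : 'M[R[i]]_n) : posdefmx A -> psdmx A.
Proof.
move=> [hA pA]; split => // v; have [->|v0] := eqVneq v 0; last exact/ltW/pA.
by rewrite mulmx0 mxE.
Qed.

(** The adjoint of a nonzero row in the kernel would be a nonzero vector on which the quadratic form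
    vanishes. *)
Lemma posdef_unit n (A : 'M[R[i]]_n) : posdefmx A -> A \in unitmx.
Proof.
move=> [hA pA]; rewrite -row_free_unit -kermx_eq0; apply/eqP/row_matrixP => j.
rewrite row0; apply/eqP/negP => /negP v0.
have vA : row j (kermx A) *m A = 0 by rewrite -row_mul mulmx_ker row0.
have := pA ((row j (kermx A)) ^t* ); rewrite trmxCK vA mul0mx mxE ltxx.
move=> h; suff: false by []; apply: h; apply: contra v0 => /eqP h; apply/eqP.
by rewrite -[LHS]trmxCK h; apply/matrixP => ? ?; rewrite !mxE conjC0.
Qed.

Lemma psd_gram m n (U : 'M[R[i]]_(n, m)) : psdmx (U *m U ^t* ).
Proof.
split; first by apply/hermP; rewrite adjM trmxCK.
move=> v; have -> : v ^t* *m (U *m U ^t* ) *m v = (U ^t* *m v) ^t* *m (U ^t* *m v).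
  by rewrite adjM trmxCK !mulmxA.
rewrite mxE; apply: sumr_ge0 => j _; rewrite !mxE mulrC; exact: mul_conjC_ge0.
Qed.

Lemma l2normE n (v : 'cV[R[i]]_n) : l2norm v = Num.sqrt (ip v v).
Proof.
rewrite /l2norm ipE; congr Num.sqrt; apply: eq_bigr => k _; rewrite big_ord1.
by rewrite !expr2.
Qed.

(** For a unit vector [v] attaining the Rayleigh quotient, expanding |A v - lambda v|^2 >= 0 gives
    |A v|^2 >= lambda^2. *)
Lemma lambda_max_le_opnorm n (A : 'M[R[i]]_n) : (0 < n)%N -> A \is hermsymmx ->
  lambda_max A <= opnorm A.
Proof.
move=> n0 hA; have /hermP adjA := hA.
have [v [v1 vA]] := rayleigh_max n0 hA.
apply: (@le_trans _ _ (l2norm (A *m v))).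
  rewrite l2normE; apply: le_trans (ler_norm _) _.
  rewrite -sqrtr_sqr; apply: ler_wsqrtr.
  have := ip_ge0 (A *m v - (lambda_max A)%:C *: v).
  by rewrite ip_subZ (ipC _ v) v1 vA; lra.
apply: ub_le_sup; last by exists v => //=; rewrite l2normE v1 sqrtr1.
have hAA : A *m A \is hermsymmx by apply/hermP; rewrite adjM adjA.
(* The supremum in [opnorm] only dominates its elements once the set is bounded; |A w|^2 is the
   quadratic form of [A *m A], which bounds it. *)
exists (Num.sqrt (Num.max 0 (lambda_max (A *m A)))) => _ [w /= w1 <-].
rewrite l2normE; apply: ler_wsqrtr; rewrite ip_mull adjA mulmxA.
apply: le_trans (rayleigh_le _ n0 hAA) _.
have {}w1 : ip w w <= 1.
  by move: w1; rewrite l2normE -[X in _ <= X]sqrtr1 ler_psqrt ?nnegrE ?ip_ge0.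
apply: (@le_trans _ _ (Num.max 0 (lambda_max (A *m A)) * ip w w)).
  by rewrite ler_wpM2r ?ip_ge0// le_max lexx orbT.
by rewrite ler_piMr// le_max lexx.
Qed.

(** With A = B^2 the form is the squared norm of B E B. For indefinite [A] it can be negative; this
    is where positivity of the coefficients is used. *)
Lemma ip_psd_ge0 n (A E : 'M[R[i]]_n) : psdmx A -> 0 <= ip E (A *m E *m A).
Proof.
move=> /psd_sqrt [B [hB <-]].
have -> : ip E (B *m B *m E *m (B *m B)) = ip (B *m E *m B) (B *m E *m B).
  by rewrite ip_mulr ip_mull hB !mulmxA.
exact: ip_ge0.
Qed.

(* With S = U W*, the right side minus the left side equals
   2 <E, A E A> + |PAP - QAQ|^2 for E = S - PQ. *)
Lemma ip_increment n m (A P Q : 'M[R[i]]_n) (U W : 'M[R[i]]_(n, m)) :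
  psdmx A -> P ^t* = P -> P *m P = U *m U ^t* -> Q ^t* = Q -> Q *m Q = W *m W ^t* ->
  ip (U ^t* *m A *m U - W ^t* *m A *m W) (U ^t* *m A *m U - W ^t* *m A *m W) <=
  2 * ip (U ^t* *m A *m P - W ^t* *m A *m Q) (U ^t* *m A *m P - W ^t* *m A *m Q).
Proof.
move=> pA hP PP hQ QQ; have [/hermP hA _] := pA.
(* These norms see [X] only through X X^H = B^2, so [X] and the square root [B] are interchangeable
   in them. *)
have same B (X : 'M[R[i]]_(n, m)) : B ^t* = B -> B *m B = X *m X ^t* ->
    ip (X ^t* *m A *m X) (X ^t* *m A *m X) = ip (B *m A *m B) (B *m A *m B) /\
    ip (X ^t* *m A *m B) (X ^t* *m A *m B) = ip (B *m A *m B) (B *m A *m B).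
  move=> hB BB; rewrite !ip_sandwich trmxCK hB !mulmxA -BB -(mulmxA _ X) -BB.
  by rewrite !mulmxA.
have [UU UP] := same P U hP PP; have [WW WQ] := same Q W hQ QQ.
set S := U *m W ^t*.
have UW : ip (U ^t* *m A *m U) (W ^t* *m A *m W) = ip S (A *m S *m A).
  by rewrite /ip !adjM !trmxCK hA !mulmxA mxtrace_mulC !mulmxA.
have UWPQ : ip (U ^t* *m A *m P) (W ^t* *m A *m Q) = ip S (A *m (P *m Q) *m A).
  rewrite [RHS]ipC /ip !adjM !trmxCK hA hP hQ !mulmxA.
  by rewrite -(mulmxA _ A Q) mxtrace_mulC !mulmxA.
have PQPQ : ip (P *m A *m P) (Q *m A *m Q) = ip (P *m Q) (A *m (P *m Q) *m A).
  by rewrite /ip !adjM hA hP hQ !mulmxA mxtrace_mulC !mulmxA.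
clearbody S; clear same.
have SPQ : ip (P *m Q) (A *m S *m A) = ip S (A *m (P *m Q) *m A).
  by rewrite [LHS]ipC [LHS]ip_sandwich hA.
have h1 := ip_psd_ge0 (S - P *m Q) pA.
have h2 := ip_ge0 (P *m A *m P - Q *m A *m Q).
move: h1 h2; rewrite !ip_sub UU UP WW WQ UW UWPQ PQPQ.
rewrite mulmxBr mulmxBl ipBl !ipBr SPQ.
move: (ip (P *m A *m P) _) (ip (Q *m A *m Q) _) (ip S (A *m S *m A)) (ip S _) (ip _ _).
by move=> p q r s t h1 h2; clear -h1 h2; lra.
Qed.

End hermitian_geometry.

(** * The decoupled process *)

Lemma adjD {R : realType} m n (A B : 'M[R[i]]_(m, n)) : (A + B) ^t* = A ^t* + B ^t*.
Proof. by apply/matrixP => j k; rewrite !mxE rmorphD. Qed.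

Lemma adj_sum {R : realType} (I : finType) m n (F : I -> 'M[R[i]]_(m, n)) :
  (\sum_k F k) ^t* = \sum_k (F k) ^t*.
Proof.
apply/matrixP => a b; rewrite !mxE !summxE rmorph_sum.
by apply: eq_bigr => k _; rewrite !mxE.
Qed.

Lemma adj1 {R : realType} n : (1%:M : 'M[R[i]]_n) ^t* = 1%:M.
Proof. by rewrite trmx1 map_mx1. Qed.

Lemma posdef_sqrt {R : realType} n (Z : 'M[R[i]]_n) : posdefmx Z -> exists B C,
  [/\ B ^t* = B, C ^t* = C, B *m C = 1%:M, B *m B = Z & C *m C = invmx Z].
Proof.
move=> pZ; have uZ := posdef_unit pZ.
have [B [hB BB]] := psd_sqrt (posdef_psd pZ).
have uB : B \in unitmx by move: uZ; rewrite -BB unitmx_mul => /andP[].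
have BC : B *m invmx B = 1%:M by exact: mulmxV.
exists B, (invmx B); split => //.
  have : invmx B ^t* *m B = 1%:M by rewrite -{2}hB -adjM BC trmx1 map_mx1.
  by move=> /(congr1 (fun X => X *m invmx B)); rewrite -mulmxA BC mulmx1 mul1mx.
have : invmx B *m invmx B *m Z = 1%:M.
  by rewrite -BB mulmxA -(mulmxA _ (invmx B) B) mulVmx// mulmx1 mulVmx.
by move=> /(congr1 (fun X => X *m invmx Z)); rewrite -[LHS]mulmxA mulmxV// mulmx1 mul1mx.
Qed.

Lemma Im_sum {R : realType} (I : finType) (F : I -> R[i]) :
  complex.Im (\sum_k F k) = \sum_k complex.Im (F k).
Proof.
have ImD (x y : R[i]) : complex.Im (x + y) = complex.Im x + complex.Im y.
  by case: x y => [a b] [c d].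
exact: (big_morph _ ImD).
Qed.

Lemma posdef1 {R : realType} n : posdefmx (1%:M : 'M[R[i]]_n).
Proof.
split; first by apply/hermP; exact: adj1.
move=> v v0; have [_ /(_ v)] := @psd_gram R n n 1%:M.
rewrite adj1 mulmx1 mulmx1 lt0r => ->; rewrite andbT.
apply: contra v0 => /eqP h; apply/eqP/ip_eq0.
by rewrite ip_col h.
Qed.

(** [y] is the average of its two bounds with weights m / (m + e) and e / (m + e), which cancel the
    common factor. *)
Lemma ler_mix {R : realFieldType} (m e y p q : R) : 0 < m -> 0 <= e ->
  y <= (m + e) * p -> y <= (m + e) * q -> y <= m * p + e * q.
Proof.
move=> m0 e0 yp yq; have s0 : 0 < m + e by rewrite ltr_wpDr.
rewrite -(@ler_pM2l _ (m + e))//.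
rewrite (_ : (m + e) * (m * p + e * q) = m * ((m + e) * p) + e * ((m + e) * q)); last by ring.
by rewrite mulrDl; apply: lerD; [rewrite ler_pM2l|exact: ler_wpM2l].
Qed.

(** * Bounding the decoupled process *)

Section decoupling.
Context {R : realType} (n N M : nat).
Variables (A : 'I_n -> 'M[R[i]]_N) (hA : forall k, (A k) ^t* = A k).

Section pointwise.
Variables (Gam : 'I_n -> 'M[R[i]]_(M, N)) (s : R).
Hypothesis s0 : 0 < s.
Hypothesis Gam_le : forall X : 'I_n -> 'M[R[i]]_N,
  ip (\sum_k Gam k *m X k) (\sum_k Gam k *m X k) <= s ^+ 2 * \sum_k ip (X k) (X k).
Variables (U : 'M[R[i]]_(N, M)) (P : 'M[R[i]]_N).
Hypotheses (hP : P ^t* = P) (PP : P *m P = U *m U ^t* ).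

(** Inserting B C = 1 rewrites the sum as the pairing of sum_k Gam_k (P A_k C) with U^H B. Young's
    inequality separates the two; [Gam_le] controls the first, and P^2 = U U^H turns |P A_k C|^2
    into the form of A_k Z^-1 A_k at U. *)
Lemma decoupled_young (Z : 'M[R[i]]_N) (t : R) : posdefmx Z -> 0 < t ->
  2 * (\sum_k ip (Gam k) (U ^t* *m A k *m P)) <=
    t^-1 * s ^+ 2 * ip U ((\sum_k A k *m invmx Z *m A k) *m U) + t * ip U (Z *m U).
Proof.
move=> pZ t0; have [B [C [hB hC BC <- <-]]] := posdef_sqrt pZ.
pose X k := P *m A k *m C.
have -> : \sum_k ip (Gam k) (U ^t* *m A k *m P) = ip (\sum_k Gam k *m X k) (U ^t* *m B).
  rewrite ip_suml; apply: eq_bigr => k _.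
  rewrite [RHS]ip_mulr /X !adjM hP hA hC.
  by rewrite !mulmxA -(mulmxA (U ^t* ) B C) BC mulmx1.
apply: le_trans (ip_young _ _ t0) _; apply: lerD.
  rewrite -mulrA ler_pM2l ?invr_gt0//; apply: le_trans (Gam_le X) _.
  rewrite ler_pM2l ?exprn_gt0// mulmx_suml ip_sumr; apply: ler_sum => k _.
  have -> : ip (X k) (X k) = ip (U ^t* *m (A k *m C)) (U ^t* *m (A k *m C)).
    by rewrite /X -mulmxA [LHS]ip_mull hP [RHS]ip_mull trmxCK !mulmxA PP.
  rewrite -ip_adj [_ ^t*]adjM trmxCK adjM hA hC [leLHS]ip_mull adjM hA hC.
  by rewrite !mulmxA.
by rewrite ler_pM2l// -ip_adj adjM trmxCK hB [leLHS]ip_mull hB mulmxA.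
Qed.

Lemma decoupled_le (Z : 'M[R[i]]_N) (m e : R) (A0 : 'M[R[i]]_N) :
  (0 < N)%N -> A0 \is hermsymmx -> ip U U = 1 -> posdefmx Z ->
  0 < m -> 0 <= e -> s = m + e ->
  ip U (A0 *m U) + 2 / m * (\sum_k ip (Gam k) (U ^t* *m A k *m P)) <=
  lambda_max (A0 + Z + \sum_k A k *m invmx Z *m A k) +
    2 * e / m * Num.sqrt (opnorm (\sum_k A k *m A k)).
Proof.
move=> N0 hA0 U1 pZ m0 e0 sE; set Y := \sum_k ip _ _.
set S2 := \sum_k A k *m A k; set k2 := opnorm S2.
have [hZ _] := pZ.
have hS2 : S2 \is hermsymmx.
  by apply/hermP; rewrite adj_sum; apply: eq_bigr => k _; rewrite adjM hA.
(* The weight [t = s] makes both coefficients equal to [s]. *)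
have Y1 := decoupled_young pZ s0.
have p1 := @posdef1 R N.
have S20 : 0 <= ip U (S2 *m U).
  rewrite /S2 mulmx_suml ip_sumr; apply: sumr_ge0 => k _.
  by rewrite -mulmxA -{1}(hA k) -ip_mull ip_ge0.
have S2k : ip U (S2 *m U) <= k2.
  apply: le_trans (rayleigh_le _ N0 hS2) _; rewrite U1 mulr1.
  exact: lambda_max_le_opnorm.
have k20 : 0 <= k2 by exact: le_trans S2k.
have Y2 t : 0 < t -> 2 * Y <= t^-1 * s ^+ 2 * k2 + t.
  move=> t0; apply: le_trans (decoupled_young p1 t0) _.
  rewrite mul1mx U1 mulr1 lerD2r.
  have c0 : 0 < t^-1 * s ^+ 2 by rewrite mulr_gt0 ?invr_gt0 ?exprn_gt0.
  rewrite (ler_pM2l c0).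
  apply: le_trans S2k; rewrite /S2 invmx1.
  by under eq_bigr do rewrite mulmx1.
(* The weight [t = s * Num.sqrt k2] is optimal; when [k2 = 0] it degenerates, and [t] is sent to 0
   instead. *)
have Y3 : 2 * Y <= 2 * s * Num.sqrt k2.
  move: k20; rewrite le_eqVlt => /orP[/eqP k0|k0].
    rewrite -k0 sqrtr0 mulr0; apply/ler_addgt0Pr => t t0.
    by have := Y2 t t0; rewrite -k0 mulr0.
  have q0 : 0 < Num.sqrt k2 by rewrite sqrtr_gt0.
  apply: le_trans (Y2 (s * Num.sqrt k2) (mulr_gt0 s0 q0)) _.
  rewrite -{2}(sqr_sqrtr (ltW k0)) le_eqVlt; apply/orP; left; apply/eqP.
  by field; rewrite !gt_eqF.
set Phi := ip U (Z *m U) + ip U ((\sum_k A k *m invmx Z *m A k) *m U).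
have {}Y1 : 2 * Y <= s * Phi.
  apply: le_trans Y1 _; rewrite expr2 mulrA mulVf ?gt_eqF// mul1r /Phi.
  by rewrite mulrDr addrC.
have YY : 2 * Y <= m * Phi + e * (2 * Num.sqrt k2).
  by apply: ler_mix => //; rewrite -sE// mulrCA mulrA.
have hX : A0 + Z + \sum_k A k *m invmx Z *m A k \is hermsymmx.
  have [_ [C [_ hC _ _ <-]]] := posdef_sqrt pZ.
  apply/hermP; rewrite !adjD (hermP _ hA0) (hermP _ hZ) adj_sum; congr (_ + _).
  by apply: eq_bigr => k _; rewrite !adjM hA hC !mulmxA.
have := rayleigh_le U N0 hX; rewrite U1 mulr1 !mulmxDl !ipDr => h.
apply: (@le_trans _ _ (ip U (A0 *m U) + (Phi + 2 * e / m * Num.sqrt k2))); last first.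
  by rewrite addrA lerD2r /Phi addrA.
rewrite lerD2l; rewrite -(@ler_pM2l _ m)//.
rewrite (_ : m * (2 / m * Y) = 2 * Y); last by field; rewrite gt_eqF.
rewrite (_ : m * (Phi + _) = m * Phi + e * (2 * Num.sqrt k2))//; field.
by rewrite gt_eqF.
Qed.

End pointwise.

(** Block [k] of the wide matrix Gamma, whose columns are indexed by the pairs [(k, j)]; the factor
    [(Num.sqrt 2)^-1] gives complex entries of variance 1. *)
Definition cplx_mx (J : finType) (p : nat) (x y : 'I_M * (J * 'I_p) -> R) (k : J) :
    'M[R[i]]_(M, p) :=
  \matrix_(a, j) ((Num.sqrt 2)^-1 * x (a, (k, j)) +i* ((Num.sqrt 2)^-1 * y (a, (k, j)))).

Lemma ip_columns p q (X Y : 'M[R[i]]_(p, q)) : ip X Y = \sum_j ip (col j X) (col j Y).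
Proof.
rewrite ipE exchange_big; apply: eq_bigr => j _; rewrite ipE.
by apply: eq_bigr => k _; rewrite big_ord1 !mxE.
Qed.

(** Column [c] of all the blocks [X k], stacked over [k], is a single complex vector a + ib to which
    the hypothesis applies; the columns are then summed. *)
Lemma cplx_mx_le (x y : 'I_M * ('I_n * 'I_N) -> R) (s : R) :
  (forall a b, cplx_sqr x y a b <= 2 * s ^+ 2 * (dot a a + dot b b)) ->
  forall X : 'I_n -> 'M[R[i]]_N,
  ip (\sum_k cplx_mx x y k *m X k) (\sum_k cplx_mx x y k *m X k) <= s ^+ 2 * \sum_k ip (X k) (X k).
Proof.
move=> le X; set T := \sum_k _; have s22 : Num.sqrt 2 ^+ 2 = 2 :> R by rewrite sqr_sqrtr.
have s20 : Num.sqrt 2 != 0 :> R by rewrite gt_eqF// sqrtr_gt0.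
rewrite ip_columns; under [in leRHS]eq_bigr do rewrite ip_columns.
rewrite exchange_big mulr_sumr; apply: ler_sum => c _.
pose a (kj : 'I_n * 'I_N) := complex.Re (X kj.1 kj.2 c).
pose b (kj : 'I_n * 'I_N) := complex.Im (X kj.1 kj.2 c).
have -> : \sum_k ip (col c (X k)) (col c (X k)) = dot a a + dot b b.
  rewrite /dot -big_split/= -(pair_bigA _ (fun k j => a (k, j) * a (k, j) + b (k, j) * b (k, j)))/=.
  apply: eq_bigr => k _; rewrite ipE; apply: eq_bigr => j _.
  by rewrite big_ord1 !mxE.
rewrite -(@ler_pM2l _ 2)// mulrA; apply: le_trans (le a b).
rewrite ipE /cplx_sqr mulr_sumr; apply: ler_sum => i _.
rewrite big_ord1 ![col c T _ _]mxE.
have TE : T i c =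
   ((Num.sqrt 2)^-1 * (mulv x a i - mulv y b i)) +i* ((Num.sqrt 2)^-1 * (mulv x b i + mulv y a i)).
  rewrite /T summxE.
  have -> : \sum_k (cplx_mx x y k *m X k) i c = \sum_(kj : 'I_n * 'I_N)
     cplx_mx x y kj.1 i kj.2 * X kj.1 kj.2 c.
    rewrite -(pair_bigA _ (fun k j => cplx_mx x y k i j * X k j c))/=.
    by apply: eq_bigr => k _; rewrite mxE.
  rewrite /mulv -sumrB -big_split/= !mulr_sumr; apply/eqP; rewrite eq_complex/= Re_sum Im_sum.
  apply/andP; split; apply/eqP; apply: eq_bigr => -[k j] _; rewrite !mxE /a /b/=;
    by case: (X k j c) => p q /=; ring.
rewrite TE/=.
have s2V : 2 * (Num.sqrt 2)^-1 ^+ 2 = 1 :> R by rewrite exprVn s22 divff.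
rewrite le_eqVlt; apply/orP; left; apply/eqP.
transitivity (2 * (Num.sqrt 2)^-1 ^+ 2 * ((mulv x a i - mulv y b i) ^+ 2 + (mulv x b i + mulv y a i) ^+ 2)).
  by ring.
by rewrite s2V mul1r.
Qed.

End decoupling.

(** * The Gaussian pencil *)

Lemma sum_pair {R : nmodType} (I J : finType) (f : I * J -> R) :
  \sum_p f p = \sum_j \sum_k f (j, k).
Proof. by rewrite pair_bigA; apply: eq_bigr => -[]. Qed.

(** * Real coordinates of Hermitian matrices *)

Section gue_coordinates.
Context {R : realType} (M : nat).
Implicit Types (x : 'I_M * 'I_M -> R) (B : 'M[R[i]]_M).

(** [gue_mx] and [gue_coef] treat the two triangles differently, so the sums compared below agree
    only after [(a, b)] is paired with [(b, a)]. *)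
Lemma sum_symmetrize (f g : 'I_M -> 'I_M -> R) :
  (forall a b, f a b + f b a = g a b + g b a) ->
  \sum_a \sum_b f a b = \sum_a \sum_b g a b.
Proof.
move=> fg; have E (h : 'I_M -> 'I_M -> R) :
    2 * (\sum_a \sum_b h a b) = \sum_a \sum_b (h a b + h b a).
  under [RHS]eq_bigr do rewrite big_split.
  by rewrite big_split/= [X in _ + X]exchange_big/=; ring.
apply: (@mulfI _ 2); first by rewrite pnatr_eq0.
by rewrite !E; do 2 apply: eq_bigr => ? _; exact: fg.
Qed.

(** The [M ^ 2] real coordinates fill a square: position [(a, b)] above the diagonal holds the real
    part of that entry, its mirror position the imaginary part. *)
Definition gue_mx x : 'M[R[i]]_M := \matrix_(a, b)
  if a == b then (x (a, a))%:C
  else if (a < b)%N then ((Num.sqrt 2)^-1 * x (a, b)) +i* ((Num.sqrt 2)^-1 * x (b, a))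
  else ((Num.sqrt 2)^-1 * x (b, a)) -i* ((Num.sqrt 2)^-1 * x (a, b)).

(** Coefficients dual to [gue_mx]. The pairing in [gue_mx_dot] has no conjugation and produces minus
    the imaginary part of the upper entry; for Hermitian [B] this is the imaginary part of the lower
    one. *)
Definition gue_coef B (ab : 'I_M * 'I_M) : R :=
  if ab.1 == ab.2 then complex.Re (B ab.1 ab.1)
  else if (ab.1 < ab.2)%N then Num.sqrt 2 * complex.Re (B ab.1 ab.2)
  else Num.sqrt 2 * complex.Im (B ab.1 ab.2).

Lemma gue_coefB B C ab : gue_coef (B - C) ab = gue_coef B ab - gue_coef C ab.
Proof.
case: ab => a b; rewrite /gue_coef/=; case: eqP => _; last case: ifP => _; rewrite !mxE.
- by case: (B _ _) (C _ _) => [? ?] [? ?].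
- by case: (B _ _) (C _ _) => [? ?] [? ?]/=; ring.
- by case: (B _ _) (C _ _) => [? ?] [? ?]/=; ring.
Qed.

Lemma herm_entry B a b : B ^t* = B -> complex.Re (B b a) = complex.Re (B a b) /\
  complex.Im (B b a) = - complex.Im (B a b).
Proof. by move=> /matrixP/(_ b a); rewrite !mxE => <-; case: (B a b). Qed.

Lemma sqr_sqrt2_neq0 : Num.sqrt 2 ^+ 2 = 2 :> R /\ Num.sqrt 2 != 0 :> R.
Proof. by rewrite sqr_sqrtr// gt_eqF// sqrtr_gt0. Qed.

Lemma gue_mx_dot x B : B ^t* = B ->
  \sum_a \sum_b complex.Re (gue_mx x a b * B a b) = \sum_ab gue_coef B ab * x ab.
Proof.
move=> hB; have [s2 s0] := sqr_sqrt2_neq0.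
have s2V : (Num.sqrt 2)^-1 = Num.sqrt 2 / 2 :> R.
  by apply: (mulfI s0); rewrite mulrA -expr2 s2 !divff.
rewrite sum_pair/=.
apply: sum_symmetrize => a b; rewrite !mxE /gue_coef/= (eq_sym b a).
have [Re_ Im_] := herm_entry a b hB; move: Re_ Im_.
case: (ltngtP a b) => [ab|ba|/val_inj <-].
- rewrite (_ : (a == b) = false); last by apply/eqP => E; rewrite E ltnn in ab.
  by case: (B a b) (B b a) => [p q] [p' q'] /= -> ->; rewrite s2V; field.
- rewrite (_ : (a == b) = false); last by apply/eqP => E; rewrite E ltnn in ba.
  by case: (B a b) (B b a) => [p q] [p' q'] /= -> ->; rewrite s2V; field.
- by rewrite eqxx; case: (B a a) => p q /= _ _; ring.
Qed.

(** The coordinates are isometric on Hermitian matrices, so the increments of the GUE process are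
    Frobenius norms of differences of the U^H A_k U. *)
Lemma gue_coef_dot B : B ^t* = B -> \sum_ab gue_coef B ab * gue_coef B ab = ip B B.
Proof.
move=> hB; have [s2 s0] := sqr_sqrt2_neq0; rewrite ipE.
rewrite sum_pair/=.
apply: sum_symmetrize => a b; rewrite /gue_coef/= (eq_sym b a).
have [Re_ Im_] := herm_entry a b hB; move: Re_ Im_.
case: (ltngtP a b) => [ab|ba|/val_inj <-].
- rewrite (_ : (a == b) = false); last by apply/eqP => E; rewrite E ltnn in ab.
  case: (B a b) (B b a) => [p q] [p' q'] /= -> ->.
  transitivity (Num.sqrt 2 ^+ 2 * (p * p + q * q)); first by ring.
  by rewrite s2; ring.
- rewrite (_ : (a == b) = false); last by apply/eqP => E; rewrite E ltnn in ba.
  case: (B a b) (B b a) => [p q] [p' q'] /= -> ->.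
  transitivity (Num.sqrt 2 ^+ 2 * (p * p + q * q)); first by ring.
  by rewrite s2; ring.
- have [_] := herm_entry a a hB; rewrite eqxx; case: (B a a) => p q /= q0 _ _.
  have -> : q = 0 by lra.
  by ring.
Qed.

Lemma gue_mx_herm x : (gue_mx x) ^t* = gue_mx x.
Proof.
apply/matrixP => a b; rewrite !mxE (eq_sym b a).
case: (ltngtP a b) => [ab|ba|/val_inj <-].
- rewrite (_ : (a == b) = false); last by apply/eqP => E; rewrite E ltnn in ab.
  by apply/eqP; rewrite eq_complex/= opprK !eqxx.
- rewrite (_ : (a == b) = false); last by apply/eqP => E; rewrite E ltnn in ba.
  by apply/eqP; rewrite eq_complex/= !eqxx.
- by rewrite eqxx; apply/eqP; rewrite eq_complex/= oppr0 !eqxx.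
Qed.

End gue_coordinates.

Section tensor_form.
Context {R : realType} (N M : nat).

Definition unvec (v : 'cV[R[i]]_(N * M)) : 'M[R[i]]_(N, M) :=
  \matrix_(j, a) v (mxtens_index (j, a)) 0.

Lemma sum_mxtens (f : 'I_(N * M) -> R[i]) :
  \sum_k f k = \sum_j \sum_a f (mxtens_index (j, a)).
Proof.
rewrite (reindex (@mxtens_index N M)); last first.
  by apply: onW_bij; exists (@mxtens_unindex N M); [exact: mxtens_indexK|exact: mxtens_unindexK].
by rewrite sum_pair.
Qed.

Lemma vec_exists (U : 'M[R[i]]_(N, M)) : exists v, unvec v = U.
Proof.
exists (\col_k U (mxtens_unindex k).1 (mxtens_unindex k).2).
by apply/matrixP => j a; rewrite !mxE mxtens_indexK.
Qed.

Lemma ip_unvec v w : ip (unvec v) (unvec w) = ip v w.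
Proof.
rewrite ip_col mxE sum_mxtens Re_sum ipE; apply: eq_bigr => j _; rewrite Re_sum.
by apply: eq_bigr => a _; rewrite !mxE Re_conjM.
Qed.

(** Coordinate [(j, a)] of [v] is [U j a]; summing over the indices of [A] leaves U^H A U, paired
    with [G] entry by entry and without transposition. *)
Lemma ip_tens (A : 'M[R[i]]_N) (G : 'M[R[i]]_M) v :
  let U := unvec v in ip v ((A *t G) *m v) =
  \sum_a \sum_b complex.Re (G a b * (U ^t* *m A *m U) a b).
Proof.
move=> U; rewrite ip_col mxE sum_mxtens.
under eq_bigr => j _.
  under eq_bigr => a _.
    rewrite [(_ *m v) _ _]mxE sum_mxtens mulr_sumr.
    under eq_bigr => k _.
      rewrite mulr_sumr.
      under eq_bigr => b _ do rewrite tensmxE.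
      over.
    over.
  over.
rewrite exchange_big/=.
under [RHS]eq_bigr do rewrite -Re_sum.
rewrite -Re_sum; congr (complex.Re _); apply: eq_bigr => a _.
under eq_bigr do rewrite exchange_big/=.
rewrite exchange_big/=; apply: eq_bigr => b _.
rewrite mxE mulr_sumr exchange_big/=; apply: eq_bigr => k _.
rewrite !mxE mulr_suml mulr_sumr; apply: eq_bigr => j _.
by rewrite !mxE; ring.
Qed.

Lemma adj_tens (A : 'M[R[i]]_N) (G : 'M[R[i]]_M) : (A *t G) ^t* = A ^t* *t G ^t*.
Proof. by apply/matrixP => j k; rewrite !mxE rmorphM. Qed.

End tensor_form.

Lemma adjZ {R : realType} m n (t : R) (X : 'M[R[i]]_(m, n)) :
  (t%:C *: X) ^t* = t%:C *: X ^t*.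
Proof.
apply/matrixP => j k; rewrite !mxE rmorphM; congr (_ * _).
by apply/CrealP; rewrite complex_real.
Qed.

(** * The pencil as a supremum of affine Gaussian functionals *)

Section gaussian_pencil.
Context {R : realType} (n N M : nat).
Variables (A0 : 'M[R[i]]_N) (A : 'I_n -> 'M[R[i]]_N).
Hypotheses (hn : (0 < n)%N) (hN : (0 < N)%N) (hM : (0 < M)%N).
Hypotheses (hA0 : A0 \is hermsymmx) (hA : forall k, psdmx (A k)).
Local Notation I := ('I_n * ('I_M * 'I_M))%type.

Let adjA k : (A k) ^t* = A k. Proof. by have [/hermP] := hA k. Qed.

Definition pencil (x : I -> R) : 'M[R[i]]_(N * M) :=
  A0 *t 1%:M + ((Num.sqrt (M%:R : R))^-1)%:C *:
    \sum_(k < n) A k *t gue_mx (fun ab => x (k, ab)).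

Definition pencil_cst (U : 'M[R[i]]_(N, M)) : R := ip U (A0 *m U).

Definition pencil_coef (U : 'M[R[i]]_(N, M)) (i : I) : R :=
  (Num.sqrt M%:R)^-1 * gue_coef (U ^t* *m A i.1 *m U) i.2.

Lemma pencil_herm x : pencil x \is hermsymmx.
Proof.
apply/hermP; rewrite /pencil adjD adj_tens adj1 (hermP _ hA0) adjZ adj_sum; congr (_ + _ *: _).
by apply: eq_bigr => l _; rewrite adj_tens adjA gue_mx_herm.
Qed.

Lemma ip_pencil x v : ip v (pencil x *m v) =
  pencil_cst (unvec v) + dot (pencil_coef (unvec v)) x.
Proof.
rewrite /pencil mulmxDl ipDr -scalemxAl ipZr mulmx_suml ip_sumr; congr (_ + _).
  rewrite ip_tens /pencil_cst /ip mulmxA /mxtrace Re_sum; apply: eq_bigr => a _.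
  rewrite (bigD1 a)//= big1 => [|b ba]; first by rewrite !mxE eqxx mul1r addr0.
  by rewrite !mxE eq_sym (negbTE ba) mul0r.
rewrite /dot sum_pair mulr_sumr; apply: eq_bigr => k _.
rewrite ip_tens gue_mx_dot; last by rewrite !adjM adjA trmxCK mulmxA.
by rewrite mulr_sumr; apply: eq_bigr => ab _; rewrite /pencil_coef/= mulrA.
Qed.

(** When [ip U U = 1] every entry of [U] has modulus at most 1, hence a bound uniform in [U]. The
    finite nets and the integrability of the supremum rest on it. *)
Lemma pencil_coef_bound (B : 'M[R[i]]_N) : exists C, 0 <= C /\
  forall (U : 'M[R[i]]_(N, M)) a b, ip U U = 1 ->
  `|complex.Re ((U ^t* *m B *m U) a b)| <= C /\
  `|complex.Im ((U ^t* *m B *m U) a b)| <= C.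
Proof.
pose K := \sum_j \sum_k `|B k j|.
have K0 : 0 <= K by do 2 apply: sumr_ge0 => ? _.
have KE : K = (complex.Re K)%:C by rewrite RRe_real// ger0_real.
exists (complex.Re K); split.
  by rewrite -lecR -KE.
move=> U a b U1.
have U_le j c : `|U j c| <= 1.
  rewrite normc_def lecR -sqrtr1; apply: ler_wsqrtr; rewrite -U1 ipE.
  rewrite (bigD1 j)//= (bigD1 c)//= !expr2 -addrA lerDl addr_ge0//.
    by apply: sumr_ge0 => ? _; rewrite addr_ge0// -expr2 sqr_ge0.
  by do 2 apply: sumr_ge0 => ? _; rewrite addr_ge0// -expr2 sqr_ge0.
have le : `|(U ^t* *m B *m U) a b| <= (complex.Re K)%:C.
  rewrite -KE mxE; apply: le_trans (ler_norm_sum _ _ _) _; apply: ler_sum => j _.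
  rewrite normrM; apply: (@le_trans _ _ (`|(U ^t* *m B) a j| * 1)).
    by rewrite ler_wpM2l.
  rewrite mulr1 mxE; apply: le_trans (ler_norm_sum _ _ _) _; apply: ler_sum => k _.
  by rewrite normrM !mxE norm_conjC ler_piMl.
move: le; rewrite normc_def lecR; case: ((U ^t* *m B *m U) a b) => p q /= le.
split; apply: le_trans le; rewrite -sqrtr_sqr; apply: ler_wsqrtr.
  by rewrite lerDl sqr_ge0.
by rewrite lerDr sqr_ge0.
Qed.

Lemma pencil_bounded : exists C, forall U : 'M[R[i]]_(N, M), ip U U = 1 ->
  `|pencil_cst U| <= C /\ forall i, `|pencil_coef U i| <= C.
Proof.
have [C0 [C00 C0P]] := pencil_coef_bound A0.
have /choice [C1 C1P] : forall k, exists C, 0 <= C /\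
  forall (U : 'M[R[i]]_(N, M)) a b, ip U U = 1 ->
  `|complex.Re ((U ^t* *m A k *m U) a b)| <= C /\
  `|complex.Im ((U ^t* *m A k *m U) a b)| <= C.
  by move=> k; exact: pencil_coef_bound.
have [s2 _] := @sqr_sqrt2_neq0 R.
have s0 : 1 <= Num.sqrt 2 :> R by rewrite -[leLHS]sqrtr1 ler_wsqrtr// ler1n.
set m : R := Num.sqrt M%:R; have m0 : 0 < m by rewrite sqrtr_gt0 ltr0n.
pose K := \sum_k C1 k.
have K0 : 0 <= K by apply: sumr_ge0 => k _; have [] := C1P k.
exists (M%:R * C0 + m^-1 * (Num.sqrt 2 * K)) => U U1.
have t0 : 0 <= m^-1 * (Num.sqrt 2 * K).
  by rewrite mulr_ge0 ?invr_ge0 ?(ltW m0)// mulr_ge0// ltW// (lt_le_trans _ s0).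
split.
  apply: (@le_trans _ _ (M%:R * C0)); last by rewrite lerDl.
  rewrite /pencil_cst /ip mulmxA /mxtrace Re_sum; apply: le_trans (ler_norm_sum _ _ _) _.
  rewrite mulr_natl -[in leRHS](card_ord M) -sumr_const; apply: ler_sum => a _.
  by have [] := C0P U a a U1.
move=> [k [a b]]; apply: (@le_trans _ _ (m^-1 * (Num.sqrt 2 * K))); last first.
  by rewrite lerDr mulr_ge0.
have CK : C1 k <= K.
  by rewrite /K (bigD1 k)//= lerDl; apply: sumr_ge0 => j _; have [] := C1P j.
have CK2 : C1 k <= Num.sqrt 2 * K.
  by apply: le_trans CK _; rewrite ler_peMl.
rewrite /pencil_coef normrM ger0_norm ?invr_ge0 ?(ltW m0)//.
rewrite ler_pM2l ?invr_gt0// /gue_coef/=.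
have [_ h] := C1P k.
have s00 : 0 <= Num.sqrt 2 :> R by exact: sqrtr_ge0.
case: ifP => _; first by have [h1 _] := h U a a U1; exact: le_trans h1 CK2.
have [hr hi] := h U a b U1.
by case: ifP => _; rewrite normrM (ger0_norm s00); apply: ler_wpM2l => //; apply: le_trans CK.
Qed.

Definition unit_mx := {U : 'M[R[i]]_(N, M) | ip U U = 1}.

Lemma pencil_ge x (U : unit_mx) :
  pencil_cst (sval U) + dot (pencil_coef (sval U)) x <= lambda_max (pencil x).
Proof.
case: U => U /= U1; have [v vU] := vec_exists U.
rewrite -vU -ip_pencil; apply: le_trans (rayleigh_le _ _ (pencil_herm x)) _.
  by rewrite muln_gt0 hN.
by rewrite -ip_unvec vU U1 mulr1.
Qed.

Lemma pencil_sup x e : 0 < e -> exists U : unit_mx,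
  lambda_max (pencil x) - e <= pencil_cst (sval U) + dot (pencil_coef (sval U)) x.
Proof.
move=> e0; have [|v [v1 vE]] := @rayleigh_max R _ (pencil x) _ (pencil_herm x).
  by rewrite muln_gt0 hN.
have U1 : ip (unvec v) (unvec v) = 1 by rewrite ip_unvec.
exists (exist _ (unvec v) U1) => /=; rewrite -ip_pencil vE; lra.
Qed.

Section over_gauss_family.
Context d (T : measurableType d) (P : probability T R) (g : I -> T -> R).
Hypothesis gP : gauss_family P g.

Lemma integrable_lambda_max :
  P.-integrable setT (EFin \o (fun w => lambda_max (pencil (g ^~ w)))).
Proof.
have [C CP] := pencil_bounded.
exact: (integrable_sup_affine (c := fun U : unit_mx => pencil_cst (sval U))
  (a := fun U : unit_mx => pencil_coef (sval U))
  (fun U => (CP _ (svalP U)).1) (fun U i => (CP _ (svalP U)).2 i)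
  pencil_ge pencil_sup gP).
Qed.

Lemma mean_lambda_max (Z : 'M[R[i]]_N) : posdefmx Z ->
  \int[P]_w lambda_max (pencil (g ^~ w)) <=
  lambda_max (A0 + Z + \sum_k A k *m invmx Z *m A k) +
  6 * Num.sqrt ((n%:R * N%:R) / M%:R) * Num.sqrt (opnorm (\sum_(k < n) A k *m A k)).
Proof.
move=> pZ; have [C CP] := pencil_bounded.
have I0 : (0 < #|'I_M|)%N by rewrite card_ord.
have J0 : (0 < #|{: 'I_n * 'I_N}|)%N by rewrite card_prod !card_ord muln_gt0 hn.
have [d' [S [Q [W [e [WQ ie me e0 We]]]]]] := @complex_gaussian_norm R _ _ I0 J0.
set m : R := Num.sqrt M%:R; have m0 : 0 < m by rewrite sqrtr_gt0 ltr0n.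
rewrite card_ord -/m in We.
have [s2 s0] := @sqr_sqrt2_neq0 R.
set lm := lambda_max (A0 + _ + _); set kap := Num.sqrt (opnorm _).
have /choice [rt rtP] : forall U : 'M[R[i]]_(N, M), exists B, B ^t* = B /\ B *m B = U *m U ^t*.
  by move=> U; exact/psd_sqrt/psd_gram.
pose K (U : unit_mx) k := (sval U) ^t* *m A k *m rt (sval U).
(* The decoupled process has factor [2 / m]; the [(Num.sqrt 2)^-1] inside Gamma turns it into
   [Num.sqrt 2 / m] on the real variables. *)
pose b (U : unit_mx) (ij : 'I_M * ('I_n * 'I_N) + 'I_M * ('I_n * 'I_N)) : R :=
  Num.sqrt 2 / m * match ij with
  | inl (a, (k, j)) => complex.Re (K U k a j)
  | inr (a, (k, j)) => complex.Im (K U k a j)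
  end.
pose Y (s : S) : R := lm + 2 / m * kap * e s.
have iY : Q.-integrable setT (EFin \o Y).
  exact: (integrableD measurableT (finite_measure_integrable_cst Q lm measurableT)
    (integrableZl measurableT (2 / m * kap) ie)).
have sumb (f f' : 'I_n -> 'M[R[i]]_(M, N)) :
  \sum_k ip (f k) (f' k) = \sum_a \sum_k \sum_j
   (complex.Re (f k a j) * complex.Re (f' k a j) + complex.Im (f k a j) * complex.Im (f' k a j)).
  by rewrite exchange_big; apply: eq_bigr => k _; rewrite ipE.
(* Both squared increments split over [k] with the common factor [m^-1 ^+ 2], and (sqrt 2)^2
   supplies the factor 2 of [ip_increment]. *)
have incr (U V : unit_mx) :
    dot (fun i => pencil_coef (sval U) i - pencil_coef (sval V) i)
        (fun i => pencil_coef (sval U) i - pencil_coef (sval V) i) <=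
    dot (fun i => b U i - b V i) (fun i => b U i - b V i).
  have -> : dot (fun i => b U i - b V i) (fun i => b U i - b V i) =
      \sum_k m^-1 ^+ 2 * (2 * ip (K U k - K V k) (K U k - K V k)).
    have E : m^-1 ^+ 2 * 2 = (Num.sqrt 2 / m) ^+ 2 by rewrite exprMn s2 mulrC.
    under [RHS]eq_bigr do rewrite mulrA E.
    rewrite -mulr_sumr sumb /dot big_sumType/= !sum_pair -big_split mulr_sumr.
    apply: eq_bigr => a _; rewrite !sum_pair -big_split mulr_sumr; apply: eq_bigr => k _.
    rewrite -big_split mulr_sumr; apply: eq_bigr => j _; rewrite /b.
    rewrite ![(K U k - K V k) a j]mxE ![(- K V k) a j]mxE.
    by case: (K U k a j) (K V k a j) => [p q] [p' q'] /=; ring.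
  rewrite /dot sum_pair; apply: ler_sum => k _.
  set BU := (sval U) ^t* *m A k *m sval U; set BV := (sval V) ^t* *m A k *m sval V.
  have hB (X : 'M[R[i]]_(N, M)) : (X ^t* *m A k *m X) ^t* = X ^t* *m A k *m X.
    by rewrite !adjM adjA trmxCK mulmxA.
  have hD : (BU - BV) ^t* = BU - BV by rewrite adjB !hB.
  have -> : \sum_ab (pencil_coef (sval U) (k, ab) - pencil_coef (sval V) (k, ab)) *
      (pencil_coef (sval U) (k, ab) - pencil_coef (sval V) (k, ab)) =
      m^-1 ^+ 2 * ip (BU - BV) (BU - BV).
    rewrite -gue_coef_dot// mulr_sumr; apply: eq_bigr => ab _.
    by rewrite /pencil_coef gue_coefB/= -/m -/BU -/BV; ring.
  rewrite ler_pM2l ?exprn_gt0 ?invr_gt0//.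
  have [hU UU] := rtP (sval U); have [hV VV] := rtP (sval V).
  exact: ip_increment.
have ub (s : S) (U : unit_mx) : pencil_cst (sval U) + dot (b U) (W ^~ s) <= Y s.
  pose Gam := cplx_mx (fun ij => W (inl ij) s) (fun ij => W (inr ij) s).
  have E : 2 / m * (Num.sqrt 2)^-1 = Num.sqrt 2 / m.
    by rewrite -[X in X / m * _]s2; field; rewrite s0 gt_eqF.
  have -> : dot (b U) (W ^~ s) = 2 / m * \sum_k ip (Gam k) (K U k).
    rewrite sumb /dot big_sumType/= !sum_pair -big_split mulr_sumr.
    apply: eq_bigr => a _; rewrite !sum_pair -big_split mulr_sumr; apply: eq_bigr => k _.
    rewrite -big_split mulr_sumr; apply: eq_bigr => j _; rewrite /b !mxE -E/=.
    by ring.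
  have [hU UU] := rtP (sval U).
  have es : 0 < m + e s by rewrite ltr_wpDr.
  have := decoupled_le adjA es (cplx_mx_le (We s)) hU UU hN hA0 (svalP U) pZ m0 (e0 s) erefl.
  rewrite -/lm -/kap => /le_trans; apply; rewrite lerD2l.
  by rewrite le_eqVlt; apply/orP; left; apply/eqP; ring.
apply: le_trans (sudakov_fernique (c := fun U : unit_mx => pencil_cst (sval U))
  (a := fun U : unit_mx => pencil_coef (sval U)) (F := fun x => lambda_max (pencil x))
  (fun U => (CP _ (svalP U)).1) (fun U i => (CP _ (svalP U)).2 i)
  pencil_ge pencil_sup gP WQ incr iY ub) _.
rewrite /Y RintegralD//; last first.
- exact: (integrableZl measurableT (2 / m * kap) ie).
- exact: (finite_measure_integrable_cst Q lm measurableT).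
have -> : \int[Q]__ lm = lm.
  by rewrite Rintegral_cst//= [X in fine X]probability_setT mulr1.
rewrite RintegralZl// lerD2l.
rewrite card_prod !card_ord natrM in me.
(* The 2 of the decoupled process meets the 3 of the mean excess. *)
apply: (@le_trans _ _ (2 / m * kap * (3 * Num.sqrt (n%:R * N%:R)))).
  by rewrite ler_wpM2l// mulr_ge0 ?sqrtr_ge0// divr_ge0// ltW.
have -> : Num.sqrt (n%:R * N%:R / M%:R) = Num.sqrt (n%:R * N%:R) / m :> R.
  by rewrite [LHS]sqrtrM ?mulr_ge0// sqrtrV.
by rewrite le_eqVlt; apply/orP; left; apply/eqP; ring.
Qed.

End over_gauss_family.

End gaussian_pencil.

(** * Coordinates of GUE matrices *)

Section normal_scaling.
Context {R : realType}.
Local Notation mu := lebesgue_measure.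

Lemma mul_measurable (s : R) :
  measurable_fun setT ( *%R s : measurableTypeR R -> measurableTypeR R).
Proof. exact: measurable_funM. Qed.

(** The image of Lebesgue measure under multiplication by [s > 0] is Lebesgue measure divided by
    [s]; the factor restores it, which gives the linear change of variables. *)
Definition scaled_measure (s : {nonneg R}) : {measure set (measurableTypeR R) -> \bar R} :=
  mscale s (measure_function_pushforward__canonical__measure_function_Measure
    mu (mul_measurable s%:num)).

Lemma scaled_measureE (s : R) (s0 : 0 < s) (A : set R) : measurable A ->
  scaled_measure (NngNum (ltW s0)) A = mu A.
Proof.
move=> mA; apply/esym/lebesgue_measure_unique => // _ [[a b]] _ <-.
transitivity (s%:E * mu `](s^-1 * a)%R, (s^-1 * b)%R]%classic)%E; last first.
  rewrite /scaled_measure /mscale/= /pushforward; congr (_ * mu _)%E.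
  apply/seteqP; split => x /=; rewrite !in_itv/=.
    by rewrite ltr_pdivrMl// ler_pdivlMl.
  by rewrite ltr_pdivrMl// ler_pdivlMl.
rewrite !lebesgue_measure_itv/= !lte_fin ltr_pM2l ?invr_gt0//.
case: ifP => _; last by rewrite mule0.
by rewrite -!EFinB -EFinM -mulrBr mulVKf// gt_eqF.
Qed.

Lemma normal_pdf_scale (s sg x : R) : 0 < s -> 0 < sg ->
  normal_pdf 0 sg x = s * normal_pdf 0 (s * sg) (s * x).
Proof.
move=> s0 g0; rewrite /normal_pdf !gt_eqF ?mulr_gt0// mulrA; congr (_ * _).
  rewrite /normal_peak (_ : (s * sg) ^+ 2 * pi *+ 2 = s ^+ 2 * (sg ^+ 2 * pi *+ 2)); last first.
    by rewrite exprMn mulrnAr mulrA.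
  rewrite sqrtrM ?sqr_ge0// sqrtr_sqr gtr0_norm//.
  by rewrite invfM mulVKf// gt_eqF.
rewrite /normal_fun; congr expR; rewrite !subr0.
by field; rewrite !gt_eqF.
Qed.

(** Used with standard deviation [Num.sqrt (1 / 2)] and [s = Num.sqrt 2], which makes the parts of
    off-diagonal GUE entries standard. *)
Lemma normal_prob_scale (s sg : R) (A : set R) : 0 < s -> 0 < sg -> measurable A ->
  normal_prob 0 sg (( *%R s) @^-1` A) = normal_prob 0 (s * sg) A.
Proof.
move=> s0 g0 mA.
have mpdf : measurable_fun A (fun x : R => (normal_pdf 0 (s * sg) x)%:E).
  by apply/measurable_EFinP; apply: measurable_funTS; exact: measurable_normal_pdf.
have pdf0 x : A x -> (0 <= (normal_pdf 0 (s * sg) x)%:E)%E.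
  by move=> _; rewrite lee_fin normal_pdf_ge0.
transitivity (\int[scaled_measure (NngNum (ltW s0))]_(x in A) (normal_pdf 0 (s * sg) x)%:E)%E; last first.
  by apply: eq_measure_integral => B mB _; exact: scaled_measureE.
rewrite ge0_integral_mscale// ge0_integral_pushforward//; last first.
  by move=> x /[!inE]; exact: pdf0.
rewrite /normal_prob -ge0_integralZl//=.
- by apply: eq_integral => x _; rewrite (normal_pdf_scale _ s0 g0) EFinM.
- by rewrite -[X in measurable X]setTI; exact: mul_measurable.
- apply/measurable_EFinP; apply: measurable_funTS.
  exact: (measurableT_comp (measurable_normal_pdf _ _) (mul_measurable s)).
- by move=> x; exact: pdf0.
- by rewrite lee_fin ltW.
Qed.

End normal_scaling.

Section gue_family.
Context {R : realType} d (T : measurableType d) (P : probability T R) (M : nat).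

(** The inverse of [gue_mx]. Below the diagonal it reads the mirrored upper entry, since [is_GUE]
    states laws and independence for upper entries. *)
Definition gue_coord (G : T -> 'M[R[i]]_M) (ab : 'I_M * 'I_M) (w : T) : R :=
  if ab.1 == ab.2 then complex.Re (G w ab.1 ab.1)
  else if (ab.1 < ab.2)%N then Num.sqrt 2 * complex.Re (G w ab.1 ab.2)
  else Num.sqrt 2 * complex.Im (G w ab.2 ab.1).

Lemma gue_coordK (G : T -> 'M[R[i]]_M) w : G w \is hermsymmx ->
  gue_mx (fun ab => gue_coord G ab w) = G w.
Proof.
move=> /hermP hG; have [_ s0] := @sqr_sqrt2_neq0 R.
have E p q : (Num.sqrt 2)^-1 * (Num.sqrt 2 * p) +i* ((Num.sqrt 2)^-1 * (Num.sqrt 2 * q)) = p +i* q.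
  by rewrite !mulKf.
apply/matrixP => a b; rewrite mxE /gue_coord/= !eqxx (eq_sym b a).
have [hr hi] := herm_entry a b hG; move: hr hi.
case: (ltngtP a b) => [ab|ba|/val_inj <-].
- rewrite (_ : (a == b) = false); last by apply/eqP => e; rewrite e ltnn in ab.
  by move=> _ _; rewrite E; case: (G w a b).
- rewrite (_ : (a == b) = false); last by apply/eqP => e; rewrite e ltnn in ba.
  by rewrite !mulKf//; case: (G w a b) (G w b a) => [p q] [p' q'] /= -> ->; rewrite opprK.
- rewrite eqxx => _ h; apply/eqP; rewrite eq_complex/= eqxx/=; move: h.
  by case: (G w a a) => p q /= h; apply/eqP; lra.
Qed.

(** Independence in [is_GUE] is indexed by the upper triangle, so each off-diagonal position has to
    collect the factor of its mirror image. *)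
Lemma prod_triangle (F : 'I_M * 'I_M -> \bar R) :
  (\prod_ab F ab = \prod_(s : {ab : 'I_M * 'I_M | (ab.1 <= ab.2)%N})
    (if (val s).1 == (val s).2 then F (val s) else F (val s) * F ((val s).2, (val s).1)))%E.
Proof.
rewrite -(big_sub (fun ab : 'I_M * 'I_M => (ab.1 <= ab.2)%N)
  (fun ab => if ab.1 == ab.2 then F ab else F ab * F (ab.2, ab.1))%E).
rewrite (bigID (fun ab : 'I_M * 'I_M => (ab.1 <= ab.2)%N))/=.
rewrite [RHS](bigID (fun ab : 'I_M * 'I_M => ab.1 == ab.2))/=.
rewrite [X in (X * _)%E](bigID (fun ab : 'I_M * 'I_M => ab.1 == ab.2))/=.
rewrite -muleA; congr (_ * _)%E.
  by apply: eq_bigr => ab /andP[_ ->].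
under [RHS]eq_bigr => ab /andP[_ /negbTE h] do rewrite h.
rewrite big_split/=; congr (_ * _)%E.
rewrite [RHS](reindex_inj (h := fun ab : 'I_M * 'I_M => (ab.2, ab.1)))/=; last first.
  by move=> [a b] [a' b'] [-> ->].
apply: eq_big => [[a b]|[a b]]//=.
by change (~~ (a <= b)%N = (b <= a)%N && (b != a)); rewrite -ltnNge ltn_neqAle andbC.
Qed.

Lemma sigma_bigcap (S : set (set T)) (J : finType) (E : J -> set T) :
  (forall j, <<s S >> (E j)) -> <<s S >> (\bigcap_(j in setT) E j).
Proof.
move=> SE.
exact: (@fin_bigcap_measurable _ (g_sigma_algebraType S) _ setT E finite_finset (fun j _ => SE j)).
Qed.

Lemma sigma_setI (S : set (set T)) (A B : set T) :
  <<s S >> A -> <<s S >> B -> <<s S >> (A `&` B).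
Proof. exact: (@measurableI _ (g_sigma_algebraType S)). Qed.

Section one_matrix.
Variables (G : T -> 'M[R[i]]_M).
Hypothesis hG : is_GUE P G.
Variables (B : 'I_M * 'I_M -> set R).
Hypothesis mB : forall ab, measurable (B ab).

Let scale (A : set R) := ( *%R (Num.sqrt 2) : R -> R) @^-1` A.

(** The part of a box event that concerns one upper entry: the condition at [(a, b)] falls on its
    real part, the one at [(b, a)] on its imaginary part. *)
Let E (ab : 'I_M * 'I_M) : set T :=
  if ab.1 == ab.2 then (fun w => complex.Re (G w ab.1 ab.2)) @^-1` B ab
  else (fun w => complex.Re (G w ab.1 ab.2)) @^-1` scale (B ab) `&`
       (fun w => complex.Im (G w ab.1 ab.2)) @^-1` scale (B (ab.2, ab.1)).

Lemma gue_event : \bigcap_(ab in setT) (gue_coord G ab @^-1` B ab) =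
  \bigcap_(s in [set: {ab : 'I_M * 'I_M | (ab.1 <= ab.2)%N}]) E (val s).
Proof.
apply/seteqP; split => w /= h.
  move=> [[a b] /= ab] _; rewrite /E/=.
  have := h (a, b) Logic.I; have := h (b, a) Logic.I; rewrite /gue_coord/=.
  rewrite eq_sym; case: eqP => [->//|/eqP nab].
  by rewrite ltnNge ab/= ltn_neqAle ab nab.
move=> [a b] _; rewrite /gue_coord/=; case: eqP => [<-|/eqP nab].
  by have := h (exist _ (a, a) (leqnn a)) Logic.I; rewrite /E/= eqxx.
case: ltnP => ab.
  have := h (exist _ (a, b) (ltnW ab)) Logic.I; rewrite /E/= (negbTE nab).
  by move=> [].
have := h (exist _ (b, a) ab) Logic.I; rewrite /E/= eq_sym (negbTE nab).
by move=> [].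
Qed.

Let scale_measurable A : measurable A -> measurable (scale A).
Proof. by move=> mA; rewrite -[X in measurable X]setTI; exact: mul_measurable. Qed.

Let law_scale A : measurable A -> normal_prob 0 (Num.sqrt (1 / 2)) (scale A) = normal_prob 0 1 A.
Proof.
move=> mA; have s0 : 0 < Num.sqrt 2 :> R by rewrite sqrtr_gt0.
have g0 : 0 < Num.sqrt (1 / 2) :> R by rewrite sqrtr_gt0 divr_gt0.
rewrite (normal_prob_scale s0 g0 mA) -(sqrtrM (1 / 2) (ler0n R 2)).
by rewrite mulrC divfK ?pnatr_eq0// sqrtr1.
Qed.

Let E_re (a b : 'I_M) A : measurable A ->
  complex_sigma (fun w => G w a b) ((fun w => complex.Re (G w a b)) @^-1` A).
Proof.
by move=> mA; apply: sub_sigma_algebra; left; exists A => //; rewrite setTI.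
Qed.

Let E_im (a b : 'I_M) A : measurable A ->
  complex_sigma (fun w => G w a b) ((fun w => complex.Im (G w a b)) @^-1` A).
Proof.
by move=> mA; apply: sub_sigma_algebra; right; exists A => //; rewrite setTI.
Qed.

Let E_sigma ab : complex_sigma (fun w => G w ab.1 ab.2) (E ab).
Proof.
rewrite /E; case: ifP => _; first exact: E_re.
by apply: sigma_setI; [apply: E_re|apply: E_im]; exact: scale_measurable.
Qed.

Lemma gue_event_sigma : matrix_sigma G (\bigcap_(ab in setT) (gue_coord G ab @^-1` B ab)).
Proof.
rewrite gue_event; apply: sigma_bigcap => s; apply: sub_sigma_algebra.
by exists (val s) => //; exact: E_sigma.
Qed.

(** Independence acts in two layers, among the upper entries and then between the two parts of an
    entry; the scaling by [Num.sqrt 2] makes each factor a standard normal probability. *)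
Lemma gue_event_prob : P (\bigcap_(ab in setT) (gue_coord G ab @^-1` B ab)) =
  (\prod_ab normal_prob 0 1 (B ab))%E.
Proof.
rewrite gue_event.
have := GUE_entries hG (J := [set: _]%SET) (E := fun s => E (val s)) (fun s _ => @E_sigma (val s)).
rewrite (_ : [set` [set: _]%SET] = [set: _]); last by apply/seteqP; split => // s _; rewrite /= finset.in_setT.
move=> ->; rewrite prod_triangle; apply: eq_big => [s|[[a b] /= ab] _]; first by rewrite finset.in_setT.
rewrite /E/=; case: eqP => [<-|/eqP nab].
  have [_ h] := GUE_diag hG a.
  by rewrite -[LHS]/(pushforward P (fun w => complex.Re (G w a a)) (B (a, a))) h// sqrtr1.
have lt : (a < b)%N by rewrite ltn_neqAle ab andbT.
have [_ hr] := GUE_re hG lt; have [_ hi] := GUE_im hG lt.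
have := GUE_re_im hG lt (J := [set: bool]%SET) (E := fun c =>
  if c then (fun w => complex.Re (G w a b)) @^-1` scale (B (a, b))
  else (fun w => complex.Im (G w a b)) @^-1` scale (B (b, a))).
rewrite (_ : \bigcap_(_ in _) _ = (fun w => complex.Re (G w a b)) @^-1` scale (B (a, b)) `&`
   (fun w => complex.Im (G w a b)) @^-1` scale (B (b, a))); last first.
  apply/seteqP; split => w /=.
    by move=> h; split; [apply: (h true); rewrite /= finset.in_setT|apply: (h false); rewrite /= finset.in_setT].
  by move=> [h1 h2] [] _.
move=> ->; last first.
  move=> [] _; [exists (scale (B (a, b)))|exists (scale (B (b, a)))];
    by rewrite ?setTI//; exact: scale_measurable.
rewrite (eq_bigl xpredT) => [|c]; last by rewrite finset.in_setT.
rewrite big_bool/=; congr (_ * _)%E.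
  rewrite -[LHS]/(pushforward P (fun w => complex.Re (G w a b)) (scale (B (a, b)))).
  by rewrite hr ?law_scale//; exact: scale_measurable.
rewrite -[LHS]/(pushforward P (fun w => complex.Im (G w a b)) (scale (B (b, a)))).
by rewrite hi ?law_scale//; exact: scale_measurable.
Qed.

End one_matrix.

Lemma gue_coord_measurable (G : T -> 'M[R[i]]_M) ab : is_GUE P G ->
  measurable_fun setT (gue_coord G ab).
Proof.
move=> hG; case: ab => a b; rewrite /gue_coord/=.
case: (ltngtP a b) => [ab|ba|/val_inj <-].
- rewrite (_ : (a == b) = false); last by apply/eqP => e; rewrite e ltnn in ab.
  by apply: measurable_funM => //; have [] := GUE_re hG ab.
- rewrite (_ : (a == b) = false); last by apply/eqP => e; rewrite e ltnn in ba.
  by apply: measurable_funM => //; have [] := GUE_im hG ba.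
- by rewrite eqxx; have [] := GUE_diag hG a.
Qed.

(** Independence among the matrices is the outermost layer; each factor is then a single-matrix box
    event, given by [gue_event_prob]. *)
Lemma gue_gauss_family n (G : 'I_n -> T -> 'M[R[i]]_M) :
  (forall k, is_GUE P (G k)) -> independent P (fun k => matrix_sigma (G k)) ->
  gauss_family P (fun (i : 'I_n * ('I_M * 'I_M)) => gue_coord (G i.1) i.2).
Proof.
move=> hG ind; split; first by move=> i; exact: gue_coord_measurable.
move=> B mB.
pose E k := \bigcap_(ab in setT) (gue_coord (G k) ab @^-1` B (k, ab)).
have sE k : matrix_sigma (G k) (E k).
  by apply: (gue_event_sigma (G := G k) (B := fun ab => B (k, ab))) => ab; exact: mB.
rewrite (_ : \bigcap_(_ in _) _ = \bigcap_(k in [set` [set: 'I_n]%SET]) E k); last first.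
  apply/seteqP; split => w /= h.
    by move=> k _ ab _; exact: (h (k, ab) Logic.I).
  by move=> [k ab] _; apply: (h k _ ab) => //; rewrite /= finset.in_setT.
rewrite (ind [set: 'I_n]%SET E)//.
rewrite (eq_bigl xpredT) => [|c]; last by rewrite finset.in_setT.
transitivity (\prod_k \prod_ab normal_prob 0 1 (B (k, ab)))%E.
  by apply: eq_bigr => k _; exact: (gue_event_prob (hG k)).
by rewrite pair_bigA; apply: eq_bigr => -[].
Qed.

End gue_family.

Local Close Scope sesquilinear_scope.
Unset Implicit Arguments.

Theorem proposition5p3 (R : realType) (d : measure_display)
    (T : measurableType d) (P : probability T R) (n N M : nat)
    (hn : (1 <= n)%N) (hN : (1 <= N)%N) (hM : (1 <= M)%N) (hNM : (N <= M)%N)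
    (A0 : 'M[R[i]]_N) (A : 'I_n -> 'M[R[i]]_N)
    (hA0 : A0 \is hermsymmx) (hA : forall k, psdmx (A k))
    (G : 'I_n -> T -> 'M[R[i]]_M)
    (hG : forall k, is_GUE P (G k))
    (hGind : independent P (fun k => matrix_sigma (G k))) :
  ('E_P[fun w => lambda_max (GUE_pencil A0 A G w)] <=
    (rho_plus A0 A + 6 * Num.sqrt ((n%:R * N%:R) / M%:R)
      * Num.sqrt (opnorm (\sum_(k < n) A k *m A k)))%:E)%E.
Proof.
have gP := gue_gauss_family hG hGind.
pose F w := lambda_max (pencil A0 A (fun i => gue_coord (G i.1) i.2 w)).
have FE w : lambda_max (GUE_pencil A0 A G w) = F w.
  congr lambda_max; rewrite /GUE_pencil /pencil; congr (_ + _ *: _).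
  by apply: eq_bigr => k _; rewrite /= gue_coordK//; exact: (GUE_hermitian (hG k)).
have iF : P.-integrable setT (EFin \o F) := integrable_lambda_max hN hM hA0 hA gP.
have -> : ('E_P[fun w => lambda_max (GUE_pencil A0 A G w)] = (\int[P]_w F w)%:E)%E.
  rewrite unlock /Rintegral fineK; first by apply: eq_integral => w _; rewrite FE.
  exact: (integrable_fin_num measurableT iF).
(* The error term does not involve [Z], so the bound for each fixed [Z] passes to the infimum; the
   identity matrix shows that the set is nonempty. *)
rewrite lee_fin -lerBlDr; apply: lb_le_inf.
  by eexists; exists 1%:M; [exact: posdef1|reflexivity].
move=> _ [Z pZ <-]; rewrite lerBlDr.
exact: (mean_lambda_max hn hN hM hA0 hA gP pZ).
Qed.
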